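(* Let $k$ be an algebraically closed field containing $\kappa$. For every Bruhat–Tits index $(I,\mathbf\Lambda)$, there exists a point $(A_m\subset\dots\subset A_1\subset B_1\subset\dots\subset B_m)\in\mathcal N^{\mathbf h,0}_{I,\mathbf\Lambda}(k)$. In particular, $\mathcal N^{\mathbf h,0}_{I,\mathbf\Lambda}\neq\emptyset$.
   Context: Fields. $p$ is an odd prime, $F/\mathbb Q_p$ a finite extension with ring of integers $\mathcal O_F$, uniformizer $\pi$, residue field $\mathbb F_q$; $E/F$ is the unramified quadratic extension with nontrivial automorphism $x\mapsto x^*$; $\breve E$ is the completion of the maximal unramified extension of $E$, with residue field $\kappa=\overline{\mathbb F}_{q}$. For a perfect field $R\supset\mathbb F_q$, $W_{\mathcal O_F}(R)$ is the ring of relative Witt vectors, $F_R$ its fraction field, $\sigma$ the lift of $x\mapsto x^q$. Fix $n,m\ge 1$ and integers $\mathbf h=(h_1<\dots<h_m)$, $0\le h_i\le n$, all of the same parity. Framing objects. A strict formal $\mathcal O_F$-module is a formal $p$-divisible group with $\mathcal O_F$-action inducing the natural action on its Lie algebra. For $h\in\{h_1,\dots,h_m\}$ fix $\mathbb X^{[h]}=(\mathbb X,i_{\mathbb X},\lambda^{[h]})$: $\mathbb X$ a supersingular strict formal $\mathcal O_F$-module over $\mathbb F_{q^2}$ of relative $F$-height $2n$; $i_{\mathbb X}$ an $\mathcal O_E$-action extending the $\mathcal O_F$-action with $\mathrm{charpol}(i_{\mathbb X}(x)\mid\mathrm{Lie})=(T-x)(T-x^* )^{n-1}$; $\lambda^{[h]}$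 an $\mathcal O_E$-linear polarization (the dual having the action $i_{\mathbb X}(x^* )^\vee$) with kernel contained in $\mathbb X[\pi]$ of order $q^{2h}$. For $h<h'$ among the $h_i$ fix isogenies $\alpha_{h',h}:\mathbb X^{[h']}\to\mathbb X^{[h]}$, compatible with composition, $\mathcal O_E$-actions and polarizations (inducing isometries of Dieudonné isocrystals), with kernel in the $\pi$-torsion of order $q^{h'-h}$; $\alpha_{h,h}=\mathrm{id}$. Moduli space. For an $\mathcal O_E$-scheme $S$ on which $\pi$ is locally nilpotent, with $\bar S=S\times_{\mathcal O_F}\mathbb F_q$, $\mathcal N^h(S)$ is the set of isomorphism classes of $(X,i_X,\lambda_X,\rho_X)$: $X$ a strict formal $\mathcal O_F$-module over $S$ of relative height $2n$, $i_X$ an $\mathcal O_E$-action extending the $\mathcal O_F$-action with $\mathrm{charpol}(i_X(x)\mid\mathrm{Lie}X)=(T-x)(T-x^* )^{n-1}$, $\lambda_X$ an $\mathcal O_E$-linear polarization, $\rho_X:X_{\bar S}\to\mathbb X^{[h]}_{\bar S}$ an $\mathcal O_E$-linear quasi-isogeny of height $0$ with $\rho_X^\vee\lambda^{[h]}\rho_X=\lambda_X$ up to a scalar in $\mathcal O_F^\times$. $\mathcal N^{\mathbf h}(S)$ is the set of tuples $(X^{[i]},i_{X^{[i]}},\lambda_{X^{[i]}},\rho_{X^{[i]}})_{1\le i\le m}$ (up to isomorphism) of elements of $\mathcal N^{h_i}(S)$ such that $\rho_{X^{[i]}}^{-1}\circ\alpha_{h_{i+1},h_i}\circ\rho_{X^{[i+1]}}$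 lifts to an isogeny $X^{[i+1]}\to X^{[i]}$ for $1\le i<m$. After base change to $\mathcal O_{\breve E}$ it is represented by a formal scheme $\mathcal N^{\mathbf h}_{E/F}$; $\mathcal N^{\mathbf h}_{E/F,\mathrm{red}}$ is the reduced special fiber, over $\kappa$. Hermitian space. Let $\mathbb N$ be the rational relative Dieudonné module of $\mathbb X^{[h_1]}$, with $\mathcal F,\mathcal V$ ($\mathcal F\mathcal V=\pi$) and pairing $\langle\cdot,\cdot\rangle$ induced by $\lambda^{[h_1]}$, with $\langle\mathcal Fv,w\rangle=\langle v,\mathcal Vw\rangle^\sigma$ and $\langle i(x)v,w\rangle=\langle v,i(x^* )w\rangle$. For $k\supset\kappa$ algebraically closed, $\mathbb N_k=\mathbb N\otimes F_k=\mathbb N_{k,0}\oplus\mathbb N_{k,1}$, where $E$ acts on $\mathbb N_{k,0}$ via a fixed $F$-isomorphism $\varphi_0:E\simeq F_{\mathbb F_{q^2}}$ and on $\mathbb N_{k,1}$ via its conjugate. Put $\tau=\pi\mathcal V^{-2}$ and $C=\mathbb N_{k,0}^\tau$, an $n$-dimensional $F_{\mathbb F_{q^2}}$-space independent of $k$, with $C_k:=C\otimes F_k=\mathbb N_{k,0}$, $\tau=\mathrm{id}\otimes\sigma^2$. The form $\{v,w\}=\delta\langle v,\mathcal Fw\rangle$ (fixed $\delta\in W_{\mathcal O_F}(\mathbb F_{q^2})^\times$, $\delta^\sigma=-\delta$) is left linear, right $\sigma$-linear, nondegenerate on $C_k$, hermitian on $C$. For a lattice $A$, $A^\vee$ is the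 set of $v$ with $\{v,A\}$ integral. $A\overset{x}{\subset}B$ means $A\subset B$ with $B/A$ of length $x$. $\Lambda_k=\Lambda\otimes W_{\mathcal O_F}(k)$ for a lattice $\Lambda\subset C$. Points. By relative Dieudonné theory $\mathcal N^{\mathbf h}_{E/F}(k)$ is identified with the set of chains of $W_{\mathcal O_F}(k)$-lattices $A_m\subset\dots\subset A_1\subset B_1\subset\dots\subset B_m$ in $C_k$ such that for all $i$: $\pi A_i^\vee\overset{1}{\subset}B_i\subset A_i^\vee$, $\pi B_i^\vee\overset{1}{\subset}A_i\subset B_i^\vee$, $\pi B_i\subset A_i\overset{h_i}{\subset}B_i$. Vertex lattices. $\mathcal L_i$ is the set of $W_{\mathcal O_F}(\mathbb F_{q^2})$-lattices $\Lambda\subset C$ with $\pi^{i+1}\Lambda^\vee\subset\Lambda\subset\pi^i\Lambda^\vee$; the type of $\Lambda\in\mathcal L_i$ is $t(\Lambda)=[\Lambda:\pi^{i+1}\Lambda^\vee]$; $\mathcal L_i^{\ge x}=\{\Lambda\in\mathcal L_i: t(\Lambda)\ge x\}$. Bruhat–Tits index. A pair $(I,\mathbf\Lambda)$: $I$ a non-empty subset of $\{0,\dots,m\}$ with $0\notin I$ if $h_1=0$ and $m\notin I$ if $h_m=n$; $\mathbf\Lambda$ a collection of $\Lambda_0^i\in\mathcal L_0^{\ge h_i+1}$ for $i\in I\setminus\{0\}$ and $\Lambda_1^j\in\mathcal L_1^{\ge n-h_{j+1}+1}$ for $j\in I\setminus\{m\}$ such that, writing $I=\{i_1<\dots<i_s\}$,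 $\Lambda_0^{i_1}\subset\pi\Lambda_1^{i_1\vee}\subset\Lambda_0^{i_2}\subset\pi\Lambda_1^{i_2\vee}\subset\dots\subset\Lambda_0^{i_s}\subset\pi\Lambda_1^{i_s\vee}$, where the first term is omitted if $i_1=0$ and the last term is omitted if $i_s=m$. $(I',\mathbf\Lambda')\subset(I,\mathbf\Lambda)$ means: $I\subset I'$, $\Lambda_0'^{i}\subset\Lambda_0^i$ for all $i\in I\setminus\{0\}$, $\Lambda_1'^{j}\subset\Lambda_1^j$ for all $j\in I\setminus\{m\}$. Strata. For $i\in I\setminus\{0\}$ and $j\in I\setminus\{m\}$ put $\Lambda_0^{i-}=\alpha_{h_i,h_1}^{-1}(\pi\Lambda_0^{i\vee}\oplus\mathcal V(\Lambda_0^{i\vee}))$ and $\Lambda_1^{j+}=\alpha_{h_{j+1},h_1}^{-1}(\Lambda_1^j\oplus\mathcal V^{-1}(\Lambda_1^j))$, the Dieudonné modules of strict formal $\mathcal O_F$-modules with quasi-isogenies $\rho_{\Lambda_0^{i-}}$, $\rho_{\Lambda_1^{j+}}$ over $\kappa$ to $\mathbb X^{[h_i]}$, $\mathbb X^{[h_{j+1}]}$. $\mathcal N^{\mathbf h}_{I,\mathbf\Lambda}$ is the projective closed subscheme of $\mathcal N^{\mathbf h}_{E/F,\mathrm{red}}$ representing the points over $\kappa$-schemes $S$ for which all $\rho_{X^{[i]}}^{-1}\circ(\rho_{\Lambda_0^{i-}})_S$ ($i\in I\setminus\{0\}$) and $(\rho_{\Lambda_1^{j+}})_S^{-1}\circ\rho_{X^{[j+1]}}$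 ($j\in I\setminus\{m\}$) are isogenies. Its $k$-points are the lattice chains with $B_i\subset(\Lambda_0^i)_k$ for $i\in I\setminus\{0\}$ and $A_{j+1}\subset(\Lambda_1^j)_k$ for $j\in I\setminus\{m\}$. Finally $\mathcal N^{\mathbf h,0}_{I,\mathbf\Lambda}=\mathcal N^{\mathbf h}_{I,\mathbf\Lambda}\setminus\bigcup_{(I',\mathbf\Lambda')\subsetneq(I,\mathbf\Lambda)}\mathcal N^{\mathbf h}_{I',\mathbf\Lambda'}$. *)

(* Defs.v *)
From HB Require Import structures.
From mathcomp Require Import all_boot all_algebra fieldext.
From mathcomp Require Import boolp classical_sets.

Set Implicit Arguments.
Unset Strict Implicit.
Unset Printing Implicit Defensive.

Import GRing.Theory.
Local Open Scope classical_set_scope.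
Local Open Scope ring_scope.

(** * Rings of integers

    A ring with fraction field [K] is a subset [O : set K]. *)

Definition is_subring (K : fieldType) (O : set K) : Prop :=
  [/\ O 1, forall x y, O x -> O y -> O (x - y)
         & forall x y, O x -> O y -> O (x * y)].

(* [x \in pi ^ n O] is written [O (x / pi ^+ n)]. *)
Definition adically_complete (K : fieldType) (O : set K) (pi : K) : Prop :=
  (forall x, (forall n, O (x / pi ^+ n)) -> x = 0) /\
  (forall u : nat -> K, (forall n, O (u n)) ->
     (forall n, O ((u n.+1 - u n) / pi ^+ n)) ->
     exists2 l, O l & forall n, O ((l - u n) / pi ^+ n)).

(* [Z] is the p-adic completion of the integers and [Q = Z[1/p]]; this
   determines [(Q, Z)] up to unique isomorphism. *)
Record padic_numbers (p : nat) (Q : fieldType) (Z : set Q) : Prop := {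
  padic_neq0 : p%:R != 0 :> Q;
  padic_subring : is_subring Z;
  padic_complete : adically_complete Z p%:R;
  padic_dense : forall x, Z x -> forall n, exists a : nat, Z ((x - a%:R) / p%:R ^+ n);
  padic_frac : forall x, exists n, Z (p%:R ^+ n * x) }.

Definition integral_closure (K : fieldType) (O : set K) (L : fieldExtType K) : set L :=
  [set x | exists f : {poly K},
     [/\ f \is monic, forall i, O f`_i & root (map_poly (in_alg L) f) x]].
Arguments integral_closure {K} O L.

(* Since [0^-1 = 0], the nonunits of [O], zero aside, are the [x] in [O] with
   [x^-1] not in [O]; in particular such a [pi] is nonzero. *)
Definition uniformizer (K : fieldType) (O : set K) (pi : K) : Prop :=
  [/\ O pi, ~ O pi^-1 & forall x, O x -> ~ O x^-1 -> O (x / pi)].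

(* [r], whose values outside [O] are irrelevant, induces [O / pi O = k]. *)
Record residue_map (K : fieldType) (O : set K) (pi : K) (k : fieldType)
    (r : K -> k) : Prop := {
  res1 : r 1 = 1;
  resD : forall x y, O x -> O y -> r (x + y) = r x + r y;
  resM : forall x y, O x -> O y -> r (x * y) = r x * r y;
  res_surj : forall a, exists2 x, O x & r x = a;
  res_ker : forall x, O x -> (r x = 0 <-> O (x / pi)) }.

(** * Relative Witt vectors

    For a perfect field [R] over the residue field [Fq] of [OF], the ring
    [wint] of relative Witt vectors is the pi-adically complete, pi-torsion free
    [OF]-algebra with reduction [R] modulo pi (it is unique up to unique
    isomorphism); [wfrac] is its fraction field and [wfrob] the automorphism
    lifting the [#|Fq|]-power map of [R]. *)

Record rel_witt (F : fieldType) (OF : set F) (pi : F) (Fq : finFieldType)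
    (resF : F -> Fq) (R : fieldType) (j : Fq -> R) := RelWitt {
  wfrac :> fieldType;
  wint : set wfrac;
  wstr : {rmorphism F -> wfrac};
  wred : wfrac -> R;
  wfrob : {rmorphism wfrac -> wfrac};
  wfrobV : wfrac -> wfrac;
  wint_subring : is_subring wint;
  wint_frac : forall x, exists n, wint (wstr pi ^+ n * x);
  wint_complete : adically_complete wint (wstr pi);
  wred_residue : residue_map wint (wstr pi) wred;
  wstr_int : forall a, OF a -> wint (wstr a);
  wred_str : forall a, OF a -> wred (wstr a) = j (resF a);
  wfrobK : cancel wfrob wfrobV;
  wfrobVK : cancel wfrobV wfrob;
  wfrob_str : forall a, wfrob (wstr a) = wstr a;
  wfrob_int : forall x, wint x -> wint (wfrob x);
  wfrob_red : forall x, wint x -> wred (wfrob x) = wred x ^+ #|Fq| }.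

Arguments wfrac {F OF pi Fq resF R j} _ : rename.
Arguments wint {F OF pi Fq resF R j} _ : rename.
Arguments wstr {F OF pi Fq resF R j} _ : rename.
Arguments wred {F OF pi Fq resF R j} _ : rename.
Arguments wfrob {F OF pi Fq resF R j} _ : rename.
Arguments wfrobV {F OF pi Fq resF R j} _ : rename.

(* The homomorphism of Witt vectors induced by [f : R -> R']. *)
Record witt_map (F : fieldType) (OF : set F) (pi : F) (Fq : finFieldType)
    (resF : F -> Fq) (R R' : fieldType) (j : Fq -> R) (j' : Fq -> R')
    (W : rel_witt OF pi resF j) (W' : rel_witt OF pi resF j')
    (f : R -> R') (chi : W -> W') : Prop := {
  wmap_str : forall a, chi (wstr W a) = wstr W' a;
  wmap_int : forall x, wint W x -> wint W' (chi x);
  wmap_red : forall x, wint W x -> wred W' (chi x) = f (wred W x);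
  wmap_frob : forall x, chi (wfrob W x) = wfrob W' (chi x) }.

(** * Modules and lattices in [K ^ d] over a subring [O] of [K] *)

Section Lattices.
Variables (K : fieldType) (d : nat).
Implicit Types (O : set K) (U A B : set 'rV[K]_d).

Definition submodule O A : Prop :=
  [/\ A 0, forall u v, A u -> A v -> A (u + v)
         & forall a v, O a -> A v -> A (a *: v)].

(* [A] is contained in [B] and the [O]-module [B / A] has length [x]: there is
   a composition series of length [x] from [A] to [B]. *)
Definition colength O A B (x : nat) : Prop :=
  exists s : nat -> set 'rV[K]_d,
  [/\ s 0%N = A, s x = B,
      forall i, (i <= x)%N -> submodule O (s i)
    & forall i, (i < x)%N -> s i `<` s i.+1 /\
        forall M, submodule O M -> s i `<=` M -> M `<=` s i.+1 ->
          M = s i \/ M = s i.+1].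

Definition int_comb O r (e : 'M[K]_(r, d)) : set 'rV[K]_d :=
  [set v | exists2 c : 'rV[K]_r, forall i, O (c 0 i) & v = c *m e].

(* [A] is the free [O]-module on a [K]-basis, with vectors in [U'], of the
   subspace [U]. *)
Definition lattice_on O U (U' : set 'rV[K]_d) A : Prop :=
  exists r (e : 'M[K]_(r, d)),
  [/\ row_free e, forall v, U v <-> (v <= e)%MS,
      forall i, U' (row i e) & A = int_comb O e].

Definition lattice O U A : Prop := lattice_on O U setT A.

Definition extend O A : set 'rV[K]_d :=
  [set v | exists r (e : 'M[K]_(r, d)),
     (forall i, A (row i e)) /\ int_comb O e v].

Definition scale (a : K) A : set 'rV[K]_d := [set a *: v | v in A].

(* The elements [v] of [U] with [b v w] in [O] for all [w] in [A]. *)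
Definition dual O (b : 'rV[K]_d -> 'rV[K]_d -> K) U A : set 'rV[K]_d :=
  [set v | U v /\ forall w, A w -> O (b v w)].

End Lattices.

(** * Polarized relative Dieudonne modules with an action of [E] *)

Definition semilin (K : fieldType) d (s : K -> K) (M : 'M[K]_d) (v : 'rV[K]_d) :
  'rV[K]_d := map_mx s v *m M.

Definition bilin (K : fieldType) d (G : 'M[K]_d) (v w : 'rV[K]_d) : K :=
  (v *m G *m w^T) 0 0.

Section Isocrystals.
Variables (F : fieldType) (OF : set F) (pi : F) (Fq : finFieldType).
Variables (resF : F -> Fq) (E : fieldExtType F) (conjE : E -> E) (n : nat).
Variables (R : fieldType) (j : Fq -> R) (W : rel_witt OF pi resF j).

(* The rational Dieudonne module is [W ^ (2 n)], as row vectors; Frobenius,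
   Verschiebung, the action of [E] and the pairing are given by matrices. *)
Record isocrystal := Isocrystal {
  frob_mx : 'M[W]_(n.*2);
  ver_mx : 'M[W]_(n.*2);
  act : {rmorphism E -> 'M[W]_(n.*2)};
  gram : 'M[W]_(n.*2) }.

Variable D : isocrystal.

Definition frob : 'rV[W]_(n.*2) -> 'rV[W]_(n.*2) := semilin (wfrob W) (frob_mx D).
Definition ver : 'rV[W]_(n.*2) -> 'rV[W]_(n.*2) := semilin (wfrobV W) (ver_mx D).
Definition pairing := bilin (gram D).

Record is_isocrystal : Prop := {
  frob_ver : forall v, frob (ver v) = wstr W pi *: v;
  ver_frob : forall v, ver (frob v) = wstr W pi *: v;
  act_F : forall a : F, act D a%:A = (wstr W a)%:M;
  act_frob : forall x v, frob (v *m act D x) = frob v *m act D x;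
  act_ver : forall x v, ver (v *m act D x) = ver v *m act D x;
  pairing_alt : forall v, pairing v v = 0;
  pairing_nondeg : gram D \in unitmx;
  pairing_frob : forall v w, pairing (frob v) w = wfrob W (pairing v (ver w));
  pairing_act : forall x v w,
    pairing (v *m act D x) w = pairing v (w *m act D (conjE x)) }.

(* All slopes are 1/2. *)
Definition supersingular : Prop :=
  exists2 T, lattice (wint W) setT T &
    [set frob (frob v) | v in T] = scale (wstr W pi) T.

(* The characteristic polynomial of [x] on [Lie = M / ver M] is
   (T - x)(T - conjE x)^(n-1): [e] is a basis of [Lie] over [R], and [G] reduces to
   the matrix of [x] in this basis.  [phi : E -> W] gives the structure map from
   the integers of [E] to [R]. *)
Definition lie_charpol (OE : set E) (phi : E -> W) (M : set 'rV[W]_(n.*2)) : Prop :=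
  let VM := [set ver v | v in M] in
  exists e : 'M[W]_(n, n.*2),
  [/\ forall i, M (row i e),
      forall v, M v -> exists2 c : 'rV[W]_n,
        forall i, wint W (c 0 i) & VM (v - c *m e),
      forall c : 'rV[W]_n, (forall i, wint W (c 0 i)) -> VM (c *m e) ->
        forall i, wred W (c 0 i) = 0
    & forall x, OE x -> exists G : 'M[W]_n,
        [/\ forall a b, wint W (G a b),
            forall i, VM (row i (e *m act D x - G *m e))
          & char_poly (map_mx (wred W) G) =
              ('X - (wred W (phi x))%:P) *
              ('X - (wred W (phi (conjE x)))%:P) ^+ n.-1]].

(* [M] is the Dieudonne module of a framing object whose polarization has
   kernel in the pi-torsion, of order [#|Fq| ^ (2 h)]. *)
Record framing_object (OE : set E) (phi : E -> W) (h : nat)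
    (M : set 'rV[W]_(n.*2)) : Prop := {
  fr_lattice : lattice (wint W) setT M;
  fr_frob : forall v, M v -> M (frob v);
  fr_ver : forall v, M v -> M (ver v);
  fr_act : forall x v, OE x -> M v -> M (v *m act D x);
  fr_lie : lie_charpol OE phi M;
  fr_kernel : scale (wstr W pi) (dual (wint W) pairing setT M) `<=` M;
  fr_order : colength (wint W) M (dual (wint W) pairing setT M) h.*2 }.

(* The Dieudonne modules [M i], 1 <= i <= m, of the framing objects, all seen in
   the rational Dieudonne module of the first one through the isogenies
   [alpha]; the kernel of [alpha] from index [i'] to index [i] corresponds to
   [M i / M i']. *)
Record framing_chain (OE : set E) (phi : E -> W) (m : nat) (h : nat -> nat)
    (M : nat -> set 'rV[W]_(n.*2)) : Prop := {
  frc_object : forall i, (1 <= i <= m)%N -> framing_object OE phi (h i) (M i);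
  frc_kernel : forall i i', (1 <= i)%N -> (i <= i')%N -> (i' <= m)%N ->
    scale (wstr W pi) (M i) `<=` M i';
  frc_order : forall i i', (1 <= i)%N -> (i <= i')%N -> (i' <= m)%N ->
    colength (wint W) (M i') (M i) (h i' - h i) }.

End Isocrystals.

Definition base_change (F : fieldType) (OF : set F) (pi : F) (Fq : finFieldType)
    (resF : F -> Fq) (E : fieldExtType F) (n : nat) (R R' : fieldType)
    (j : Fq -> R) (j' : Fq -> R')
    (W : rel_witt OF pi resF j) (W' : rel_witt OF pi resF j')
    (chi : {rmorphism W -> W'}) (D : isocrystal E n W) : isocrystal E n W' :=
  Isocrystal (map_mx chi (frob_mx D)) (map_mx chi (ver_mx D))
    (map_mx chi \o act D) (map_mx chi (gram D)).

(** * The hermitian space, lattice chains and Bruhat-Tits strata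

    [L] and [Wk] are the fields of relative Witt vectors over the field with
    [#|Fq| ^ 2] elements and over [k].  All lattices of [C] and of [C_k] are
    subsets of the [Wk]-space [Nk]. *)

Section Strata.
Variables (F : fieldType) (OF : set F) (pi : F) (Fq : finFieldType).
Variables (resF : F -> Fq) (E : fieldExtType F) (n : nat).
Variables (Fq2 k : fieldType) (j : Fq -> Fq2) (jk : Fq -> k).
Variables (L : rel_witt OF pi resF j) (Wk : rel_witt OF pi resF jk).
Variables (chi : {rmorphism L -> Wk}) (phi : E -> L) (delta : L).
Variables (D : isocrystal E n L) (m : nat) (h : nat -> nat).

Local Notation Nk := 'rV[Wk]_(n.*2).
Local Notation piW := (wstr Wk pi).
Local Notation Dk := (base_change chi D).

Definition Ck : set Nk :=
  [set v | forall x, v *m act Dk x = chi (phi x) *: v].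

(* The fixed points of [tau = pi ver^-2]. *)
Definition Cfix : set Nk := [set v | Ck v /\ ver Dk (ver Dk v) = piW *: v].

Definition herm (v w : Nk) : Wk := chi delta * pairing Dk v (frob Dk w).

Definition OL : set Wk := chi @` wint L.

(* Duals in [C_k] and in [C]; on [C] the form takes its values in [chi @` setT],
   whose integral elements are those of [OL]. *)
Definition dualk : set Nk -> set Nk := dual (wint Wk) herm Ck.
Definition dualC : set Nk -> set Nk := dual (wint Wk) herm Cfix.

(* As [C] is an [L]-form of [C_k], its [L]-bases are the [Wk]-bases of [C_k]
   with vectors in [C]. *)
Definition latticeC : set Nk -> Prop := lattice_on OL Ck Cfix.

Definition vertex_lattice (i : nat) (A : set Nk) : Prop :=
  [/\ latticeC A, scale (piW ^+ i.+1) (dualC A) `<=` A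
    & A `<=` scale (piW ^+ i) (dualC A)].

Definition vertex_type (i : nat) (A : set Nk) (t : nat) : Prop :=
  colength OL (scale (piW ^+ i.+1) (dualC A)) A t.

Definition vertex_ge (i x : nat) (A : set Nk) : Prop :=
  vertex_lattice i A /\ exists2 t, vertex_type i A t & (x <= t)%N.

(* [N^h(k)]; only the values of [A] and [B] at 1, ..., m are relevant. *)
Definition lattice_chain (A B : nat -> set Nk) : Prop :=
  [/\ forall i, (1 <= i <= m)%N ->
        lattice (wint Wk) Ck (A i) /\ lattice (wint Wk) Ck (B i),
      forall i, (1 <= i < m)%N -> A i.+1 `<=` A i /\ B i `<=` B i.+1
    & forall i, (1 <= i <= m)%N ->
        [/\ colength (wint Wk) (scale piW (dualk (A i))) (B i) 1,
            B i `<=` dualk (A i),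
            colength (wint Wk) (scale piW (dualk (B i))) (A i) 1,
            A i `<=` dualk (B i)
          & scale piW (B i) `<=` A i /\ colength (wint Wk) (A i) (B i) (h i)]].

(* The collections [Lam0] and [Lam1] are relevant on [I :\ 0] and on
   [I :\ m] respectively. *)
Record bt_data := BTData {
  bt_I : {set 'I_m.+1};
  Lam0 : 'I_m.+1 -> set Nk;
  Lam1 : 'I_m.+1 -> set Nk }.

Record bt_index (x : bt_data) : Prop := {
  bt_neq0 : bt_I x != finset.set0;
  bt_first : h 1%N = 0%N -> ord0 \notin bt_I x;
  bt_last : h m = n -> ord_max \notin bt_I x;
  bt_Lam0 : forall i, i \in bt_I x -> i != ord0 -> vertex_ge 0 (h i).+1 (Lam0 x i);
  bt_Lam1 : forall i, i \in bt_I x -> i != ord_max ->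
    vertex_ge 1 (n - h i.+1).+1 (Lam1 x i);
  bt_incl01 : forall i, i \in bt_I x -> i != ord0 -> i != ord_max ->
    Lam0 x i `<=` scale piW (dualC (Lam1 x i));
  bt_incl10 : forall i i', i \in bt_I x -> i' \in bt_I x -> (i < i')%N ->
    scale piW (dualC (Lam1 x i)) `<=` Lam0 x i' }.

Definition bt_le (y x : bt_data) : Prop :=
  [/\ bt_I x \subset bt_I y,
      forall i, i \in bt_I x -> i != ord0 -> Lam0 y i `<=` Lam0 x i
    & forall i, i \in bt_I x -> i != ord_max -> Lam1 y i `<=` Lam1 x i].

(* The order is antisymmetric up to irrelevant values. *)
Definition bt_lt (y x : bt_data) : Prop := bt_le y x /\ ~ bt_le x y.

(* The k-points of the closed subscheme attached to [x]. *)
Definition closed_stratum (x : bt_data) (A B : nat -> set Nk) : Prop :=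
  [/\ lattice_chain A B,
      forall i, i \in bt_I x -> i != ord0 -> B i `<=` extend (wint Wk) (Lam0 x i)
    & forall i, i \in bt_I x -> i != ord_max ->
        A i.+1 `<=` extend (wint Wk) (Lam1 x i)].

Definition open_stratum (x : bt_data) (A B : nat -> set Nk) : Prop :=
  closed_stratum x A B /\
  ~ exists y, [/\ bt_index y, bt_lt y x & closed_stratum y A B].

End Strata.

(* Main.v *)
(* In a basis of [C], the space [C_k] becomes [K^n] with [tau] acting as [sigma^2] on
   the coordinates, the form is given by a hermitian matrix [H], and the lattices of
   [C] become the [tau]-stable lattices.  The Lie algebra condition on a framing object
   forces [val (det H) = n - 1 - h_i] modulo 2.

   Put [P_j = pi Lam1_j^v].  The [Lam0_i] and the [P_j] form a chain of [tau]-stable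
   lattices.  Let [P < Q] be two neighbours in this chain.  By Lang's theorem the
   residue space [Q / P], on which [tau] is bijective and [sigma^2]-linear, has a basis
   of the form [x, tau x, tau^2 x, ...].  With [Y_u = P + <x, ..., tau^(u-1) x>], a
   stable lattice containing [Y_u], [u > 0], contains [Q], and a stable lattice inside
   [Y_u], [Y_u <> Q], lies in [P].  Since [Y_u^vv = tau Y_u] has colength 1 in
   [Y_(u+1)], the pairs [B_i = Y_(u+1)], [A_i = pi Y_u^v] satisfy the conditions on
   chains, [u] being determined by [h_i].

   At the two ends of the chain one takes [Q = P^v], respectively [P = pi Q^v] with the
   roles of [A_i] and [B_i] exchanged, and [Y_u] must moreover be isotropic for the form
   induced on [Q / P].  The latter is sesquilinear with cosquare [tau]; over an
   algebraically closed field all nondegenerate such forms are equivalent, so that [x]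
   can be chosen with a prescribed Toeplitz Gram matrix.

   If the point lies in the closed stratum of an index [y], the lattices of [y] are
   stable and contain the [B_i] and [A_i], hence contain those of [x]; an index of [y]
   outside that of [x] would give a stable lattice between [B_i] and [pi A_(i+1)^v]. *)

Require Import Defs.
From HB Require Import structures.
From mathcomp Require Import all_boot all_order fingroup perm all_algebra falgebra fieldext finfield.
From mathcomp Require Import boolp classical_sets.
From mathcomp Require Import zify ring.

Set Implicit Arguments.
Unset Strict Implicit.
Unset Printing Implicit Defensive.

Import Order.TTheory GRing.Theory Num.Theory.
Local Open Scope classical_set_scope.
Local Open Scope ring_scope.

(** The obstacle is that [u] has to be an integer. Away from the lower end, the difference of
    volumes gives [h_i = n - v(det H) - 2 p + 2 u + 1] with [p] the volume of [P], so a solution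
    exists only because the parity of [v(det H)] is known. Modulo 2 it is [h_1 + n - l], where [l]
    is the dimension of the part of the Lie algebra on which [E] acts through [phi0]; the signature
    [(1, n - 1)] makes [l] odd.

    The position of [u] is then automatic: the bounds on the types of the two neighbouring vertex
    lattices say that [u] lies inside the chain, and at the two ends [0 <= h_i <= n] says that [Y_u]
    stays in the isotropic half.

    At an end, [x] has to meet two demands at once: its iterates under [tau] form a basis, and the
    form vanishes on the early ones. They do not conflict, since the cosquare is determined by the
    form: an equivalence with a Toeplitz form whose cosquare is a cyclic shift carries [tau] to that
    shift.

    Odd residue characteristic enters in the diagonalisation of hermitian forms, in the
    invertibility of the Toeplitz matrices of even size, and in the mean of the two eigenvalues on
    the Lie algebra. *)

Record is_dvr (K : fieldType) (O : set K) (pi : K) (k : fieldType) (r : K -> k) :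
  Prop := {
  dvr_subring : is_subring O;
  dvr_frac : forall x, exists n, O (pi ^+ n * x);
  dvr_complete : adically_complete O pi;
  dvr_residue : residue_map O pi r;
  dvr_pi_neq0 : pi != 0;
  dvr_pi : O pi }.

(** * Subrings of a field and matrices with entries in them *)

Section SubringTheory.
Variables (K : fieldType) (O : set K).
Hypothesis subO : is_subring O.

Lemma ring1 : O 1. Proof. by case: subO. Qed.
Lemma ringB x y : O x -> O y -> O (x - y). Proof. by case: subO => _ h _; apply: h. Qed.
Lemma ringM x y : O x -> O y -> O (x * y). Proof. by case: subO => _ _; apply. Qed.
Lemma ring0 : O 0. Proof. by rewrite -(subrr 1); apply: ringB; apply: ring1. Qed.
Lemma ringN x : O x -> O (- x).
Proof. by move=> Ox; rewrite -sub0r; apply: ringB => //; apply: ring0. Qed.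
Lemma ringD x y : O x -> O y -> O (x + y).
Proof. by move=> Ox Oy; rewrite -[y]opprK; apply/ringB/ringN. Qed.
Lemma ringX x n : O x -> O (x ^+ n).
Proof.
by move=> Ox; elim: n => [|n IH]; rewrite ?expr0 ?exprS; [apply: ring1|apply: ringM].
Qed.
Lemma ring_sum (I : Type) (s : seq I) (P : pred I) (F : I -> K) :
  (forall i, P i -> O (F i)) -> O (\sum_(i <- s | P i) F i).
Proof. by move=> H; apply: (big_ind O) => //; [apply: ring0|apply: ringD]. Qed.
Lemma ring_prod (I : Type) (s : seq I) (P : pred I) (F : I -> K) :
  (forall i, P i -> O (F i)) -> O (\prod_(i <- s | P i) F i).
Proof. by move=> H; apply: (big_ind O) => //; [apply: ring1|apply: ringM]. Qed.
Lemma ring_nat n : O n%:R.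
Proof. by elim: n => [|n IH]; rewrite ?mulr0n ?mulrS; [apply: ring0|apply: ringD => //; apply: ring1]. Qed.

Definition intmx m n (A : 'M[K]_(m, n)) := forall i j, O (A i j).

Lemma intmx_mul m n p (A : 'M_(m, n)) (B : 'M_(n, p)) :
  intmx A -> intmx B -> intmx (A *m B).
Proof. by move=> IA IB i j; rewrite mxE; apply: ring_sum => l _; apply: ringM. Qed.
Lemma intmx_add m n (A B : 'M_(m, n)) : intmx A -> intmx B -> intmx (A + B).
Proof. by move=> IA IB i j; rewrite mxE; apply: ringD. Qed.
Lemma intmx_sub m n (A B : 'M_(m, n)) : intmx A -> intmx B -> intmx (A - B).
Proof. by move=> IA IB i j; rewrite !mxE; apply: ringB. Qed.
Lemma intmx_scale m n a (A : 'M_(m, n)) : O a -> intmx A -> intmx (a *: A).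
Proof. by move=> Oa IA i j; rewrite mxE; apply: ringM. Qed.
Lemma intmx_delta m n i0 j0 : intmx (delta_mx i0 j0 : 'M_(m, n)).
Proof. by move=> i j; rewrite mxE; apply: ring_nat. Qed.
Lemma intmx_det n (A : 'M_n) : intmx A -> O (\det A).
Proof.
move=> IA; apply: ring_sum => s _; apply: ringM.
  by apply/ringX/ringN/ring1.
by apply: ring_prod => i _; apply: IA.
Qed.
Lemma intmx_adj n (A : 'M_n) : intmx A -> intmx (\adj A).
Proof.
move=> IA i j; rewrite mxE; apply: ringM; first by apply/ringX/ringN/ring1.
by apply: intmx_det => a b; rewrite !mxE; apply: IA.
Qed.
Lemma intmx_inv n (A : 'M_n) : intmx A -> O (\det A)^-1 -> intmx (invmx A).
Proof.
move=> IA Od; rewrite /invmx; case: ifP => // _.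
by apply: intmx_scale => //; apply: intmx_adj.
Qed.
Lemma intmx_row m n (A : 'M_(m, n)) : (forall i, intmx (row i A)) -> intmx A.
Proof. by move=> H i j; have := H i 0 j; rewrite mxE. Qed.

End SubringTheory.

(** * Complete discrete valuation rings *)

Section DvrTheory.
Variables (K : fieldType) (O : set K) (pi : K) (k : fieldType) (r : K -> k).
Hypothesis dvr : is_dvr O pi r.
Let subO := dvr_subring dvr.
Let resO := dvr_residue dvr.
Let pi0 := dvr_pi_neq0 dvr.
Let Opi := dvr_pi dvr.

Lemma dvr_red0 : r 0 = 0.
Proof.
have O0 := ring0 subO.
by apply: (addrI (r 0)); rewrite -(resD resO) // !addr0.
Qed.

Lemma dvr_redN x : O x -> r (- x) = - r x.
Proof.
move=> Ox; apply: (addrI (r x)); rewrite -(resD resO) //; last exact: ringN.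
by rewrite !subrr dvr_red0.
Qed.

Lemma dvr_redB x y : O x -> O y -> r (x - y) = r x - r y.
Proof. by move=> Ox Oy; rewrite (resD resO) ?dvr_redN //; apply: ringN. Qed.

Lemma dvr_red_sum (I : Type) (s : seq I) (P : pred I) (F : I -> K) :
  (forall i, O (F i)) ->
  r (\sum_(i <- s | P i) F i) = \sum_(i <- s | P i) r (F i).
Proof.
move=> OF; elim: s => [|a s IH]; first by rewrite !big_nil dvr_red0.
by rewrite !big_cons; case: ifP => // _; rewrite (resD resO) ?IH //; apply: ring_sum.
Qed.

Lemma dvr_npiV : ~ O pi^-1.
Proof.
rewrite -[pi^-1]mul1r => /(res_ker resO (ring1 subO)).
by rewrite (res1 resO) => /eqP; rewrite oner_eq0.
Qed.

Lemma dvr_red_pi x : O x -> r (pi * x) = 0.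
Proof.
by move=> Ox; apply/(res_ker resO); [apply: ringM|rewrite mulrAC divff ?mul1r].
Qed.

(** Completeness is what makes this work: a lift [y] of the inverse residue gives [x * y = 1 - w]
    with [w] divisible by [pi], and the geometric series in [w] converges to the inverse of
    [1 - w]. *)
Lemma dvr_unit x : O x -> r x != 0 -> O x^-1.
Proof.
move=> Ox rx; have [y Oy ry] := res_surj resO (r x)^-1.
have Oxy := ringM subO Ox Oy.
pose w := 1 - x * y; pose z := w / pi.
have Oz : O z.
  apply/(res_ker resO); first by apply: ringB => //; apply: ring1.
  by rewrite dvr_redB ?(res1 resO) ?(resM resO) ?ry ?divff ?subrr //; apply: ring1.
have wE : w = pi * z by rewrite mulrC divfK.
have [sep /(_ (fun n => \sum_(i < n) w ^+ i))] := dvr_complete dvr.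
case=> [n|n|l Ol Hl].
- by apply: ring_sum => // i _; apply: ringX => //; rewrite wE; apply: ringM.
- rewrite big_ord_recr /= addrAC subrr add0r wE exprMn mulrAC divff ?expf_neq0 // mul1r.
  exact: ringX.
suff lxy : 1 - l * (1 - w) = 0.
  have <- : y * l = x^-1; last exact: ringM.
  have x0 : x != 0 by apply: contraNneq rx => ->; rewrite dvr_red0.
  apply: (mulfI x0); rewrite divff //; apply/esym/eqP.
  by rewrite -subr_eq0 -lxy /w; apply/eqP; ring.
apply: sep => n.
have -> : 1 - l * (1 - w) = w ^+ n - (l - \sum_(i < n) w ^+ i) * (1 - w).
  by have := subrX1 w n; set S := \sum_(i < n) _ => /eqP; rewrite subr_eq => /eqP ->; ring.
rewrite mulrBl {1}wE exprMn [pi ^+ n * _]mulrC mulfK ?expf_neq0 //.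
apply: ringB => //; first exact: ringX.
rewrite mulrAC; apply: ringM => //; apply: ringB; rewrite ?wE //; first exact: ring1.
exact: ringM.
Qed.

Definition pival_rel (x : K) (z : int) := O (x / pi ^ z) /\ O (pi ^ z / x).

Lemma exprz_pi_neq0 z : pi ^ z != 0.
Proof. by rewrite expfz_neq0. Qed.

(** By separatedness, division of [pi ^+ N * x] by [pi] stops; the last integral quotient has
    nonzero residue, hence is a unit. *)
Lemma pival_ex x : x != 0 -> exists z, pival_rel x z.
Proof.
move=> x0; have [N ON] := dvr_frac dvr x.
set y := pi ^+ N * x in ON.
have y0 : y != 0 by rewrite mulf_neq0 ?expf_neq0.
have [n [On nOn]] : exists n, O (y / pi ^+ n) /\ ~ O (y / pi ^+ n.+1).
  apply: contrapT => nex; have [sep _] := dvr_complete dvr.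
  case/eqP: y0; apply: sep; elim=> [|n IH]; first by rewrite expr0 divr1.
  by apply: contrapT => H; apply: nex; exists n.
have Ou : O (y / pi ^+ n)^-1.
  apply: dvr_unit => //; apply/eqP => /(res_ker resO On).
  by rewrite -mulrA -invfM -exprSr.
exists (n%:Z - N%:Z).
have E : x / pi ^ (n%:Z - N%:Z) = y / pi ^+ n.
  rewrite /y expfzDr // -invr_expz -!exprnP; field.
  by rewrite !expf_neq0.
by split; rewrite ?E // -invf_div E.
Qed.

Lemma pival_uniq x z z' : x != 0 -> pival_rel x z -> pival_rel x z' -> z = z'.
Proof.
move=> x0 h h'.
suff aux u v : pival_rel x u -> pival_rel x v -> (u <= v)%R by apply/eqP; rewrite eq_le !aux.
move=> [h1 _] [_ h2]; rewrite leNgt; apply/negP => lt.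
have [m Em] : exists m : nat, u = v + m.+1%:Z by exists (absz (u - v)).-1; lia.
apply: dvr_npiV; have -> : pi^-1 = pi ^+ m * ((pi ^ v / x) * (x / pi ^ u)).
  rewrite Em expfzDr // -exprnP exprSr; field.
  by rewrite x0 pi0 expf_neq0 ?exprz_pi_neq0.
by apply: ringM => //; [apply: ringX|apply: ringM].
Qed.

(* The normalised valuation, with junk value [0] at [0]. *)
Definition pival (x : K) : int := if x == 0 then 0 else xget 0 (pival_rel x).

Lemma pivalP x : x != 0 -> pival_rel x (pival x).
Proof.
by move=> x0; have [z Hz] := pival_ex x0; rewrite /pival (negPf x0); case: xgetP => // /(_ z).
Qed.

Lemma pival_eq x z : x != 0 -> pival_rel x z -> pival x = z.
Proof. by move=> x0; apply: pival_uniq => //; apply: pivalP. Qed.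

Lemma pivalM x y : x != 0 -> y != 0 -> pival (x * y) = pival x + pival y.
Proof.
move=> x0 y0; apply: pival_eq; first exact: mulf_neq0.
have [a b] := pivalP x0; have [c d] := pivalP y0.
by rewrite /pival_rel expfzDr //; split; rewrite invfM mulrACA; apply: ringM.
Qed.

Lemma pivalV x : x != 0 -> pival x^-1 = - pival x.
Proof.
move=> x0; apply: pival_eq; rewrite ?invr_eq0 //; have [a b] := pivalP x0.
by split; rewrite -invr_expz invrK mulrC.
Qed.

Lemma pival1 : pival 1 = 0.
Proof. by apply: pival_eq; rewrite ?oner_neq0 //; split; rewrite expr0z divr1; apply: ring1. Qed.

Lemma pival_pi : pival pi = 1.
Proof. by apply: pival_eq => //; split; rewrite expr1z divff //; apply: ring1. Qed.

Lemma pivalX x n : x != 0 -> pival (x ^+ n) = pival x *+ n.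
Proof.
move=> x0; elim: n => [|n IH]; first by rewrite expr0 pival1.
by rewrite exprS pivalM ?expf_neq0 // IH mulrS.
Qed.

Lemma pivalN x : pival (- x) = pival x.
Proof.
have [->|x0] := eqVneq x 0; first by rewrite oppr0.
apply: pival_eq; rewrite ?oppr_eq0 //; have [a b] := pivalP x0.
by split; rewrite ?invrN ?mulNr ?mulrN; apply: ringN.
Qed.

Lemma pival_ge0 x : x != 0 -> O x <-> (0 <= pival x)%R.
Proof.
move=> x0; have [a b] := pivalP x0; split=> [Ox|].
  rewrite leNgt; apply/negP => lt.
  have [m Em] : exists m : nat, pival x = - m.+1%:Z by exists (absz (pival x)).-1; lia.
  apply: dvr_npiV; have -> : pi^-1 = pi ^+ m * (pi ^ pival x / x * x).
    by rewrite divfK // Em -invr_expz -exprnP exprSr; field; rewrite pi0 expf_neq0.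
  by apply: ringM => //; [apply: ringX|apply: ringM].
move=> ge; rewrite -[x](divfK (exprz_pi_neq0 (pival x))); apply: ringM => //.
by case: (pival x) ge => // m _; apply: ringX.
Qed.

Lemma pival0 : pival 0 = 0. Proof. by rewrite /pival eqxx. Qed.

Lemma pival_int x : O x -> (0 <= pival x)%R.
Proof. by have [->|x0] := eqVneq x 0; [rewrite pival0|move/pival_ge0; apply]. Qed.

Lemma pival_unit x : O x -> O x^-1 -> pival x = 0.
Proof.
have [->|x0] := eqVneq x 0; first by rewrite pival0.
move=> /pival_int h /pival_int; rewrite pivalV // => h'; apply/eqP; rewrite eq_le h andbT.
by rewrite -oppr_ge0.
Qed.

Lemma pival_red x : O x -> r x != 0 -> pival x = 0.
Proof. by move=> Ox rx; apply: pival_unit => //; apply: dvr_unit. Qed.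

End DvrTheory.

(** * Lattices and their volumes *)

Section RowReplace.
Variables (K : fieldType) (d : nat) (i : 'I_d).

Definition row_replace (w : 'rV[K]_d) : 'M[K]_d :=
  \matrix_(a, b) if a == i then w 0 b else (a == b)%:R.

Lemma row_row_replace (w : 'rV[K]_d) : row i (row_replace w) = w.
Proof. by apply/rowP => b; rewrite !mxE eqxx. Qed.

Lemma row_row_replace_neq (w : 'rV[K]_d) a : a != i -> row a (row_replace w) = delta_mx 0 a.
Proof. by move=> ai; apply/rowP => b; rewrite !mxE (negPf ai) eqxx eq_sym. Qed.

Lemma det_row_replace (w : 'rV[K]_d) : \det (row_replace w) = w 0 i.
Proof.
rewrite (expand_det_col _ i) (bigD1 i) //= mxE eqxx big1 => [|a ai]; last first.
  by rewrite mxE (negPf ai) mul0r.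
rewrite addr0 /cofactor -signr_odd addnn odd_double expr0 mul1r.
suff -> : row' i (col' i (row_replace w)) = 1%:M by rewrite det1 mulr1.
apply/matrixP => a b; by rewrite !mxE eq_sym (negPf (neq_lift _ _)) (inj_eq lift_inj).
Qed.

(** The inverse of an identity matrix with row [i] replaced has the same shape; this is its row
    [i]. *)
Definition row_replaceV (w : 'rV[K]_d) : 'rV[K]_d :=
  \row_(b < d) if b == i then (w 0 i)^-1 else - (w 0 b / w 0 i).

Lemma row_replaceK (w : 'rV[K]_d) : w 0 i != 0 ->
  row_replace (row_replaceV w) *m row_replace w = 1%:M.
Proof.
move=> wi; apply/row_matrixP => a; rewrite row_mul.
have [->|ai] := eqVneq a i; last first.
  by rewrite row_row_replace_neq // -rowE row_row_replace_neq // row1.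
rewrite row_row_replace; apply/rowP => b; rewrite !mxE (bigD1 i) //= !mxE !eqxx.
have [->|bi] := eqVneq b i.
  rewrite mulVf // big1 ?addr0 // => j ji.
  by rewrite !mxE (negPf ji) mulr0.
rewrite (bigD1 b) //= !mxE (negPf bi) eqxx mulr1 big1 => [|j /andP[ji jb]].
  by rewrite addr0 mulrC subrr.
by rewrite !mxE (negPf ji) (negPf jb) mulr0.
Qed.

End RowReplace.

Section Submodules.
Variables (K : fieldType) (d : nat) (O : set K).
Hypothesis subO : is_subring O.
Implicit Types (A B M : set 'rV[K]_d) (v : 'rV[K]_d).

Definition adjoin A v : set 'rV[K]_d := [set u | exists2 c, O c & A (u - c *: v)].

Lemma submoduleN A v : submodule O A -> A v -> A (- v).
Proof.
by case=> _ _ AZ Av; rewrite -scaleN1r; apply: AZ => //; apply/(ringN subO)/(ring1 subO).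
Qed.

Lemma submoduleB A u v : submodule O A -> A u -> A v -> A (u - v).
Proof. by move=> sA Au Av; have [_ AD _] := sA; apply: AD => //; apply: submoduleN. Qed.

Lemma submodule_sum A (I : Type) (s : seq I) (P : pred I) F :
  submodule O A -> (forall i, P i -> A (F i)) -> A (\sum_(i <- s | P i) F i).
Proof. by move=> [A0 AD _] AF; apply: (big_ind A). Qed.

Lemma adjoin_sub A v : A `<=` adjoin A v.
Proof. by move=> u Au; exists 0; rewrite ?scale0r ?subr0 //; apply: (ring0 subO). Qed.

Lemma adjoin_self A v : submodule O A -> adjoin A v v.
Proof. by case=> A0 _ _; exists 1; rewrite ?scale1r ?subrr //; apply: (ring1 subO). Qed.

Lemma submodule_adjoin A v : submodule O A -> submodule O (adjoin A v).
Proof.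
move=> [A0 AD AZ]; split=> [|u w [c Oc Hu] [b Ob Hw]|a u Oa [c Oc Hu]].
- by exists 0; rewrite ?scale0r ?subr0 //; apply: (ring0 subO).
- exists (c + b); first exact: (ringD subO).
  by rewrite scalerDl opprD addrACA; apply: AD.
- by exists (a * c); [apply: (ringM subO)|rewrite -scalerA -scalerBr; apply: AZ].
Qed.

Lemma adjoin_le A B v : submodule O B -> A `<=` B -> B v -> adjoin A v `<=` B.
Proof.
move=> [B0 BD BZ] AB Bv u [c Oc /AB Hu].
by rewrite -[u](subrK (c *: v)); apply: BD => //; apply: BZ.
Qed.

Lemma int_comb_sub r (g : 'M[K]_(r, d)) A :
  submodule O A -> (forall i, A (row i g)) -> int_comb O g `<=` A.
Proof.
move=> sA Ag u [c Oc ->]; have [_ _ AZ] := sA; rewrite mulmx_sum_row.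
by apply: submodule_sum => // i _; apply: AZ.
Qed.

Lemma submodule_int_comb r (g : 'M[K]_(r, d)) : submodule O (int_comb O g).
Proof.
split=> [|u v [a Oa ->] [b Ob ->]|a v Oa [c Oc ->]].
- by exists 0; rewrite ?mul0mx // => i; rewrite mxE; apply: (ring0 subO).
- by exists (a + b); rewrite ?mulmxDl // => i; rewrite mxE; apply: (ringD subO).
- by exists (a *: c); rewrite ?scalemxAl // => i; rewrite mxE; apply: (ringM subO).
Qed.

Lemma int_comb_row r (g : 'M[K]_(r, d)) i : int_comb O g (row i g).
Proof.
exists (delta_mx 0 i); rewrite ?rowE // => j; rewrite mxE; apply: (ring_nat subO).
Qed.

Lemma int_comb_mul r s (g : 'M[K]_(r, d)) (c : 'M[K]_(s, r)) :
  intmx O c -> int_comb O (c *m g) `<=` int_comb O g.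
Proof.
move=> Ic; apply: int_comb_sub; first exact: submodule_int_comb.
by move=> i; rewrite row_mul; exists (row i c) => // j; rewrite mxE.
Qed.

End Submodules.

Section Lat.
Variables (K : fieldType) (O : set K) (pi : K) (k : fieldType) (r : K -> k).
Hypothesis dvr : is_dvr O pi r.
Let subO := dvr_subring dvr.
Let resO := dvr_residue dvr.
Let pi0 := dvr_pi_neq0 dvr.
Let Opi := dvr_pi dvr.
Variable d : nat.
Implicit Types (A B M : set 'rV[K]_d) (v : 'rV[K]_d) (g : 'M[K]_d).
Local Notation lat g := (int_comb O g).
Local Notation pival := (pival O pi).

Lemma mem_lat g v : g \in unitmx -> lat g v <-> intmx O (v *m invmx g).
Proof.
move=> gu; split=> [[c Oc ->] i j|H]; first by rewrite mulmxK // ord1.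
by exists (v *m invmx g) => //; rewrite mulmxKV.
Qed.

Lemma lat_subP g g' : g' \in unitmx -> lat g `<=` lat g' <-> intmx O (g *m invmx g').
Proof.
move=> gu; split=> [H|H].
  by apply: intmx_row => i; rewrite row_mul; apply/mem_lat/H/int_comb_row.
by rewrite -[g](mulmxKV gu); apply: int_comb_mul.
Qed.

Lemma det_neq0 g : g \in unitmx -> \det g != 0.
Proof. by rewrite unitmxE unitfE. Qed.

(* [z] is the colength of [A] relative to the standard lattice, so that colengths
   become differences of volumes. *)
Definition isvol A (z : int) := exists g, [/\ g \in unitmx, A = lat g & pival (\det g) = z].

Lemma isvol_submodule A z : isvol A z -> submodule O A.
Proof. by case=> g [_ -> _]; apply: submodule_int_comb. Qed.

Lemma isvol_le A B a b : isvol A a -> isvol B b -> A `<=` B -> (b <= a)%R.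
Proof.
move=> [g [gu -> <-]] [g' [gu' -> <-]] /(lat_subP _ gu') /(intmx_det subO).
move/(pival_int dvr); rewrite det_mulmx (pivalM dvr) ?det_neq0 ?unitmx_inv //.
by rewrite det_inv (pivalV dvr) ?det_neq0 // subr_ge0.
Qed.

(** The transition matrix is integral and its determinant has valuation 0, so its inverse is
    integral too. *)
Lemma isvol_eq A B a : isvol A a -> isvol B a -> A `<=` B -> A = B.
Proof.
move=> [g [gu -> gE]] [g' [gu' -> gE']] AB; apply/seteqP; split=> //.
apply/(lat_subP _ gu).
have -> : g' *m invmx g = invmx (g *m invmx g').
  apply: (can_inj (mulKmx (_ : g *m invmx g' \in unitmx))).
    by rewrite unitmx_mul gu unitmx_inv.
  by rewrite mulmxV ?unitmx_mul ?gu ?unitmx_inv // mulmxA mulmxKV // mulmxV.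
apply: intmx_inv => //; first by apply/(lat_subP _ gu').
apply/(pival_ge0 dvr); rewrite ?invr_eq0 ?det_neq0 ?unitmx_mul ?gu ?unitmx_inv //.
rewrite det_mulmx det_inv (pivalV dvr) ?mulf_neq0 ?invr_eq0 ?det_neq0 //.
by rewrite (pivalM dvr) ?invr_eq0 ?det_neq0 // (pivalV dvr) ?det_neq0 // gE gE' subrr.
Qed.

Lemma isvol_uniq A a b : isvol A a -> isvol A b -> a = b.
Proof. by move=> ha hb; apply/eqP; rewrite eq_le !(isvol_le _ _ (@subset_refl _ A)). Qed.

(** An element of [M] outside [A] is [c *: v] modulo [A] with [c] a unit, because [pi *: v] lies in
    [A]; hence [M] contains [v]. *)
Lemma adjoin_simple A v M : submodule O A -> A (pi *: v) -> submodule O M ->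
  A `<=` M -> M `<=` adjoin O A v -> M = A \/ M = adjoin O A v.
Proof.
move=> sA Apv sM AM MAv; have [MA|/existsNP[u /not_implyP[Mu nAu]]] :=
  pselect (M `<=` A); [left|right]; apply/seteqP; split=> //.
have [_ AD AZ] := sA; have [_ MD MZ] := sM.
apply: adjoin_le => //; have [c Oc Hu] := MAv _ Mu.
have rc : r c != 0.
  apply/eqP => /(res_ker resO Oc) Oc'; apply: nAu; rewrite -[u](subrK (c *: v)).
  by apply: AD => //; rewrite -[c](divfK pi0) -scalerA; apply: AZ.
have c0 : c != 0 by apply: contraNneq rc => ->; rewrite (dvr_red0 dvr).
have -> : v = c^-1 *: (u - (u - c *: v)) by rewrite subKr scalerA mulVf ?scale1r.
apply: MZ; first exact: (dvr_unit dvr).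
by apply: (submoduleB subO) => //; apply: AM.
Qed.

(** In a basis of [A] the coordinates [u] of [pi *: v] are integral and some [u_i] is a unit.
    Replacing the [i]-th basis vector by [v] gives a basis of the larger lattice, and multiplies the
    determinant by [u_i / pi]. *)
Lemma adjoin_vol A v a : isvol A a -> A (pi *: v) -> ~ A v -> isvol (adjoin O A v) (a - 1).
Proof.
move=> [g [gu -> <-]] /(mem_lat _ gu) Ipv nAv.
set w := v *m invmx g; pose u := pi *: w.
have Iu : intmx O u by rewrite /u scalemxAl.
have wgE : w *m g = v by rewrite mulmxKV.
have {}nAv : ~ intmx O w by move/(mem_lat _ gu).
have uE c : u 0 c = pi * w 0 c by rewrite mxE.
have wE c : w 0 c = u 0 c / pi by rewrite uE mulrC mulKf.
clearbody w u.
have [i rui] : exists i, r (u 0 i) != 0.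
  apply: contrapT => H; apply: nAv => z b; rewrite ord1.
  have : r (u 0 b) = 0 by apply: contrapT => /eqP ru; apply: H; exists b.
  by move/(res_ker resO (Iu 0 b)); rewrite wE.
have ui0 : u 0 i != 0 by apply: contraNneq rui => ->; rewrite (dvr_red0 dvr).
have wi0 : w 0 i != 0 by apply: contraNneq ui0; rewrite uE => ->; rewrite mulr0.
have Oui := dvr_unit dvr (Iu _ _) rui.
have TK := row_replaceK wi0.
set T := row_replace i w in TK; set T' := row_replace i _ in TK.
have Tu : T \in unitmx by have /mulmx1_unit[] := TK.
have IT' : intmx O T'.
  move=> z b; rewrite !mxE; case: ifP => // _; last exact: (ring_nat subO).
  have -> : (w 0 i)^-1 = pi / u 0 i by rewrite uE; field; rewrite wi0 pi0.
  case: ifP => // _; first exact: (ringM subO).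
  apply: (ringN subO); rewrite !wE.
  have -> : u 0 b / pi * (pi / u 0 i) = u 0 b / u 0 i by field; rewrite ui0 pi0.
  exact: (ringM subO).
have T'E : T' = invmx T by rewrite -[T'](mulmxK Tu) TK mul1mx.
have gT : lat g `<=` lat (T *m g).
  by rewrite -{1}[g](mulKmx Tu) -T'E; apply: int_comb_mul.
exists (T *m g); rewrite unitmx_mul Tu gu; split=> //; last first.
  rewrite det_mulmx det_row_replace (pivalM dvr) ?det_neq0 // addrC; congr (_ + _).
  by rewrite wE (pivalM dvr) ?invr_eq0 // (pivalV dvr) // (pival_pi dvr) (pival_red dvr) // sub0r.
have vE : row i (T *m g) = v by rewrite row_mul row_row_replace.
apply/seteqP; split.
  apply: adjoin_le => //; first exact: submodule_int_comb.
  by rewrite -vE; apply: int_comb_row.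
apply: int_comb_sub => //; first by apply: submodule_adjoin => //; apply: submodule_int_comb.
move=> j; have [->|ji] := eqVneq j i.
  by rewrite vE; apply: adjoin_self => //; apply: submodule_int_comb.
by rewrite row_mul row_row_replace_neq // -rowE; apply: adjoin_sub => //; apply: int_comb_row.
Qed.

(** The point is that [pi] kills a simple quotient (Nakayama): if [pi *: v] were not in [A], it
    would generate [B] over [A], so that [v = c * pi *: v] modulo [A]; but [1 - c * pi] is a unit,
    which puts [v] in [A]. *)
Lemma step_vol A B a : isvol A a -> submodule O B -> A `<` B ->
  (forall M, submodule O M -> A `<=` M -> M `<=` B -> M = A \/ M = B) ->
  isvol B (a - 1).
Proof.
move=> vA sB [AB nBA] simp; have sA := isvol_submodule vA.
have /existsNP[v /not_implyP[Bv nAv]] := nBA.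
have [_ AD AZ] := sA; have [_ BD BZ] := sB.
have Apv : A (pi *: v).
  have sM := submodule_adjoin subO (pi *: v) sA.
  have := simp _ sM (adjoin_sub subO _) (adjoin_le sB AB (BZ _ _ Opi Bv)).
  case=> [<-|ME]; first exact: adjoin_self.
  have [c Oc] : adjoin O A (pi *: v) v by rewrite ME.
  rewrite scalerA -{1}[v]scale1r -scalerBl => H; case: nAv.
  have Oc' : O (1 - c * pi) by apply: (ringB subO) => //; [apply: (ring1 subO)|apply: (ringM subO)].
  have rc : r (1 - c * pi) = 1.
    by rewrite (dvr_redB dvr) ?[c * _]mulrC ?(dvr_red_pi dvr) ?(res1 resO) ?subr0 //;
      [apply: (ring1 subO)|apply: (ringM subO)].
  have c0 : 1 - c * pi != 0.
    by apply/eqP => c0; move/eqP: rc; rewrite c0 (dvr_red0 dvr) eq_sym oner_eq0.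
  rewrite -[v]scale1r -(mulVf c0) -scalerA; apply: AZ => //.
  by apply: (dvr_unit dvr); rewrite ?rc ?oner_neq0.
have [ME|<-] := simp _ (submodule_adjoin subO v sA) (adjoin_sub subO _) (adjoin_le sB AB Bv).
  by case: nAv; rewrite -ME; apply: adjoin_self.
exact: adjoin_vol.
Qed.

Lemma colength_vol A B a x : isvol A a -> colength O A B x -> isvol B (a - x%:Z).
Proof.
move=> vA [s [s0 <- sS sI]].
suff H i : (i <= x)%N -> isvol (s i) (a - i%:Z) by apply: H.
elim: i => [|i IH] ix; first by rewrite s0 subr0.
have [lt simp] := sI _ ix.
have -> : a - i.+1%:Z = a - i%:Z - 1 by lia.
by apply: step_vol (IH (ltnW ix)) (sS _ ix) lt simp.
Qed.

Lemma colength_sub A B x : colength O A B x -> A `<=` B.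
Proof.
move=> [s [<- <- _ sI]]; suff H i : (i <= x)%N -> s 0%N `<=` s i by apply: H.
elim: i => [|i IH] ix //; apply: subset_trans (IH (ltnW ix)) _.
by have [[]] := sI _ ix.
Qed.

Lemma colength_cons A A' B x : submodule O A -> A `<` A' ->
  (forall M, submodule O M -> A `<=` M -> M `<=` A' -> M = A \/ M = A') ->
  colength O A' B x -> colength O A B x.+1.
Proof.
move=> sA AA' simp [s [s0 sx sS sI]].
exists (fun i => if i is j.+1 then s j else A); split=> // [[|i] // /sS //|[|i] ix /=].
  by rewrite s0.
exact: sI.
Qed.

Lemma adjoin_proper A v : submodule O A -> ~ A v -> A `<` adjoin O A v.
Proof.
move=> sA nAv; split; first exact: adjoin_sub.
by move=> H; apply: nAv; apply: H; apply: adjoin_self.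
Qed.

(* Multiplying a vector of [B] outside [A] by a suitable power of [pi]. *)
Lemma ex_socle A B a : isvol A a -> submodule O B -> A `<=` B -> ~ B `<=` A ->
  exists v, [/\ B v, ~ A v & A (pi *: v)].
Proof.
move=> [g [gu -> _]] [_ _ BZ] AB /existsNP[v /not_implyP[Bv nAv]].
have [N AN] : exists N, lat g (pi ^+ N *: v).
  have H i : exists N, O (pi ^+ N * (v *m invmx g) 0 i) by apply: (dvr_frac dvr).
  have [N HN] := choice H; exists (\sum_i N i)%N; apply/mem_lat => // a0 i; rewrite ord1.
  rewrite -scalemxAl mxE (bigD1 i) //= addnC exprD -mulrA.
  by apply: (ringM subO) => //; apply: (ringX subO).
elim: N => [|N IH] in v Bv nAv AN *; first by case: nAv; rewrite -[v]scale1r -(expr0 pi).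
have [ApN|nApN] := pselect (lat g (pi *: v)); first by exists v.
by apply: (IH (pi *: v)) => //; [apply: BZ|rewrite scalerA -exprSr].
Qed.

(** Adjoining a vector of the socle of [B / A] lowers the volume by 1, so after [x] steps the volume
    of [B] is reached, and with it [B]. *)
Lemma vol_colength A B a x : isvol A (a + x%:Z) -> isvol B a -> A `<=` B -> colength O A B x.
Proof.
elim: x A => [|x IH] A vA vB AB.
  rewrite addr0 in vA; have <- := isvol_eq vA vB AB.
  by exists (fun=> A); split=> // *; apply: isvol_submodule vA.
have nBA : ~ B `<=` A by move=> /(isvol_le vB vA); lia.
have [v [Bv nAv Apv]] := ex_socle vA (isvol_submodule vB) AB nBA.
have sA := isvol_submodule vA.
apply: (@colength_cons _ (adjoin O A v)) => //; first exact: adjoin_proper.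
  by move=> M sM AM MA; apply: adjoin_simple.
apply: IH => //; last exact: adjoin_le (isvol_submodule vB) _ _.
by have := adjoin_vol vA Apv nAv; congr isvol; lia.
Qed.

(** Every submodule between two lattices is a lattice: [A] is enlarged inside [S] one socle vector
    at a time, and the volume of [B] bounds the number of steps. *)
Lemma submodule_between_vol A B S a b : isvol A a -> isvol B b -> submodule O S ->
  A `<=` S -> S `<=` B -> exists2 s, isvol S s & (b <= s <= a)%R.
Proof.
move=> vA vB sS AS SB.
have ba := isvol_le vA vB (subset_trans AS SB).
have [x Hx] : exists x : nat, a = b + x%:Z by exists (absz (a - b)); lia.
elim: x A a Hx vA AS {ba} => [|x IH] A a Hx vA AS.
  rewrite addr0 in Hx; rewrite Hx in vA *.
  have AB := isvol_eq vA vB (subset_trans AS SB); rewrite -AB in SB.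
  by exists b; rewrite ?lexx //; rewrite (_ : S = A) //; apply/seteqP.
have [SA|nSA] := pselect (S `<=` A).
  exists a; rewrite ?lexx ?andbT //; last by lia.
  by rewrite (_ : S = A) //; apply/seteqP.
have [v [Sv nAv Apv]] := ex_socle vA sS AS nSA.
have [|||s vs /andP[bs sa]] := IH (adjoin O A v) (a - 1).
- lia.
- exact: adjoin_vol.
- exact: adjoin_le.
by exists s => //; lia.
Qed.

Lemma isvol_scale A a c : c != 0 -> isvol A a -> isvol (scale c A) (a + pival c *+ d).
Proof.
move=> c0 [g [gu -> <-]]; exists (c *: g); rewrite unitmxZ ?unitfE //; split=> //.
  apply/seteqP; split=> [_ [_ [u Ou ->] <-]|_ [u Ou ->]].
    by exists u; rewrite // scalemxAr.
  by exists (u *m g); [exists u|rewrite scalemxAr].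
by rewrite detZ (pivalM dvr) ?expf_neq0 ?det_neq0 // (pivalX dvr) // addrC.
Qed.

Lemma lattice_isvol A : lattice O setT A -> exists a, isvol A a.
Proof.
move=> [s [e [ef eT _ ->]]].
have sd : s = d.
  apply/eqP; rewrite -(eqP ef); apply/eqP/eqP; rewrite -/(row_full e) -sub1mx.
  by apply/row_subP => i; apply/eT.
subst s; rewrite row_free_unit in ef.
by exists (pival (\det e)), e.
Qed.

End Lat.

(** * Lang's theorem for the general linear group *)

Section Lang.
Variables (k : closedFieldType) (Q : nat) (phi : {rmorphism k -> k}).
Hypotheses (Q_gt1 : (1 < Q)%N) (phiE : forall a, phi a = a ^+ Q).

Lemma closed_rootE (p : {poly k}) : size p != 1%N -> exists x, p.[x] = 0.
Proof. by move=> /closed_rootP[x /rootP]; exists x. Qed.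

Lemma artin_schreier a : exists y, phi y + a = y.
Proof.
have [|y] := @closed_rootE ('X^Q - 'X + a%:P)%R.
  have lt : (size (- 'X + a%:P)%R < size ('X^Q : {poly k}))%N.
    rewrite size_polyXn (leq_ltn_trans (size_polyD _ _)) // size_polyN size_polyX.
    by rewrite gtn_max ltnS Q_gt1 (leq_ltn_trans (size_polyC_leq1 _)) // ltnS ltnW.
  by rewrite -addrA size_polyDl // size_polyXn eqSS -lt0n ltnW.
rewrite !hornerE => /eqP H; exists y; rewrite phiE.
by apply/eqP; rewrite -subr_eq0 -[X in _ == X](eqP H); apply/eqP; ring.
Qed.

(** Let [T] be [phi]-semilinear with [T w_i = w_(i+1)] for [i < d] and [T w_d] the sum of the
    [c_i w_i]. The vector with coefficients [b_i] on the [w_i] is fixed by [T] when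
    [b_0 = c_0 b_d^Q] and [b_(i+1) = b_i^Q + c_(i+1) b_d^Q]. These recursions give [b_i] as a
    polynomial in [X = b_d]; what remains is [lang_poly c d = X]. *)
Fixpoint lang_poly (c : nat -> k) i : {poly k} :=
  if i is j.+1 then lang_poly c j ^+ Q + c j.+1 *: 'X^Q else c 0%N *: 'X^Q.

(** Writing the polynomial as [s * 'X^2] turns the equation [lang_poly c d = X] at a nonzero point
    into [s * X = 1], which excludes the trivial solution 0. *)
Lemma lang_poly_dvd c i : exists s, lang_poly c i = s * 'X^2.
Proof.
have XQ : 'X^Q = 'X^(Q - 2) * 'X^2 :> {poly k} by rewrite -exprD subnK.
case: i => [|i] /=; first by exists (c 0%N *: 'X^(Q-2)); rewrite XQ scalerAl.
suff [s ->] : exists s, lang_poly c i ^+ Q = s * 'X^2.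
  by exists (s + c i.+1 *: 'X^(Q - 2)); rewrite mulrDl -scalerAl -XQ.
have [s ->] : exists s, lang_poly c i = s * 'X.
  elim: i => [|i [s IH]] /=.
    by exists (c 0%N *: 'X^(Q.-1)); rewrite -scalerAl -exprSr prednK // ltnW.
  exists (s ^+ Q * 'X^(Q.-1) + c i.+1 *: 'X^(Q.-1)).
  by rewrite IH exprMn mulrDl -scalerAl -!mulrA -exprSr prednK // ltnW.
by exists (s ^+ Q * 'X^(Q - 2)); rewrite exprMn XQ mulrA.
Qed.

(** The degree cannot collapse: a nonzero polynomial reached earlier has degree at least [Q], so its
    [Q]-th power dominates the added term of degree at most [Q]. The use of the bound is that the
    cofactor [s] above is nonzero. *)
Lemma lang_poly_size c i : (exists2 j, (j <= i)%N & c j != 0) ->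
  (Q < size (lang_poly c i))%N.
Proof.
elim: i => [|i IH] /= [j ji cj].
  move: ji cj; rewrite leqn0 => /eqP -> c0.
  by rewrite size_scale // size_polyXn.
have szc : (size (c i.+1 *: 'X^Q : {poly k}) <= Q.+1)%N.
  by rewrite (leq_trans (size_scale_leq _ _)) // size_polyXn.
have [p0|p0] := eqVneq (lang_poly c i) 0.
  have ji1 : j = i.+1.
    apply/eqP; rewrite eqn_leq ji ltnNge; apply/negP => ji'.
    by have := IH (ex_intro2 _ _ j ji' cj); rewrite p0 size_poly0.
  rewrite p0 expr0n (gtn_eqF (ltnW Q_gt1)) add0r size_scale ?size_polyXn //.
  by rewrite -ji1.
have szp : (Q < size (lang_poly c i))%N.
  apply: IH; apply: contrapT => H; case/eqP: p0.
  have c0 l : (l <= i)%N -> c l = 0.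
    by move=> li; apply: contrapT => /eqP cl; apply: H; exists l.
  elim: i c0 {szc ji cj H} => [|i IH] c0 /=; first by rewrite c0 // scale0r.
  rewrite IH; first by rewrite expr0n (gtn_eqF (ltnW Q_gt1)) c0 // scale0r addr0.
  by move=> l li; apply: c0; apply: leqW.
have szpQ : (Q.+1 < size (lang_poly c i ^+ Q))%N.
  have -> : size (lang_poly c i ^+ Q) = ((size (lang_poly c i)).-1 * Q).+1.
    by rewrite -size_exp prednK // lt0n size_poly_eq0 expf_neq0.
  rewrite ltnS (@leq_trans (Q * Q)) //; first by rewrite -[X in (X < _)%N]muln1 ltn_pmul2l // ltnW.
  by rewrite leq_mul2r -ltnS prednK ?szp ?orbT // (leq_ltn_trans _ szp).
by rewrite size_polyDl ?(leq_ltn_trans szc) // ltnW.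
Qed.

(** [T] is injective, so the iterates [w i] of a nonzero vector do not vanish, and the first linear
    relation among them writes an iterate, with coefficients not all zero, through the free family
    of the preceding ones. This is the situation of [lang_poly]. *)
Lemma lang_vector N (M : 'M[k]_N.+1) : M \in unitmx ->
  exists2 v : 'rV[k]_N.+1, v != 0 & map_mx phi v *m M = v.
Proof.
move=> Mu; pose T (v : 'rV[k]_N.+1) := map_mx phi v *m M.
pose w i := iter i T (delta_mx 0 0).
have TI v : T v = 0 -> v = 0.
  move=> /(congr1 (mulmx^~ (invmx M))); rewrite mulmxK // mul0mx => /matrixP H.
  by apply/rowP => i; apply/eqP; have /eqP := H 0 i; rewrite !mxE fmorph_eq0.
have w0 i : w i != 0.
  elim: i => [|i IH]; last by apply: contra_neq IH; apply: TI.
  by apply/eqP => /rowP/(_ 0)/eqP; rewrite !mxE oner_eq0.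
pose Kr d : 'M[k]_(d, N.+1) := \matrix_(i < d) w i.
have ex : exists d, ~~ row_free (Kr d).
  by exists N.+2; rewrite /row_free neq_ltn ltnS rank_leq_col.
case: (ex_minnP ex) => -[|d] nfree mind.
  by case/negP: nfree; rewrite /row_free -leqn0 rank_leq_row.
have free : row_free (Kr d) by apply: contraT => /mind; rewrite ltnn.
have KrS : (Kr d <= Kr d.+1)%MS.
  by apply/row_subP => i; rewrite rowK -[w i](rowK (fun j : 'I_d.+1 => w j) (widen_ord (leqnSn d) i)) row_sub.
have wd : (w d <= Kr d)%MS.
  have : (Kr d == Kr d.+1)%MS.
    rewrite -(mxrank_leqif_eq KrS) (eqP free) eqn_leq -{1}(eqP free) mxrankS //=.
    by rewrite -ltnS ltn_neqAle nfree rank_leq_row.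
  move/eqmxP->; rewrite -[w d](rowK (fun j : 'I_d.+1 => w j) ord_max); exact: row_sub.
have [c wE] := submxP wd.
case: d c wE free nfree mind KrS wd => [|d] c wE free nfree mind KrS wd.
  by case/eqP: (w0 0%N); rewrite wE thinmx0 mul0mx.
pose cf i := c 0 (inord i).
have [j cj] : exists j : 'I_d.+1, c 0 j != 0.
  apply: contrapT => H; case/eqP: (w0 d.+1); rewrite wE (_ : c = 0) ?mul0mx //.
  by apply/rowP => j; rewrite mxE; apply: contrapT => /eqP cj; apply: H; exists j.
have [s sE] := lang_poly_dvd cf d.
have [|z] := @closed_rootE (s * 'X - 1).
  have s0 : s != 0.
    apply/eqP => s0; have := @lang_poly_size cf d; rewrite sE s0 mul0r size_poly0 => H.
    suff : (Q < 0)%N by [].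
    by apply: H; exists (nat_of_ord j); [rewrite -ltnS|rewrite /cf inord_val].
  rewrite size_polyDl size_mulX // ?size_polyN ?size_poly1 ?ltnS ?lt0n ?size_poly_eq0 //.
  by rewrite eqSS size_poly_eq0.
rewrite !hornerE => /eqP; rewrite subr_eq0 => /eqP sz1.
have z0 : z != 0 by apply: contra_eq_neq sz1 => ->; rewrite mulr0 eq_sym oner_eq0.
pose b i := (lang_poly cf i).[z].
have bd : b d = z by rewrite /b sE hornerM hornerXn expr2 mulrA sz1 mul1r.
have bS i : b i.+1 = b i ^+ Q + cf i.+1 * z ^+ Q by rewrite /b /= hornerD hornerZ hornerXn horner_exp.
pose v := \sum_(i < d.+1) b i *: w i.
exists v.
  have -> : v = (\row_(i < d.+1) b i) *m Kr d.+1.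
    by rewrite mulmx_sum_row; apply: eq_bigr => i _; rewrite rowK !mxE.
  rewrite -mxrank_eq0 mxrankMfree // mxrank_eq0; apply: contraNneq z0 => /rowP/(_ ord_max).
  by rewrite !mxE /= bd => ->.
have TD : {morph T : u u' / u + u'} by move=> u u'; rewrite /T map_mxD mulmxDl.
have TZ a u : T (a *: u) = a ^+ Q *: T u by rewrite /T map_mxZ -scalemxAl; congr (_ *: _); rewrite -phiE.
have T0 : T 0 = 0 by rewrite /T map_mx0 mul0mx.
rewrite -[LHS]/(T v) /v (big_morph T TD T0) big_ord_recr /= TZ bd.
have -> : T (w d) = \sum_(i < d.+1) cf i *: w i.
  rewrite -[LHS]/(w d.+1) wE mulmx_sum_row; apply: eq_bigr => i _.
  by rewrite rowK /cf inord_val.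
rewrite big_ord_recl scalerDr scaler_sumr addrCA big_ord_recl /=; congr (_ + _).
  by rewrite scalerA /b /= hornerZ hornerXn mulrC.
rewrite -big_split; apply: eq_bigr => i _ /=.
by rewrite TZ scalerA -scalerDl bS [z ^+ Q * _]mulrC.
Qed.

(** Completes a vector with [v 0 i != 0] to a basis of which it is the first member. *)
Definition replace0 N (i : 'I_N.+1) (v : 'rV[k]_N.+1) : 'M[k]_N.+1 :=
  perm_mx (tperm 0 i) *m row_replace i v.

Lemma replace0_unit N (i : 'I_N.+1) (v : 'rV[k]_N.+1) : v 0 i != 0 -> replace0 i v \in unitmx.
Proof. by move=> vi; rewrite unitmx_mul unitmx_perm unitmxE det_row_replace unitfE. Qed.

Lemma row0_replace0 N (i : 'I_N.+1) (v : 'rV[k]_N.+1) : row 0 (replace0 i v) = v.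
Proof.
rewrite /replace0 -row_permE -[RHS](row_row_replace i).
by apply/rowP => j; rewrite !mxE tpermL.
Qed.

(** With a fixed vector as first basis vector, [M] becomes block lower triangular with corner 1.
    Induction trivialises the other diagonal block, and the column below the corner is removed by
    solving one Artin-Schreier equation per entry. *)
Lemma lang N (M : 'M[k]_N) : M \in unitmx ->
  exists2 g, g \in unitmx & map_mx phi g *m M = g.
Proof.
elim: N => [|N IH] in M *; first by exists 1%:M; rewrite ?unitmx1 // !flatmx0.
move=> Mu; have [v v0 vE] := lang_vector Mu.
have [i vi] : exists i, v 0 i != 0.
  by apply: contrapT => H; case/eqP: v0; apply/rowP => i; rewrite mxE; apply: contrapT => /eqP vi; apply: H; exists i.
have Bu := replace0_unit vi; have rB := row0_replace0 i v.
set B := replace0 i v in Bu rB.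
pose M1 : 'M_(1 + N) := map_mx phi B *m M *m invmx B.
have M1u : M1 \in unitmx by rewrite !unitmx_mul map_unitmx Bu Mu unitmx_inv.
have r1 : row 0 M1 = delta_mx 0 0.
  rewrite !row_mul -map_row rB vE -[delta_mx 0 0](mulmxK Bu); congr (_ *m _).
  by rewrite -rowE rB.
have M1B : map_mx phi B *m M = M1 *m B by rewrite mulmxKV.
have r1e (j : 'I_(1 + N)) : M1 (lshift N 0) j = (j == lshift N 0)%:R.
  have /rowP/(_ j) := r1; rewrite mxE => M1j.
  have -> : lshift N (0 : 'I_1) = (0 : 'I_N.+1) :> 'I_(1 + N) by apply: val_inj.
  by rewrite M1j mxE eqxx.
clearbody M1.
have M1E : M1 = block_mx 1 0 (dlsubmx M1) (drsubmx M1).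
  by rewrite -[LHS]submxK; congr block_mx; apply/matrixP => a b; rewrite !ord1 !mxE r1e.
set C := dlsubmx M1 in M1E; set D := drsubmx M1 in M1E.
have Du : D \in unitmx by move: M1u; rewrite M1E unitmxE det_lblock det1 mul1r.
have [g gu gE] := IH _ Du.
have [y yE] : exists y : 'cV[k]_N, map_mx phi y + map_mx phi g *m C = y.
  have H a : exists z, phi z + (map_mx phi g *m C) a 0 = z by apply: artin_schreier.
  have [y Hy] := choice H; exists (\col_a y a).
  by apply/matrixP => a b; rewrite !ord1 [RHS]mxE -[RHS]Hy [LHS]mxE; congr (_ + _); rewrite !mxE.
pose g1 : 'M_(1 + N) := block_mx 1 0 y g.
have g1u : g1 \in unitmx by rewrite unitmxE det_lblock det1 mul1r -unitmxE.
exists (g1 *m B); first by rewrite unitmx_mul g1u.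
have -> : map_mx phi (g1 *m B) *m M = map_mx phi g1 *m M1 *m B.
  by rewrite map_mxM -!mulmxA M1B.
congr (_ *m _); rewrite M1E /g1 map_block_mx map_mx1 map_mx0 mulmx_block.
by rewrite !mulmx0 !mul0mx !mul1mx mulmx1 !addr0 add0r gE yE.
Qed.

End Lang.

(** * Sesquilinear forms over an algebraically closed field *)

Section ConjTranspose.
Variables (k : fieldType) (fr : {rmorphism k -> k}).

Definition conj_tr m n (A : 'M[k]_(m, n)) : 'M[k]_(n, m) := (map_mx fr A)^T.
Local Notation "A ^h" := (conj_tr A) (at level 8, format "A ^h").
Definition fr2 m n (A : 'M[k]_(m, n)) := map_mx fr (map_mx fr A).

Lemma conj_trM m n p (A : 'M_(m, n)) (B : 'M_(n, p)) : (A *m B)^h = B^h *m A^h.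
Proof. by rewrite /conj_tr map_mxM trmx_mul. Qed.

Lemma conj_trK m n (A : 'M_(m, n)) : A^h^h = fr2 A.
Proof. by apply/matrixP => i j; rewrite !mxE. Qed.

Lemma conj_tr_unit n (A : 'M_n) : (A^h \in unitmx) = (A \in unitmx).
Proof. by rewrite unitmx_tr map_unitmx. Qed.

Lemma fr2M m n p (A : 'M_(m, n)) (B : 'M_(n, p)) : fr2 (A *m B) = fr2 A *m fr2 B.
Proof. by rewrite /fr2 !map_mxM. Qed.

Lemma gram_entry m n p (A : 'M_(m, n)) G (B : 'M_(p, n)) i j :
  (A *m G *m B^h) i j = (row i A *m G *m (row j B)^h) 0 0.
Proof. by rewrite -row_mul !mxE; apply: eq_bigr => l _; rewrite !mxE. Qed.

Lemma fr2_inv n (g : 'M[k]_n) : fr2 (invmx g) = invmx (fr2 g).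
Proof. by rewrite /fr2 !map_invmx. Qed.

Lemma conj_tr_inv n (g : 'M[k]_n) : (invmx g)^h = invmx g^h.
Proof. by rewrite /conj_tr map_invmx trmx_inv. Qed.

End ConjTranspose.

Section Hermitian.
Variables (k : closedFieldType) (q : nat) (fr : {rmorphism k -> k}).
Hypotheses (q_gt1 : (1 < q)%N) (frE : forall a, fr a = a ^+ q).
Hypothesis two_neq0 : 2%:R != 0 :> k.

Local Notation "A ^h" := (conj_tr fr A) (at level 8, format "A ^h").
Local Notation fr2 := (fr2 fr).

Lemma herm_change n (G B : 'M_n) : G^h = G -> fr2 B = B ->
  (B *m G *m B^h)^h = B *m G *m B^h.
Proof. by move=> hG hB; rewrite !conj_trM conj_trK hG hB mulmxA. Qed.

(** If the diagonal of [G] vanishes and [G j i] does not, then [e_i + (G j i)^-1 e_j] has norm 2.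
    The vector is asked to be fixed by [fr2] because only such changes of basis preserve
    [G^h = G]. *)
Lemma herm_vector n (G : 'M_n.+1) : G \in unitmx -> G^h = G ->
  exists w : 'rV_n.+1, [/\ fr2 w = w & (w *m G *m w^h) 0 0 != 0].
Proof.
move=> Gu hG.
have hGe i j : fr (G i j) = G j i by rewrite -{2}hG !mxE.
have fd (i : 'I_n.+1) : map_mx fr (delta_mx 0 i : 'rV_n.+1) = delta_mx 0 i.
  by rewrite map_delta_mx.
have ee i j : ((delta_mx 0 i : 'rV_n.+1) *m G *m (delta_mx 0 j : 'rV_n.+1)^T) 0 0 = G i j.
  by rewrite -rowE trmx_delta -colE !mxE.
have [[i Gii]|dG] := pselect (exists i, G i i != 0).
  by exists (delta_mx 0 i); rewrite /fr2 /conj_tr !fd ee.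
have {}dG i : G i i = 0 by apply: contrapT => /eqP Gii; apply: dG; exists i.
have [i [j Gji]] : exists i j, G j i != 0.
  apply: contrapT => H; have G0 : G = 0.
    by apply/matrixP => j i; rewrite mxE; apply: contrapT => /eqP Gji; apply: H; exists i, j.
  by move: Gu; rewrite G0 unitmxE det0 unitr0.
have fc : fr (G j i)^-1 = (G i j)^-1 by rewrite fmorphV hGe.
have fc' : fr (G i j)^-1 = (G j i)^-1 by rewrite fmorphV hGe.
have Gij : G i j != 0 by rewrite -hGe fmorph_eq0.
exists (delta_mx 0 i + (G j i)^-1 *: delta_mx 0 j); split.
  by rewrite /fr2 !map_mxD !map_mxZ !fd fc fc'.
have -> : (delta_mx 0 i + (G j i)^-1 *: delta_mx 0 j : 'rV_n.+1)^h =
    (delta_mx 0 i : 'rV_n.+1)^T + (G i j)^-1 *: (delta_mx 0 j : 'rV_n.+1)^T.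
  by rewrite /conj_tr map_mxD map_mxZ !fd fc linearD linearZ.
rewrite !(mulmxDl, mulmxDr) -!(scalemxAl, scalemxAr).
do !rewrite [(_ + _ : 'M_1) 0 0]mxE; do !rewrite [(_ *: _ : 'M_1) 0 0]mxE.
by rewrite !ee !dG !mulVf // !mulr0 add0r addr0 two_neq0.
Qed.

(** Gram-Schmidt: [B] puts the anisotropic vector first, [E] splits off its orthogonal complement,
    and the remaining coefficient [a] is normalised by a root [s] of [s^(q+1) = a^-1]. *)
Lemma herm_diag n (G : 'M_n) : G \in unitmx -> G^h = G ->
  exists2 g, g \in unitmx & g *m G *m g^h = 1%:M.
Proof.
elim: n => [|n IH] in G *.
  by exists 1%:M; rewrite ?unitmx1 // [LHS]flatmx0 [RHS]flatmx0.
move=> Gu hG; have [w [fw wG]] := herm_vector Gu hG.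
have [i wi] : exists i, w 0 i != 0.
  apply: contrapT => H; move: wG; rewrite (_ : w = 0) ?mul0mx ?mxE ?eqxx //.
  by apply/rowP => i; rewrite mxE; apply: contrapT => /eqP wi; apply: H; exists i.
have Bu := replace0_unit wi; have rB := row0_replace0 i w.
have fB : fr2 (replace0 i w) = replace0 i w.
  rewrite fr2M /fr2 !map_perm_mx; congr (_ *m _); apply/matrixP => a b; rewrite !mxE.
  by case: ifP => _; rewrite ?rmorph_nat //; have /matrixP/(_ 0 b) := fw; rewrite !mxE.
set B := replace0 i w in Bu rB fB; clearbody B.
pose G1 : 'M_(1 + n) := B *m G *m B^h.
have G100 : G1 (lshift n 0) (lshift n 0) != 0.
  have -> : lshift n (0 : 'I_1) = (0 : 'I_n.+1) :> 'I_(1 + n) by apply: val_inj.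
  by rewrite gram_entry rB.
have hG1 : G1^h = G1 := herm_change hG fB.
have G1u : G1 \in unitmx by rewrite !unitmx_mul Bu Gu conj_tr_unit.
have [E [Eu [a a0 [D [DE hD Du]]]]] : exists E : 'M_(1 + n), E \in unitmx /\
    exists2 a : k, a != 0 & exists D : 'M_n,
      [/\ E *m G1 *m E^h = block_mx a%:M 0 0 D, D^h = D & D \in unitmx].
  clearbody G1; have [a aE] : exists a : k, ulsubmx G1 = a%:M.
    by exists (ulsubmx G1 0 0); rewrite [LHS]mx11_scalar.
  have a0 : a != 0 by apply: contraNneq G100 => a0; move/matrixP/(_ 0 0): aE; rewrite !mxE a0 mul0rn => ->.
  have G1E := submxK G1; rewrite aE in G1E.
  set u := ursubmx G1 in G1E; set l := dlsubmx G1 in G1E; set D := drsubmx G1 in G1E.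
  rewrite -G1E in hG1 G1u *; move: hG1.
  rewrite {1}/conj_tr map_block_mx tr_block_mx => /eq_block_mx[].
  rewrite map_scalar_mx tr_scalar_mx -/(conj_tr fr l) -/(conj_tr fr u) -/(conj_tr fr D).
  move=> /matrixP/(_ 0 0); rewrite !mxE !eqxx !mulr1n => ha hl hu hD.
  pose E : 'M_(1 + n) := block_mx 1%:M 0 (- a^-1 *: l) 1%:M.
  have EE : E *m block_mx a%:M u l D *m E^h = block_mx a%:M 0 0 (D - a^-1 *: (l *m u)).
    have Eh : E^h = block_mx 1%:M (- a^-1 *: u) 0 1%:M.
      rewrite /conj_tr map_block_mx tr_block_mx !map_mx1 !map_mx0 map_mxZ rmorphN /=.
      by rewrite fmorphV /= ha linearZ /= !trmx1 !trmx0 -/(conj_tr fr l) hl.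
    rewrite Eh /E !mulmx_block !mul1mx !mulmx1 !mul0mx !mulmx0 !addr0.
    rewrite mul_mx_scalar scalerA mulrN divff // scaleN1r addNr.
    rewrite mul_scalar_mx scalerA mulrN divff // scaleN1r addNr mul0mx add0r.
    by rewrite -scalemxAl scaleNr addrC.
  have Eu : E \in unitmx by rewrite unitmxE det_lblock !det1 mul1r unitr1.
  exists E; split=> //; exists a => //; exists (D - a^-1 *: (l *m u)); split=> //.
    rewrite /conj_tr map_mxB map_mxZ fmorphV /= ha linearB linearZ /=.
    by rewrite -!/(conj_tr fr _) conj_trM hl hu hD.
  have : E *m block_mx a%:M u l D *m E^h \in unitmx by rewrite !unitmx_mul Eu G1u conj_tr_unit.
  by rewrite EE unitmxE det_lblock unitrM => /andP[].
have [g gu gE] := IH _ Du hD.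
have [s] : exists s, s * a * fr s = 1.
  have [|s] := @closed_rootE k ('X^q * 'X - a^-1%:P).
    rewrite size_polyDl size_mulX ?expf_neq0 ?polyX_eq0 // size_polyXn //.
    by rewrite size_polyN (leq_ltn_trans (size_polyC_leq1 _)).
  rewrite hornerD hornerM hornerXn hornerX hornerN hornerC => /eqP.
  by rewrite subr_eq0 => /eqP H; exists s; rewrite frE mulrAC [s * _]mulrC H mulVf.
move=> sE; have s0 : s != 0.
  by apply: contraPneq sE => ->; rewrite !mul0r => /eqP; rewrite eq_sym oner_eq0.
pose S : 'M_(1 + n) := block_mx s%:M 0 0 g.
have Su : S \in unitmx by rewrite unitmxE det_lblock det_scalar1 unitrM unitfE s0 -unitmxE.
exists (S *m E *m B); first by rewrite !unitmx_mul Su Eu.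
have -> : S *m E *m B *m G *m (S *m E *m B)^h = S *m (E *m G1 *m E^h) *m S^h.
  by rewrite !conj_trM !mulmxA.
rewrite DE /S mulmx_block !mulmx0 !mul0mx !addr0 !add0r /conj_tr map_block_mx tr_block_mx.
rewrite !map_mx0 !trmx0 mulmx_block !mulmx0 !mul0mx !addr0 !add0r -/(conj_tr fr g) gE.
rewrite map_scalar_mx tr_scalar_mx -!scalar_mxM sE.
by rewrite -scalar_mx_block.
Qed.

(** Lang's theorem for the cosquare [M = G^h G^-1] gives [g] with [fr2 g *m M = g]. Then the
    conjugate transpose of [g G g^h] is [fr2 g *m M *m G *m g^h = g G g^h], so the form has become
    hermitian and can be diagonalised. *)
Lemma sesqui_lang n (G : 'M_n) : G \in unitmx ->
  exists2 g, g \in unitmx & g *m G *m g^h = 1%:M.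
Proof.
move=> Gu; pose M := G^h *m invmx G.
have fr2E a : (fr \o fr) a = a ^+ (q * q) by rewrite /= !frE exprM.
have [||g gu] := @lang k (q * q)%N (fr \o fr : {rmorphism k -> k}) _ fr2E n M.
- by rewrite (@ltn_mul 1 1 q q).
- by rewrite unitmx_mul conj_tr_unit Gu unitmx_inv.
rewrite (_ : map_mx _ g = fr2 g) => [gE|]; last by apply/matrixP => i j; rewrite !mxE.
have [||h hu hE] := @herm_diag n (g *m G *m g^h).
- by rewrite !unitmx_mul gu Gu conj_tr_unit.
- transitivity (fr2 g *m M *m G *m g^h); last by rewrite gE.
  by rewrite !conj_trM conj_trK /M !mulmxA mulmxKV.
by exists (h *m g); rewrite ?unitmx_mul ?hu // conj_trM -hE !mulmxA.
Qed.

(* The form [toeplitz_mx t] has as cosquare the cyclic shift [cyc_mx t] (with a sign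
   when [t] is even), and vanishes on the first half of the standard basis. *)
Definition toeplitz (t i j : nat) : k :=
  let c := t.-1./2 in
  (j == i + c)%N%:R + (i == j + c.+1)%N%:R -
  (if odd t then 0 else (j == i + c.+1)%N%:R + (i == j + c.+2)%N%:R).

Definition toeplitz_mx t : 'M[k]_t := \matrix_(i < t, j < t) toeplitz t i j.

Definition cyc_mx t : 'M[k]_t := \matrix_(i < t, j < t)
  if (i.+1 < t)%N then (j == i.+1 :> nat)%:R
  else (if odd t then 1 else -1) * (j == 0 :> nat)%:R.

Lemma half_odd t : odd t -> t = (t.-1./2).*2.+1.
Proof. by lia. Qed.

Lemma half_even t : (0 < t)%N -> ~~ odd t -> t = (t.-1./2).*2.+2.
Proof. by lia. Qed.

Lemma cyc_toeplitz t : cyc_mx t *m toeplitz_mx t = (toeplitz_mx t)^T.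
Proof.
apply/matrixP => i j; rewrite !mxE.
have [it|it] := ltnP i.+1 t.
  rewrite (bigD1 (Ordinal it)) //= !mxE it /= eqxx mul1r big1 => [|l li]; last first.
    by rewrite !mxE it -val_eqE /= in li *; rewrite (negPf li) mul0r.
  rewrite addr0 /toeplitz; set c := t.-1./2.
  have -> : (j == i.+1 + c :> nat)%N = (j == i + c.+1 :> nat)%N by lia.
  have -> : (i.+1 == j + c.+1 :> nat)%N = (i == j + c :> nat)%N by lia.
  have -> : (j == i.+1 + c.+1 :> nat)%N = (j == i + c.+2 :> nat)%N by lia.
  have -> : (i.+1 == j + c.+2 :> nat)%N = (i == j + c.+1 :> nat)%N by lia.
  by case: odd; ring.
have t0 : (0 < t)%N by apply: leq_ltn_trans (ltn_ord i).
rewrite (bigD1 (Ordinal t0)) //= !mxE ltnNge it /= mulr1 big1 => [|l li]; last first.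
  by rewrite !mxE ltnNge it -val_eqE /= in li *; rewrite (negPf li) mulr0 mul0r.
have iE : i = t.-1 :> nat by have := ltn_ord i; lia.
have jt := ltn_ord j.
rewrite addr0 /toeplitz iE; set c := t.-1./2; case: ifP => ot.
  have tE := half_odd ot; rewrite -/c in tE.
  have -> : (j == 0 + c :> nat)%N = (t.-1 == j + c)%N by lia.
  have -> : (0 == j + c.+1)%N = false by lia.
  have -> : (j == t.-1 + c.+1 :> nat)%N = false by lia.
  by rewrite mul1r.
have tE := half_even t0 (negbT ot); rewrite -/c in tE.
have -> : (j == 0 + c :> nat)%N = (t.-1 == j + c.+1)%N by lia.
have -> : (0 == j + c.+1)%N = false by lia.
have -> : (j == 0 + c.+1 :> nat)%N = (t.-1 == j + c)%N by lia.
have -> : (0 == j + c.+2)%N = false by lia.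
have -> : (j == t.-1 + c.+1 :> nat)%N = false by lia.
have -> : (j == t.-1 + c.+2 :> nat)%N = false by lia.
by ring.
Qed.

(** A row vector [u] in the kernel is extended by 0 to all indices, as [U] on naturals and [V] on
    integers. For odd [t] each equation has a single surviving term. For even [t] the equations say
    that consecutive coordinates agree, and the one of index [c] that [2 U_0 = 0]. *)
Lemma toeplitz_unit t : toeplitz_mx t \in unitmx.
Proof.
rewrite -row_free_unit; apply: inj_row_free => u uJ.
case: (posnP t) => [t0|t0]; first by apply/rowP => i; have := ltn_ord i; rewrite {2}t0.
pose U l := if insub l is Some i then u 0 i else 0 : k.
have Uo l : (t <= l)%N -> U l = 0 by move=> tl; rewrite /U insubN // -leqNgt.
have Us (P : nat -> bool) l : (forall i : 'I_t, P i = (i == l :> nat)) ->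
    \sum_i u 0 i * (P i)%:R = U l.
  move=> HP; have [lt|tl] := ltnP l t.
    rewrite (bigD1 (Ordinal lt)) // HP /= eqxx mulr1 big1 ?addr0 => [|i il].
      by rewrite /U insubT.
    by rewrite HP; rewrite -val_eqE /= in il; rewrite (negPf il) mulr0.
  rewrite Uo // big1 // => i _; rewrite HP.
  by have := ltn_ord i; case: eqP => [->|]; rewrite ?mulr0 // ltnNge tl.
set c := t.-1./2.
pose V l := if (l >= 0)%R then U (absz l) else 0.
have E (j : 'I_t) : V (j%:Z - c%:Z) + U (j + c.+1)%N -
    (if odd t then 0 else V (j%:Z - c.+1%:Z) + U (j + c.+2)%N) = 0.
  have /rowP/(_ j) := uJ; rewrite !mxE => uJj; rewrite -[RHS]uJj.
  have VE l : V (j%:Z - l%:Z) = \sum_i u 0 i * (j == i + l :> nat)%N%:R.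
    rewrite /V; case: ifP => jl; first by rewrite (Us (fun i => (j == i + l :> nat)%N) (absz (j%:Z - l%:Z))) // => i; lia.
    by rewrite big1 // => i _; rewrite (_ : (_ == _) = false) ?mulr0 //; lia.
  have UE l : U l = \sum_i u 0 i * (i == l :> nat)%N%:R.
    by rewrite (Us (fun i => i == l)%N l).
  rewrite !VE !UE.
  under [RHS]eq_bigr do rewrite mxE /toeplitz -/c mulrBr mulrDr.
  rewrite sumrB big_split /=; congr (_ - _).
  case: ifP => _; first by rewrite [RHS]big1 // => i _; rewrite mulr0.
  by under [RHS]eq_bigr do rewrite mulrDr; rewrite big_split.
suff U0 : forall l, (l < t)%N -> U l = 0.
  by apply/rowP => i; rewrite mxE -[RHS](U0 i (ltn_ord i)) /U valK.
have [ot|et] := boolP (odd t).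
  have tE := half_odd ot; rewrite -/c in tE.
  move=> l lt; have [lc|cl] := leqP l c.
    have jt : (l + c < t)%N by lia.
    have := E (Ordinal jt); rewrite ot subr0 /= (Uo (_ + _)%N) ?addr0; last by lia.
    by rewrite /V ifT; [congr (U _ = _)|]; lia.
  have jt : (l - c.+1 < t)%N by lia.
  have := E (Ordinal jt); rewrite ot subr0 /= /V ifF ?add0r; last by lia.
  by congr (U _ = _); lia.
have tE := half_even t0 et; rewrite -/c in tE; rewrite (negPf et) in E.
have S l : (l.+1 < t)%N -> U l.+1 = U l.
  move=> lt; have [lc|cl] := leqP l c.
    have jt : (l + c.+1 < t)%N by lia.
    have := E (Ordinal jt); rewrite /= !(Uo (_ + _ + _)%N) ?addr0; try lia.
    rewrite /V !ifT; try lia.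
    have -> : absz ((l + c.+1)%N%:Z - c%:Z) = l.+1 by lia.
    have -> : absz ((l + c.+1)%N%:Z - c.+1%:Z) = l by lia.
    by move/eqP; rewrite subr_eq0 => /eqP.
  have jt : (l - c.+1 < t)%N by lia.
  have := E (Ordinal jt); rewrite /= /V !ifF ?add0r; try lia.
  have -> : (l - c.+1 + c.+1 = l)%N by lia.
  have -> : (l - c.+1 + c.+2 = l.+1)%N by lia.
  by move/eqP; rewrite subr_eq0 => /eqP.
have UU l : (l < t)%N -> U l = U 0%N.
  by elim: l => // l IH lt; rewrite S // IH // ltnW.
have ct : (c < t)%N by lia.
have := E (Ordinal ct); rewrite /= /V ifT ?ifF ?add0r; try lia.
have -> : absz (c%:Z - c%:Z) = 0%N by lia.
rewrite (Uo (c + c.+2)%N) ?subr0 ?(UU (c + c.+1)%N); try lia.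
rewrite -mulr2n -mulr_natl => /eqP; rewrite mulf_eq0 (negPf two_neq0) /= => /eqP U0.
by move=> l lt; rewrite UU.
Qed.

Lemma cyc_unit t : cyc_mx t \in unitmx.
Proof.
have := cyc_toeplitz t => /(congr1 (fun A => A \in unitmx)).
by rewrite unitmx_tr unitmx_mul toeplitz_unit andbT.
Qed.

Lemma row_cyc t (f : 'M[k]_t) (i j : 'I_t) : j = i.+1 :> nat -> row i (cyc_mx t *m f) = row j f.
Proof.
move=> ji; rewrite row_mul [RHS]rowE; congr (_ *m _).
by apply/rowP => l; rewrite !mxE -ji ltn_ord.
Qed.

Lemma fr_toeplitz t : map_mx fr (toeplitz_mx t) = toeplitz_mx t.
Proof.
apply/matrixP => i j; rewrite !mxE /toeplitz rmorphB rmorphD !rmorph_nat /=.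
by case: odd; rewrite ?rmorph0 // rmorphD !rmorph_nat.
Qed.

(** By Lang's theorem both [M] and [cyc_mx t] are twisted conjugates of the identity, hence of each
    other; all rows of the resulting identity except the wrap-around one are retained. *)
Lemma semilinear_cyclic t (M : 'M[k]_t) : M \in unitmx ->
  exists2 f, f \in unitmx &
    forall i j : 'I_t, j = i.+1 :> nat -> fr2 (row i f) *m M = row j f.
Proof.
move=> Mu; have fr2E a : (fr \o fr) a = a ^+ (q * q) by rewrite /= !frE exprM.
have qq : (1 < q * q)%N by rewrite (@ltn_mul 1 1 q q).
have L := @lang k (q * q)%N (fr \o fr : {rmorphism k -> k}) qq fr2E t.
have mE (A : 'M_t) : map_mx (fr \o fr) A = fr2 A by apply/matrixP => i j; rewrite !mxE.
have [g gu] := L _ Mu; rewrite mE => gE.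
have [h hu] := L _ (cyc_unit t); rewrite mE => hE.
exists (invmx h *m g); first by rewrite unitmx_mul unitmx_inv hu.
move=> i j ji; rewrite -(row_cyc _ ji) /fr2 !map_row -row_mul; congr (row i _).
have fh : fr2 h \in unitmx by rewrite !map_unitmx.
apply: (can_inj (mulKmx fh)); rewrite -/(fr2 _) mulmxA -fr2M mulKVmx // gE.
by rewrite [RHS]mulmxA hE mulKVmx.
Qed.

(** Both [G] and the Toeplitz form are equivalent to the identity, so some [f] carries [G] to the
    Toeplitz form. Since [M] is the cosquare of [G], the same [f] carries [M] to the cosquare
    [cyc_mx t]. The vanishing of entries is the central band of zeros of the Toeplitz matrix. *)
Lemma sesquilinear_cyclic t (G M : 'M[k]_t) : G \in unitmx -> M *m G = G^h ->
  exists f, [/\ f \in unitmx,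
    forall i j : 'I_t, j = i.+1 :> nat -> fr2 (row i f) *m M = row j f
  & forall i j : 'I_t, (j < i + t.-1./2)%N -> (i <= j + t.-1./2)%N ->
      (f *m G *m f^h) i j = 0].
Proof.
move=> Gu MG; have [g gu gE] := sesqui_lang Gu; have [h hu hE] := sesqui_lang (toeplitz_unit t).
set J := toeplitz_mx t in hE.
have hhu : h^h \in unitmx by rewrite conj_tr_unit.
pose f := invmx h *m g.
have fE : f *m G *m f^h = J.
  rewrite /f conj_trM; apply: (can_inj (mulKmx hu)); apply: (can_inj (mulmxK hhu)).
  rewrite hE -gE !mulmxA mulmxV // mul1mx -[RHS]mulmx1 -!mulmxA; congr (_ *m (_ *m (_ *m _))).
  by rewrite -conj_trM mulmxV // /conj_tr map_mx1 trmx1.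
have fu : f \in unitmx by rewrite unitmx_mul unitmx_inv hu.
have fhu : f^h \in unitmx by rewrite conj_tr_unit.
clearbody f; exists f; split=> // [i j ji|i j ji ij].
  rewrite -(row_cyc _ ji) /fr2 !map_row -row_mul; congr (row i _); rewrite -/(fr2 f).
  apply: (can_inj (mulmxK Gu)); apply: (can_inj (mulmxK fhu)).
  transitivity ((f *m G *m f^h)^h); first by rewrite !conj_trM conj_trK -MG !mulmxA.
  transitivity (cyc_mx t *m (f *m G *m f^h)); last by rewrite !mulmxA.
  by rewrite fE cyc_toeplitz /conj_tr fr_toeplitz.
rewrite fE mxE /toeplitz.
have -> : (j == i + t.-1./2 :> nat)%N = false by lia.
have -> : (i == j + t.-1./2.+1 :> nat)%N = false by lia.
have -> : (j == i + t.-1./2.+1 :> nat)%N = false by lia.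
have -> : (i == j + t.-1./2.+2 :> nat)%N = false by lia.
by case: odd; rewrite !addr0 subr0.
Qed.

End Hermitian.

(** * Reduction modulo [pi] and coordinates on residue spaces *)

Section Reduction.
Variables (K : fieldType) (O : set K) (pi : K) (k : fieldType) (r : K -> k).
Hypothesis dvr : is_dvr O pi r.
Let subO := dvr_subring dvr.
Let resO := dvr_residue dvr.
Let pi0 := dvr_pi_neq0 dvr.
Variable n : nat.
Local Notation isvol := (isvol O pi).

Lemma map_red_mul m p s (A : 'M[K]_(m, p)) (B : 'M_(p, s)) : intmx O A -> intmx O B ->
  map_mx r (A *m B) = map_mx r A *m map_mx r B.
Proof.
move=> IA IB; apply/matrixP => i j; rewrite !mxE (dvr_red_sum dvr) => [|l].
  by apply: eq_bigr => l _; rewrite !mxE (resM resO).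
exact: (ringM subO).
Qed.

Lemma map_red_add m p (A B : 'M[K]_(m, p)) : intmx O A -> intmx O B ->
  map_mx r (A + B) = map_mx r A + map_mx r B.
Proof. by move=> IA IB; apply/matrixP => i j; rewrite !mxE (resD resO). Qed.

Lemma map_red_sub m p (A B : 'M[K]_(m, p)) : intmx O A -> intmx O B ->
  map_mx r (A - B) = map_mx r A - map_mx r B.
Proof. by move=> IA IB; apply/matrixP => i j; rewrite !mxE (dvr_redB dvr). Qed.

Lemma map_red_scale m p a (A : 'M[K]_(m, p)) : O a -> intmx O A ->
  map_mx r (a *: A) = r a *: map_mx r A.
Proof. by move=> Oa IA; apply/matrixP => i j; rewrite !mxE (resM resO). Qed.

Lemma red_lift m p (A : 'M[k]_(m, p)) : exists2 B : 'M[K]_(m, p), intmx O B & map_mx r B = A.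
Proof.
have H i j : exists x, O x /\ r x = A i j by have [x] := res_surj resO (A i j); exists x.
pose f i j := xget 0 [set x | O x /\ r x = A i j].
have fP i j : O (f i j) /\ r (f i j) = A i j by rewrite /f; case: xgetP => // hx; case: (H i j) => x /hx.
exists (\matrix_(i, j) f i j); first by move=> i j; rewrite mxE; case: (fP i j).
by apply/matrixP => i j; rewrite !mxE; case: (fP i j).
Qed.

Lemma red_eq0 m p (A : 'M[K]_(m, p)) : intmx O A -> map_mx r A = 0 ->
  exists2 B, intmx O B & A = pi *: B.
Proof.
move=> IA /matrixP A0; exists (pi^-1 *: A); last by rewrite scalerA divff // scale1r.
move=> i j; rewrite mxE mulrC; apply/(res_ker resO (IA i j)).
by have := A0 i j; rewrite !mxE.
Qed.

(* [c] induces an isomorphism of [Q / P] with [k ^ N]. *)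
Record quot_coord (P Q : set 'rV[K]_n) (N : nat) (c : 'rV[K]_n -> 'rV[k]_N) : Prop := {
  qcD : forall u v, Q u -> Q v -> c (u + v) = c u + c v;
  qcZ : forall a v, O a -> Q v -> c (a *: v) = r a *: c v;
  qc_surj : forall y, exists2 v, Q v & c v = y;
  qc_ker : forall v, Q v -> (c v = 0 <-> P v) }.

(** In a basis of [Q] the lattice [P] is spanned by the rows of [C]. As [P] contains [pi Q], the
    quotient is the cokernel of the reduction of [C], and [col_base] of [cokermx] supplies
    surjective coordinates on it. *)
Lemma quot_coord_ex P Q p q : isvol P p -> isvol Q q -> P `<=` Q ->
  (forall v, Q v -> P (pi *: v)) ->
  exists N (c : 'rV[K]_n -> 'rV[k]_N), quot_coord P Q c.
Proof.
move=> vP vQ; have sP := isvol_submodule dvr vP; case: vP vQ sP => [gP [guP -> _]] [g [gu -> _]] sP.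
move=> /(lat_subP dvr _ gu); set C := gP *m invmx g => IC piQ.
have gPE : gP = C *m g by rewrite mulmxKV.
pose X := cokermx (map_mx r C); pose kap := col_base X.
exists (\rank X), (fun v => map_mx r (v *m invmx g) *m kap); split.
- move=> u v /(mem_lat O _ gu) Iu /(mem_lat O _ gu) Iv.
  by rewrite mulmxDl map_red_add // mulmxDl.
- move=> a v Oa /(mem_lat O _ gu) Iv.
  by rewrite -scalemxAl map_red_scale // scalemxAl.
- move=> y; have /row_fullP[B BE] := col_base_full X.
  have [w Iw wE] := red_lift (y *m B); exists (w *m g); first by exists w.
  by rewrite mulmxK // wE -mulmxA BE mulmx1.
move=> v Qv; have /(mem_lat O _ gu) Iv := Qv; set u := v *m invmx g in Iv *.
have vE : v = u *m g by rewrite mulmxKV.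
have uX : (map_mx r u *m kap = 0) <-> (map_mx r u <= map_mx r C)%MS.
  have E : map_mx r u *m X = map_mx r u *m kap *m row_base X by rewrite -mulmxA mulmx_base.
  rewrite submxE -/X E; split=> [->|/eqP H]; first by rewrite mul0mx.
  by apply: (row_free_inj (row_base_free X)); rewrite /= H mul0mx.
rewrite uX; split=> [/submxP[wb wbE]|[w Iw vw]].
  have [w Iw wE] := red_lift wb.
  have IwC := intmx_mul subO Iw IC.
  have [|z Iz zE] := red_eq0 (intmx_sub subO Iv IwC).
    by rewrite map_red_sub // wbE map_red_mul // wE subrr.
  have -> : v = pi *: (z *m g) + w *m gP.
    by rewrite scalemxAl -zE gPE mulmxBl vE mulmxA subrK.
  have [_ AD _] := sP; apply: AD; last by exists w => // i.
  by apply: piQ; exists z => // i.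
have -> : u = w *m C by rewrite /u vw gPE mulmxA mulmxK.
by rewrite map_red_mul // => [|i j]; rewrite ?ord1 ?submxMl.
Qed.

Variables (P Q : set 'rV[K]_n) (N : nat) (c : 'rV[K]_n -> 'rV[k]_N).
Hypotheses (sP : submodule O P) (sQ : submodule O Q) (PQ : P `<=` Q)
  (cP : quot_coord P Q c).

Lemma qc0 : c 0 = 0.
Proof. by apply/(qc_ker cP); [case: sQ|case: sP]. Qed.

Lemma qc_sum (I : Type) (s : seq I) (F : I -> 'rV[K]_n) : (forall i, Q (F i)) ->
  c (\sum_(i <- s) F i) = \sum_(i <- s) c (F i).
Proof.
move=> QF; elim: s => [|i s IH]; first by rewrite !big_nil qc0.
have Qs : Q (\sum_(i <- s) F i) by apply: submodule_sum sQ _.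
by rewrite !big_cons (qcD cP) // IH.
Qed.

Lemma qcB u v : Q u -> Q v -> c (u - v) = c u - c v.
Proof.
move=> Qu Qv; rewrite (qcD cP) //; last exact: (submoduleN subO sQ).
have O1 : O (-1) by apply/(ringN subO)/(ring1 subO).
by rewrite -[- v]scaleN1r (qcZ cP) // (dvr_redN dvr) ?(res1 resO) ?scaleN1r //; apply: (ring1 subO).
Qed.

Lemma quot_coord_mul (B : 'M[k]_N) : B \in unitmx -> quot_coord P Q (fun v => c v *m B).
Proof.
move=> Bu; split=> [u v Qu Qv|a v Oa Qv|y|v Qv].
- by rewrite (qcD cP) // mulmxDl.
- by rewrite (qcZ cP) // scalemxAl.
- by have [v Qv vE] := qc_surj cP (y *m invmx B); exists v; rewrite // vE mulmxKV.
rewrite -(qc_ker cP Qv); split=> [H|->]; last by rewrite mul0mx.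
by rewrite -[c v](mulmxK Bu) H mul0mx.
Qed.

Lemma qc_decomp (e : 'I_N -> 'rV[K]_n) v :
  (forall i, Q (e i) /\ c (e i) = delta_mx 0 i) -> Q v ->
  exists a : 'I_N -> K, [/\ forall i, O (a i), forall i, r (a i) = c v 0 i
    & P (v - \sum_i a i *: e i)].
Proof.
move=> eP Qv; have [a0 Ia aE] := red_lift (c v).
have [_ _ QZ] := sQ; have Qe i : Q (a0 0 i *: e i) by apply: QZ => //; case: (eP i).
exists (fun i => a0 0 i); split=> // [i|]; first by rewrite -aE mxE.
have Qs : Q (\sum_i a0 0 i *: e i) by apply: submodule_sum sQ _.
apply/(qc_ker cP); first exact: (submoduleB subO sQ).
rewrite qcB // qc_sum // [X in X - _]row_sum_delta -sumrB big1 // => i _.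
by have [Qi ei] := eP i; rewrite (qcZ cP) // ei -aE mxE subrr.
Qed.

(** The preimage in [Q] of the span of the first [u] coordinate vectors of [Q / P]. *)
Definition flag u : set 'rV[K]_n :=
  [set v | Q v /\ forall j : 'I_N, (u <= j)%N -> c v 0 j = 0].

Lemma flag0 : flag 0 = P.
Proof.
apply/seteqP; split=> v => [[Qv cv]|Pv].
  by apply/(qc_ker cP Qv)/rowP => j; rewrite cv // mxE.
by split=> [|j _]; [apply: PQ|move/(qc_ker cP (PQ Pv)): Pv => ->; rewrite mxE].
Qed.

Lemma flagN : flag N = Q.
Proof.
apply/seteqP; split=> [v []//|v Qv]; split=> // j.
by rewrite leqNgt ltn_ord.
Qed.

Lemma flagS u u' : (u <= u')%N -> flag u `<=` flag u'.
Proof. by move=> uu v [Qv cv]; split=> // j u'j; apply: cv; apply: leq_trans u'j. Qed.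

Lemma submodule_flag u : submodule O (flag u).
Proof.
have [Q0 QD QZ] := sQ; split=> [|v w [Qv cv] [Qw cw]|a v Oa [Qv cv]].
- by split=> // j _; rewrite qc0 mxE.
- by split=> [|j uj]; [apply: QD|rewrite (qcD cP) // mxE cv ?cw ?addr0].
- by split=> [|j uj]; [apply: QZ|rewrite (qcZ cP) // mxE cv ?mulr0].
Qed.

Lemma flag_step u x (uN : (u < N)%N) : Q x -> c x = delta_mx 0 (Ordinal uN) ->
  flag u.+1 = adjoin O (flag u) x.
Proof.
have [Q0 QD QZ] := sQ; move=> Qx cx; apply/seteqP; split=> v.
  move=> [Qv cv]; have [a Oa aE] := res_surj resO (c v 0 (Ordinal uN)).
  exists a => //; split=> [|j uj]; first by apply: (submoduleB subO sQ) => //; apply: QZ.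
  rewrite qcB //; [rewrite (qcZ cP) // cx !mxE|exact: QZ].
  rewrite aE; move: uj; rewrite leq_eqVlt => /orP[/eqP uj|uj].
    have -> : Ordinal uN = j by apply: val_inj.
    by rewrite !eqxx mulr1 subrr.
  have /negPf -> : j != Ordinal uN by rewrite -val_eqE /=; lia.
  by rewrite (cv j uj) andbF mulr0 subr0.
move=> [a Oa Yv]; rewrite -[v](subrK (a *: x)).
have [_ YD YZ] := submodule_flag u.+1; apply: YD; first exact: flagS Yv.
apply: YZ => //; split=> // j uj; rewrite cx mxE.
have /negPf -> : j != Ordinal uN by rewrite -val_eqE /=; lia.
by rewrite andbF.
Qed.

Lemma flag_vol p u : isvol P p -> (forall v, Q v -> P (pi *: v)) -> (u <= N)%N ->
  isvol (flag u) (p - u%:Z).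
Proof.
move=> vP piQ; elim: u => [|u IH] uN; first by rewrite subr0 flag0.
have [x Qx cx] := qc_surj cP (delta_mx 0 (Ordinal uN)).
rewrite (flag_step Qx cx); have -> : p - u.+1%:Z = p - u%:Z - 1 by lia.
apply: (adjoin_vol dvr); first exact: IH (ltnW uN).
  by apply: (@flagS 0%N) => //; rewrite flag0; apply: piQ.
move=> [_ /(_ (Ordinal uN) (leqnn _))]; rewrite cx mxE !eqxx => /eqP.
by rewrite oner_eq0.
Qed.

End Reduction.

(** * Chains of lattices in a hermitian space *)

Section SesquilinearDual.
Variables (K : fieldType) (O : set K) (pi : K) (k : fieldType) (r : K -> k).
Hypothesis dvr : is_dvr O pi r.
Let subO := dvr_subring dvr.
Variable sigma : {rmorphism K -> K}.
Hypotheses (sigma_int : forall x, O x -> O (sigma x)) (sigma_pi : sigma pi = pi).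
Variables (n : nat) (H : 'M[K]_n).
Hypothesis Hu : H \in unitmx.
Local Notation isvol := (isvol O pi).
Local Notation pival := (pival O pi).
Local Notation lat g := (int_comb O g).
Local Notation "A ^h" := (conj_tr sigma A) (at level 8, format "A ^h").
Implicit Types (A : set 'rV[K]_n) (v w : 'rV[K]_n).

Lemma pival_sigma x : pival (sigma x) = pival x.
Proof.
have [->|x0] := eqVneq x 0; first by rewrite rmorph0.
apply: (pival_eq dvr); first by rewrite fmorph_eq0.
have sz z : sigma (pi ^ z) = pi ^ z by rewrite fmorphXz sigma_pi.
by have [a b] := pivalP dvr x0; split; rewrite -sz -fmorph_div; apply: sigma_int.
Qed.

Lemma int_sigma x : O (sigma x) <-> O x.
Proof.
have [->|x0] := eqVneq x 0; first by rewrite rmorph0.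
by rewrite !(pival_ge0 dvr) ?fmorph_eq0 // pival_sigma.
Qed.

Definition beta v w : K := (v *m H *m w^h) 0 0.

Lemma betaDl u v w : beta (u + v) w = beta u w + beta v w.
Proof. by rewrite /beta !mulmxDl mxE. Qed.

Lemma betaZl a v w : beta (a *: v) w = a * beta v w.
Proof. by rewrite /beta -!scalemxAl mxE. Qed.

Lemma betaZr a v w : beta v (a *: w) = sigma a * beta v w.
Proof. by rewrite /beta /conj_tr map_mxZ linearZ -scalemxAr mxE. Qed.

Lemma betaDr u v w : beta u (v + w) = beta u v + beta u w.
Proof. by rewrite /beta /conj_tr map_mxD linearD /= mulmxDr [LHS]mxE. Qed.

(** The dual on the left of a form that is [sigma]-linear on the right. Arbitrary [sigma] is allowed
    so that the identity covers the bilinear pairing of a Dieudonne module as well. *)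
Definition sdual A : set 'rV[K]_n := [set v | forall w, A w -> O (beta v w)].

Lemma submodule_sdual A : submodule O (sdual A).
Proof.
split=> [w _|u v Hu' Hv w Aw|a v Oa Hv w Aw].
- by rewrite /beta !mul0mx mxE; apply: (ring0 subO).
- by rewrite betaDl; apply: (ringD subO); [apply: Hu'|apply: Hv].
- by rewrite betaZl; apply: (ringM subO) => //; apply: Hv.
Qed.

Lemma sdual_lat g : g \in unitmx -> sdual (lat g) = lat (invmx (H *m g^h)).
Proof.
move=> gu; have gu' : H *m g^h \in unitmx by rewrite unitmx_mul Hu conj_tr_unit.
apply/seteqP; split=> v.
  move=> Hv; apply/mem_lat; rewrite ?unitmx_inv // invmxK mulmxA => i j.
  rewrite gram_entry; rewrite ord1 row_id; apply: Hv.
  exact: int_comb_row.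
move=> /(mem_lat O _ (_ : invmx _ \in unitmx)); rewrite unitmx_inv invmxK => /(_ gu') Iv.
move=> _ [c Ic ->]; rewrite /beta conj_trM mulmxA -[v *m _ *m _]mulmxA.
apply: (intmx_mul subO) => // i j.
by rewrite !mxE ord1; apply: sigma_int.
Qed.

Lemma isvol_sdual A a : isvol A a -> isvol (sdual A) (- a - pival (\det H)).
Proof.
move=> [g [gu -> <-]]; exists (invmx (H *m g^h)).
have gu' : H *m g^h \in unitmx by rewrite unitmx_mul Hu conj_tr_unit.
rewrite unitmx_inv sdual_lat //; split=> //.
rewrite det_inv (pivalV dvr) ?det_neq0 // det_mulmx (pivalM dvr) ?det_neq0 ?conj_tr_unit //.
by rewrite det_tr det_map_mx pival_sigma opprD addrC.
Qed.

End SesquilinearDual.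

(** * Hermitian duality, stable lattices and cyclic chains *)

Section Sesqui.
Variables (K : fieldType) (O : set K) (pi : K) (k : closedFieldType) (r : K -> k).
Hypothesis dvr : is_dvr O pi r.
Let subO := dvr_subring dvr.
Let resO := dvr_residue dvr.
Let pi0 := dvr_pi_neq0 dvr.
Let Opi := dvr_pi dvr.
Variables (sigma : {rmorphism K -> K}) (sigmaV : K -> K) (q : nat).
Variable (fr : {rmorphism k -> k}).
Hypothesis sigmaVK : cancel sigmaV sigma.
Hypotheses (sigma_int : forall x, O x -> O (sigma x)) (sigma_pi : sigma pi = pi).
Hypotheses (q_gt1 : (1 < q)%N) (frE : forall a, fr a = a ^+ q).
Hypothesis sigma_red : forall x, O x -> r (sigma x) = fr (r x).
Hypothesis two_neq0 : 2%:R != 0 :> k.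
Variables (n : nat) (H : 'M[K]_n).
Hypotheses (Hu : H \in unitmx) (hermH : conj_tr sigma H = H).
Local Notation isvol := (isvol O pi).
Local Notation pival := (pival O pi).
Local Notation lat g := (int_comb O g).
Local Notation "A ^h" := (conj_tr sigma A) (at level 8, format "A ^h").
Local Notation tau := (fr2 sigma).
Implicit Types (A B P Q Z T : set 'rV[K]_n) (v w : 'rV[K]_n).

Let pival_sigma := pival_sigma dvr sigma_int sigma_pi.
Let int_sigma := int_sigma dvr sigma_int sigma_pi.
Let submodule_sdual := submodule_sdual dvr sigma H.
Let sdual_lat := sdual_lat dvr sigma_int Hu.
Let isvol_sdual := isvol_sdual dvr sigma_int sigma_pi Hu.
Local Notation beta := (beta sigma H).
Local Notation sdual := (sdual O sigma H).

Lemma tau_bij v : exists2 w, tau w = v & True.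
Proof.
exists (map_mx sigmaV (map_mx sigmaV v)) => //.
by apply/rowP => i; rewrite !mxE !sigmaVK.
Qed.

Lemma tauD v w : tau (v + w) = tau v + tau w.
Proof. by rewrite /fr2 !map_mxD. Qed.

Lemma tauB v w : tau (v - w) = tau v - tau w.
Proof. by rewrite /fr2 !map_mxB. Qed.

Lemma tauZ a v : tau (a *: v) = sigma (sigma a) *: tau v.
Proof. by rewrite /fr2 !map_mxZ. Qed.

Lemma tau_sum (I : Type) (s : seq I) (F : I -> 'rV[K]_n) :
  tau (\sum_(i <- s) F i) = \sum_(i <- s) tau (F i).
Proof. by rewrite (big_morph _ tauD (_ : tau 0 = 0)) // /fr2 !map_mx0. Qed.

Lemma beta_conj v w : sigma (beta v w) = beta (tau w) v.
Proof.
have -> : sigma (beta v w) = ((v *m H *m w^h)^h) 0 0 by rewrite [RHS]mxE [RHS]mxE.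
by rewrite /beta !conj_trM conj_trK hermH mulmxA.
Qed.

Lemma beta_tau v w : beta (tau v) (tau w) = sigma (sigma (beta v w)).
Proof. by rewrite -!beta_conj. Qed.

Lemma betaC_int v w : O (beta v w) <-> O (beta (tau w) v).
Proof. by rewrite -beta_conj int_sigma. Qed.

Lemma sdualS A B : A `<=` B -> sdual B `<=` sdual A.
Proof. by move=> AB v Hv w /AB; apply: Hv. Qed.

Lemma sdual_scale a A v : a != 0 -> sdual (scale a A) v <-> sdual A (sigma a *: v).
Proof.
move=> a0; split=> [Hv w Aw|Hv _ [w Aw <-]].
  by rewrite betaZl -betaZr; apply: Hv; exists w.
by rewrite betaZr -betaZl; apply: Hv.
Qed.

Lemma intmx_tau m p (A : 'M[K]_(m, p)) : intmx O (fr2 sigma A) <-> intmx O A.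
Proof. by split=> I i j; have := I i j; rewrite !mxE !int_sigma. Qed.

(** Exchanging the arguments of [beta] costs one [sigma] and one [tau], so the double dual of [A] is
    not [A] but its image under [tau]. *)
Lemma sdual_sdual A a v : isvol A a -> sdual (sdual A) (tau v) <-> A v.
Proof.
move=> [g [gu -> _]]; have gu' : H *m g^h \in unitmx by rewrite unitmx_mul Hu conj_tr_unit.
rewrite sdual_lat // sdual_lat ?unitmx_inv //.
have -> : invmx (H *m (invmx (H *m g^h))^h) = fr2 sigma g.
  have -> : (invmx (H *m g^h))^h = invmx (fr2 sigma g *m H).
    by rewrite conj_tr_inv conj_trM conj_trK hermH.
  have tu : fr2 sigma g \in unitmx by rewrite !map_unitmx.
  have guH : fr2 sigma g *m H \in unitmx by rewrite unitmx_mul tu.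
  have X : H *m invmx (fr2 sigma g *m H) *m fr2 sigma g = 1%:M.
    apply: (can_inj (mulmxK Hu)); rewrite -[_ *m fr2 _ _ *m _]mulmxA mulmxKV //.
    by rewrite mul1mx.
  have [Xu _] := mulmx1_unit X.
  by apply: (can_inj (mulKmx Xu)); rewrite mulmxV.
have tu : fr2 sigma g \in unitmx by rewrite !map_unitmx.
by rewrite !mem_lat // -fr2_inv -fr2M intmx_tau.
Qed.

(* The stable lattices are those defined over the fixed field of [sigma ^ 2]. *)
Definition stable Z := forall v, Z (tau v) <-> Z v.

Lemma stable_sdual Z : stable Z -> stable (sdual Z).
Proof.
move=> sZ v; split=> Hv w Zw.
  by have := Hv (tau w); rewrite beta_tau !int_sigma; apply; apply/sZ.
have [w' w'E _] := tau_bij w; rewrite -w'E in Zw *.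
by rewrite beta_tau !int_sigma; apply: Hv; apply/sZ.
Qed.

Lemma sdual_sdual_stable Z z : isvol Z z -> stable Z -> sdual (sdual Z) = Z.
Proof.
move=> vZ sZ; apply/seteqP; split=> v; have [w <- _] := tau_bij v.
  by rewrite (sdual_sdual _ vZ) => Zw; apply/sZ.
by move/sZ => Zw; apply/(sdual_sdual _ vZ).
Qed.

Lemma stable_scale a Z : a != 0 -> sigma a = a -> stable Z -> stable (scale a Z).
Proof.
move=> a0 sa sZ v; have E u : scale a Z u <-> Z (a^-1 *: u).
  split=> [[w Zw <-]|Zu]; first by rewrite scalerA mulVf // scale1r.
  by exists (a^-1 *: u); rewrite // scalerA divff // scale1r.
have saV : sigma a^-1 = a^-1 by rewrite fmorphV sa.
by rewrite !E -[X in X *: tau v]saV -saV -tauZ saV; apply: sZ.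
Qed.

(** The rows of [M] are the images of a basis of [Q / P]. For invertibility, [fr] is surjective on
    [k], so a vector [y] killed by [M] is [fr2] of the coordinates of some [v]; then [tau v] lies in
    [P], hence so does [v], and [y = 0]. *)
Lemma tau_red N (P Q : set 'rV[K]_n) (c : 'rV[K]_n -> 'rV[k]_N) :
  submodule O P -> submodule O Q -> P `<=` Q -> stable P -> stable Q -> quot_coord O r P Q c ->
  exists2 M : 'M[k]_N, M \in unitmx &
    forall v, Q v -> c (tau v) = fr2 fr (c v) *m M.
Proof.
move=> sP sQ PQ tP tQ cP; have [Q0 QD QZ] := sQ.
have He i : exists v, Q v /\ c v = delta_mx 0 i.
  by have [v] := qc_surj cP (delta_mx 0 i); exists v.
have [e eP] := choice He; pose M : 'M[k]_N := \matrix_i c (tau (e i)).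
have cE v : Q v -> c (tau v) = fr2 fr (c v) *m M.
  move=> Qv; have [a [Oa aE /tP]] := qc_decomp dvr sP sQ cP eP Qv.
  rewrite tauB tau_sum; set s := \sum_i _ => Pvs.
  have Qts i : Q (tau (a i *: e i)) by apply/tQ/QZ => //; case: (eP i).
  have Qs : Q s by apply: submodule_sum sQ _.
  have Qtv : Q (tau v) by apply/tQ.
  move: Pvs => /(qc_ker cP (submoduleB subO sQ Qtv Qs)).
  rewrite (qcB dvr sQ cP) // => /eqP; rewrite subr_eq0 => /eqP ->.
  rewrite (qc_sum sP sQ cP) // mulmx_sum_row; apply: eq_bigr => i _.
  rewrite tauZ (qcZ cP); last by apply/tQ; case: (eP i).
    by rewrite rowK !mxE -aE !sigma_red //; apply: sigma_int.
  by do 2!apply: sigma_int.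
exists M => //; rewrite -row_free_unit; apply: inj_row_free => y yM.
have fr_surj a : exists b, fr b = a.
  have [|b] := @closed_rootE k ('X^q - a%:P)%R.
    rewrite size_polyDl ?size_polyXn ?size_polyN; first by rewrite eqSS -lt0n ltnW.
    by rewrite (leq_ltn_trans (size_polyC_leq1 _)) // ltnS ltnW.
  by rewrite hornerD hornerXn hornerN hornerC => /eqP; rewrite subr_eq0 => /eqP bE; exists b; rewrite frE.
have [fV fVE] := choice fr_surj.
have [v Qv vE] := qc_surj cP (map_mx fV (map_mx fV y)).
have yE : fr2 fr (c v) = y by rewrite vE; apply/rowP => i; rewrite !mxE !fVE.
have := cE _ Qv; rewrite yE yM; move/(qc_ker cP); rewrite !tQ => /(_ Qv) /tP.
by move/(qc_ker cP Qv) => cv0; rewrite -yE cv0 /fr2 !map_mx0.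
Qed.

(* The chain [P = Y 0 < Y 1 < ... < Y N = Q] where [Y u] is generated over [P] by
   [x, tau x, ..., tau^(u - 1) x], for a vector [x] generating [Q] over [P] under
   [tau]. *)
Record cyclic_chain P Q (p : int) (N : nat) (Y : nat -> set 'rV[K]_n) : Prop := {
  cc_0 : Y 0%N = P;
  cc_N : Y N = Q;
  cc_vol : forall u, (u <= N)%N -> isvol (Y u) (p - u%:Z);
  cc_mono : forall u u', (u <= u')%N -> Y u `<=` Y u';
  cc_tau : forall u v, (u < N)%N -> Y u v -> Y u.+1 (tau v);
  cc_gen : forall Z u, submodule O Z -> stable Z -> (0 < u <= N)%N -> Y u `<=` Z -> Q `<=` Z;
  cc_small : forall T u, stable T -> (u < N)%N -> T `<=` Y u -> T `<=` P }.

Lemma cyclic_chain_of_coord N P Q p (c : 'rV[K]_n -> 'rV[k]_N) (S : 'M[k]_N) :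
  isvol P p -> submodule O Q -> P `<=` Q -> stable P -> stable Q -> quot_coord O r P Q c ->
  (forall v, Q v -> P (pi *: v)) ->
  (forall v, Q v -> c (tau v) = fr2 fr (c v) *m S) ->
  (forall i j : 'I_N, j = i.+1 :> nat -> row i S = delta_mx 0 j) ->
  cyclic_chain P Q p N (flag Q c).
Proof.
move=> vP sQ PQ tP tQ cP piQ cS rS; have sP := isvol_submodule dvr vP.
set Y := flag Q c.
have Y0 : Y 0%N = P := flag0 PQ cP.
have YN : Y N = Q := flagN Q c.
have mono u u' : (u <= u')%N -> Y u `<=` Y u' by apply: flagS.
have tau_next u v : (u < N)%N -> Y u v -> Y u.+1 (tau v).
  move=> uN [Qv cv]; split=> [|j uj]; first exact/tQ.
  rewrite cS // mulmx_sum_row summxE big1 // => i _; rewrite !mxE.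
  have [ui|iu] := leqP u i; first by rewrite cv // !rmorph0 mul0r.
  have iN : (i.+1 < N)%N by apply: leq_ltn_trans uN.
  have /rowP/(_ j) := rS i (Ordinal iN) erefl; rewrite !mxE => ->.
  have /negPf -> : j != Ordinal iN by rewrite -val_eqE /=; lia.
  by rewrite andbF mulr0.
(* [tau] raises the index of the top nonzero coordinate by one: a vector of [T] with nonzero
   coordinate [u] would be sent out of [Y u.+1], so [T] already lies in [Y u]. *)
have small T u : stable T -> (u < N)%N -> T `<=` Y u -> T `<=` P.
  move=> tT; elim: u => [|u IH] uN TY; first by rewrite -Y0.
  apply: IH; first exact: ltnW.
  move=> v Tv; have [Qv cv] := TY _ Tv; split=> // j; rewrite leq_eqVlt => /orP[/eqP uj|]; last exact: cv.
  have /tT/TY[_ /(_ (Ordinal uN) (leqnn _))] := Tv.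
  rewrite cS // mulmx_sum_row summxE (bigD1 j) //= !mxE.
  have /rowP/(_ (Ordinal uN)) := rS j (Ordinal uN) (congr1 succn uj); rewrite !mxE eqxx => -> /=.
  rewrite eqxx mulr1 big1 ?addr0 => [/eqP|i ij]; first by rewrite !fmorph_eq0 => /eqP.
  rewrite !mxE; have [ui|iu] := ltnP u i; first by rewrite cv // !rmorph0 mul0r.
  have iu' : (i < u)%N by rewrite ltn_neqAle iu andbT uj.
  have iN : (i.+1 < N)%N by apply: leq_ltn_trans (ltnW uN).
  have /rowP/(_ (Ordinal uN)) := rS i (Ordinal iN) erefl; rewrite !mxE => ->.
  have /negPf -> : Ordinal uN != Ordinal iN by rewrite -val_eqE /=; lia.
  by rewrite andbF mulr0.
have [N0|N_gt0] := posnP N.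
  have PQE : P = Q by rewrite -YN N0.
  split=> //.
    by move=> u; rewrite {1}N0 leqn0 => /eqP ->; rewrite subr0 Y0.
  by move=> Z u _ _ /andP[u0]; rewrite {1}N0 leqNgt u0.
have [x Qx cx] := qc_surj cP (delta_mx 0 (Ordinal N_gt0)).
pose X i := iter i (fun v : 'rV[K]_n => tau v) x.
have XP i (iN : (i < N)%N) : Q (X i) /\ c (X i) = delta_mx 0 (Ordinal iN).
  elim: i => [|i IH] in iN *.
    by split=> //; rewrite cx; congr (delta_mx 0 _); apply: val_inj.
  have [QX cX] := IH (ltnW iN); split; first exact/tQ.
  rewrite /= cS // cX /fr2 !map_delta_mx -rowE.
  exact: (rS (Ordinal (ltnW iN)) (Ordinal iN)).
have Ystep u : (u < N)%N -> Y u.+1 = adjoin O (Y u) (X u).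
  by move=> uN; have [QX cX] := XP u uN; apply: (flag_step dvr sP sQ cP QX cX).
split=> // [u uN|].
  exact: (flag_vol dvr sP sQ PQ cP vP piQ uN).
move=> Z u sZ tZ /andP[u0 uN] YZ.
have PZ : P `<=` Z by rewrite -Y0; apply: subset_trans YZ; apply: mono.
(* [Y 1] is generated by [x] over [P]; a stable [Z] containing [x] contains all its iterates. *)
have XZ i : (i < N)%N -> Z (X i).
  elim: i => [|i IH] iN; last by apply/tZ/IH/ltnW.
  apply: YZ; apply: (mono 1%N) => //; rewrite Ystep // Y0.
  exact: adjoin_self.
suff H' i : (i <= N)%N -> Y i `<=` Z by rewrite -YN; apply: H'.
elim: i => [|i IH] iN; first by rewrite Y0.
by rewrite Ystep //; apply: adjoin_le => //; [apply/IH/ltnW|apply: XZ].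
Qed.

Lemma cyclic_chain_basis N P Q p (c : 'rV[K]_n -> 'rV[k]_N) (f M : 'M[k]_N) :
  isvol P p -> submodule O Q -> P `<=` Q -> stable P -> stable Q -> quot_coord O r P Q c ->
  (forall v, Q v -> P (pi *: v)) ->
  (forall v, Q v -> c (tau v) = fr2 fr (c v) *m M) ->
  f \in unitmx ->
  (forall i j : 'I_N, j = i.+1 :> nat -> fr2 fr (row i f) *m M = row j f) ->
  cyclic_chain P Q p N (flag Q (fun v => c v *m invmx f)).
Proof.
move=> vP sQ PQ tP tQ cP piQ cM fu fM.
apply: (@cyclic_chain_of_coord _ _ _ _ (fun v => c v *m invmx f) (fr2 fr f *m M *m invmx f)) => //.
- by apply: quot_coord_mul; rewrite ?unitmx_inv.
- move=> v Qv; rewrite cM // fr2M fr2_inv !mulmxA mulmxKV //.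
  by rewrite !map_unitmx.
- move=> i j ji; rewrite !row_mul.
  have -> : row i (fr2 fr f) = fr2 fr (row i f) by rewrite /fr2 !map_row.
  by rewrite (fM i j ji) rowE mulmxK.
Qed.

Lemma cyclic_chain_ex P Q p N : isvol P p -> isvol Q (p - N%:Z) -> P `<=` Q ->
  stable P -> stable Q -> (forall v, Q v -> P (pi *: v)) ->
  exists Y, cyclic_chain P Q p N Y.
Proof.
move=> vP vQ PQ tP tQ piQ; have sP := isvol_submodule dvr vP.
have sQ := isvol_submodule dvr vQ.
have [N' [c cP]] := quot_coord_ex dvr vP vQ PQ piQ.
have [M Mu cM] := tau_red sP sQ PQ tP tQ cP.
have [f fu fM] := semilinear_cyclic q_gt1 frE two_neq0 Mu.
have YP := cyclic_chain_basis vP sQ PQ tP tQ cP piQ cM fu fM.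
set Y := (Y in cyclic_chain _ _ _ _ Y) in YP.
suff NE : N = N' by exists Y; rewrite NE.
have := cc_vol YP (leqnn _); rewrite (cc_N YP) => /(isvol_uniq dvr vQ); lia.
Qed.

(** The form [c0 * beta] is integral on [Q] with radical [P] modulo [pi], so it induces a
    nondegenerate sesquilinear form [G] on [Q / P]. The factor is [c0 = pi] when [Q] is the dual of
    [P], and [c0 = 1] when [P] is [pi] times the dual of [Q]. *)
Lemma cyclic_chain_isotropic P Q p N c0 : isvol P p -> isvol Q (p - N%:Z) -> P `<=` Q ->
  stable P -> stable Q -> (forall v, Q v -> P (pi *: v)) ->
  c0 != 0 -> sigma c0 = c0 -> (forall v w, Q v -> Q w -> O (c0 * beta v w)) ->
  (forall v, Q v -> P v <-> forall w, Q w -> O (c0 * beta v w / pi)) ->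
  exists2 Y, cyclic_chain P Q p N Y &
    forall u v w, (u.*2 <= N.+1)%N -> Y u v -> Y u.-1 w -> O (c0 * beta v w / pi).
Proof.
move=> vP vQ PQ tP tQ piQ c00 sc0 bQ PE; have sP := isvol_submodule dvr vP.
have sQ := isvol_submodule dvr vQ; have [_ QD QZ] := sQ.
have [N' [c cP]] := quot_coord_ex dvr vP vQ PQ piQ.
have [M Mu cM] := tau_red sP sQ PQ tP tQ cP.
have He i : exists v, Q v /\ c v = delta_mx 0 i.
  by have [v] := qc_surj cP (delta_mx 0 i); exists v.
have [e eP] := choice He.
pose b v w := c0 * beta v w.
have bC v w : sigma (b v w) = b (tau w) v by rewrite rmorphM beta_conj /= sc0.
have bP v w : P v -> Q w -> r (b v w) = 0.
  by move=> Pv Qw; apply/(res_ker resO); [apply: bQ (PQ _ Pv) Qw|apply: (proj1 (PE _ (PQ _ Pv)) Pv)].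
have bP' v w : Q v -> P w -> r (b v w) = 0.
  move=> Qv Pw; have := sigma_red (bQ _ _ Qv (PQ _ Pw)); rewrite bC bP //; last exact/tP.
  by move/eqP; rewrite eq_sym fmorph_eq0 => /eqP.
pose G : 'M[k]_N' := \matrix_(i, j) r (b (e i) (e j)).
have bD v v' w : Q v -> Q v' -> Q w -> r (b (v + v') w) = r (b v w) + r (b v' w).
  by move=> Qv Qv' Qw; rewrite -(resD resO) ?/b -?mulrDr -?betaDl //; apply: bQ.
have bDr v v' w : Q v -> Q v' -> Q w -> r (b w (v + v')) = r (b w v) + r (b w v').
  by move=> Qv Qv' Qw; rewrite -(resD resO) ?/b -?mulrDr -?betaDr //; apply: bQ.
have bZ a v w : O a -> Q v -> Q w -> r (b (a *: v) w) = r a * r (b v w).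
  by move=> Oa Qv Qw; rewrite -(resM resO) // /b ?betaZl ?mulrA ?[a * c0]mulrC //; apply: bQ.
have bZr a v w : O a -> Q v -> Q w -> r (b w (a *: v)) = fr (r a) * r (b w v).
  move=> Oa Qv Qw; have Osa := sigma_int Oa; have Ob := bQ _ _ Qw Qv.
  by rewrite -sigma_red // -(resM resO) // /b betaZr; congr r; ring.
have b0 w : r (b 0 w) = 0 by rewrite /b /beta !mul0mx mxE mulr0 (dvr_red0 dvr).
have b0r w : r (b w 0) = 0.
  by rewrite /b /beta /conj_tr map_mx0 trmx0 mulmx0 mxE mulr0 (dvr_red0 dvr).
have bS (F : 'I_N' -> 'rV[K]_n) w : (forall i, Q (F i)) -> Q w ->
    r (b (\sum_i F i) w) = \sum_i r (b (F i) w).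
  move=> QF Qw; elim: (index_enum _) => [|i l IH]; first by rewrite !big_nil b0.
  have Qs : Q (\sum_(j <- l) F j) by apply: submodule_sum sQ _.
  by rewrite !big_cons bD // IH.
have bSr (F : 'I_N' -> 'rV[K]_n) w : (forall i, Q (F i)) -> Q w ->
    r (b w (\sum_i F i)) = \sum_i r (b w (F i)).
  move=> QF Qw; elim: (index_enum _) => [|i l IH]; first by rewrite !big_nil b0r.
  have Qs : Q (\sum_(j <- l) F j) by apply: submodule_sum sQ _.
  by rewrite !big_cons bDr // IH.
have Qe i a : O a -> Q (a *: e i) by move=> Oa; apply: QZ => //; case: (eP i).
have bE v w : Q v -> Q w -> r (b v w) = (c v *m G *m conj_tr fr (c w)) 0 0.
  move=> Qv Qw; have [a [Oa aE Pv]] := qc_decomp dvr sP sQ cP eP Qv.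
  have [a' [Oa' aE' Pw]] := qc_decomp dvr sP sQ cP eP Qw.
  set s := \sum_i _ in Pv; set s' := \sum_i _ in Pw.
  have Qs : Q s by apply: submodule_sum sQ _ => i _; apply: Qe.
  have Qs' : Q s' by apply: submodule_sum sQ _ => i _; apply: Qe.
  have -> : r (b v w) = r (b s w).
    by rewrite -[in LHS](subrK s v) (bD _ _ _ (PQ _ Pv) Qs Qw) (bP _ _ Pv Qw) add0r.
  have -> : r (b s w) = r (b s s').
    by rewrite -[in LHS](subrK s' w) (bDr _ _ _ (PQ _ Pw) Qs' Qs) (bP' _ _ Qs Pw) add0r.
  rewrite /s bS //; last by move=> i; apply: Qe.
  rewrite -mulmxA mxE; apply: eq_bigr => i _; have [Qi _] := eP i.
  rewrite bZ // aE; congr (_ * _).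
  rewrite /s' bSr //; last by move=> j; apply: Qe.
  by rewrite mxE; apply: eq_bigr => j _; have [Qj _] := eP j; rewrite bZr // aE' !mxE mulrC.
have cE i : c (e i) = delta_mx 0 i by case: (eP i).
have Qe' i : Q (e i) by case: (eP i).
(* Reduction of [beta_conj]: the matrix of [tau] is the cosquare of the induced form. *)
have MG : M *m G = conj_tr fr G.
  apply/matrixP => i j; rewrite [RHS]mxE [RHS]mxE [G j i]mxE -sigma_red; last exact: bQ.
  rewrite bC bE //; last exact/tQ.
  rewrite cM // !cE /fr2 !map_delta_mx -rowE /conj_tr map_delta_mx trmx_delta -colE.
  by rewrite -row_mul !mxE.
have Gu : G \in unitmx.
  rewrite -row_free_unit; apply: inj_row_free => y yG.
  have [v Qv vE] := qc_surj cP y; rewrite -vE; apply/(qc_ker cP) => //.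
  apply/(PE _ Qv) => w Qw; apply/(res_ker resO); first exact: bQ.
  by rewrite -/(b v w) bE // vE yG mul0mx mxE.
have [f [fu fM fG]] := sesquilinear_cyclic q_gt1 frE two_neq0 Gu MG.
have YP := cyclic_chain_basis vP sQ PQ tP tQ cP piQ cM fu fM.
set Y := (Y in cyclic_chain _ _ _ _ Y) in YP.
have NE : N = N'.
  by have := cc_vol YP (leqnn _); rewrite (cc_N YP) => /(isvol_uniq dvr vQ); lia.
exists Y; first by rewrite NE.
move=> u v w uN [Qv cv] [Qw cw]; apply/(res_ker resO); first exact: bQ.
rewrite -/(b v w) bE //; pose x := c v *m invmx f; pose y := c w *m invmx f.
have -> : c v = x *m f by rewrite mulmxKV.
have -> : c w = y *m f by rewrite mulmxKV.
have {}cv (j : 'I_N') : (u <= j)%N -> x 0 j = 0 by apply: cv.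
have {}cw (j : 'I_N') : (u.-1 <= j)%N -> y 0 j = 0 by apply: cw.
clearbody x y.
rewrite conj_trM !mulmxA -[x *m f *m G *m _]mulmxA -[x *m f *m _]mulmxA.
have -> : f *m (G *m conj_tr fr f) = f *m G *m conj_tr fr f by rewrite mulmxA.
rewrite -mulmxA mxE big1 // => i _; have [ui|iu] := leqP u i; first by rewrite cv // mul0r.
rewrite mxE big1 ?mulr0 // => j _; have [uj|ju] := leqP u.-1 j.
  by rewrite [_ j 0]mxE [_ 0 j]mxE cw // rmorph0 mulr0.
(* Here [i <= u - 1] and [j <= u - 2], and [u.*2 <= N.+1] means [u - 1 <= (N - 1) / 2]: the entry
   lies in the zero band. *)
by rewrite fG ?mul0r //; move: uN; rewrite NE; lia.
Qed.

(** * Pairs of lattices of a point, and the segments they form *)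

Local Notation vH := (pival (\det H)).

Record chain_pair A B (h : nat) : Prop := {
  cp_A : exists a, isvol A a;
  cp_B : exists b, isvol B b;
  cp_dualA : colength O (scale pi (sdual A)) B 1;
  cp_BA : B `<=` sdual A;
  cp_dualB : colength O (scale pi (sdual B)) A 1;
  cp_AB : A `<=` sdual B;
  cp_pi : scale pi B `<=` A;
  cp_h : colength O A B h }.

Lemma scaleS a A B : A `<=` B -> scale a A `<=` scale a B.
Proof. by move=> AB _ [v Av <-]; exists v => //; apply: AB. Qed.

Lemma scaleP a A v : a != 0 -> scale a A v <-> A (a^-1 *: v).
Proof.
move=> a0; split=> [[w Zw <-]|Zu]; first by rewrite scalerA mulVf // scale1r.
by exists (a^-1 *: v); rewrite // scalerA divff // scale1r.
Qed.

Lemma scale_sdual_scale A : scale pi (sdual (scale pi A)) = sdual A.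
Proof.
apply/seteqP; split=> v.
  by move=> /(scaleP _ _ pi0)/(sdual_scale _ _ pi0); rewrite sigma_pi scalerA divff // scale1r.
by move=> Av; apply/scaleP => //; apply/sdual_scale => //; rewrite sigma_pi scalerA divff // scale1r.
Qed.

Lemma isvol_scale_sdual A a : isvol A a -> isvol (scale pi (sdual A)) (n%:Z - a - vH).
Proof.
move=> /isvol_sdual/(isvol_scale dvr pi0); rewrite (pival_pi dvr); congr isvol.
by rewrite natz; ring.
Qed.

Lemma colength1 A B a : isvol A a -> isvol B (a - 1) -> A `<=` B -> colength O A B 1.
Proof. by move=> vA vB; apply: (vol_colength dvr) vB; rewrite subrK. Qed.

Lemma colength_of_vol A B a b (h : nat) : isvol A a -> isvol B b -> A `<=` B ->
  h%:Z = a - b -> colength O A B h.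
Proof.
by move=> vA vB AB hE; apply: (vol_colength dvr) vB AB; rewrite hE addrC subrK.
Qed.

Lemma cyclic_chain_sub P Q p N Y u : cyclic_chain P Q p N Y -> (u <= N)%N -> P `<=` Y u /\ Y u `<=` Q.
Proof.
by move=> cc uN; split; rewrite -?(cc_0 cc) -?(cc_N cc); apply: (cc_mono cc).
Qed.

Lemma sdual_sdual_step P Q p N Y u : cyclic_chain P Q p N Y -> (u < N)%N ->
  colength O (sdual (sdual (Y u))) (Y u.+1) 1.
Proof.
move=> cc uN; have vY := cc_vol cc (ltnW uN); apply: (@colength1 _ _ (p - u%:Z)).
- by have := isvol_sdual (isvol_sdual vY); congr isvol; lia.
- by have := cc_vol cc uN; congr isvol; lia.
by move=> v; have [w <- _] := tau_bij v => /(sdual_sdual _ vY) Yw; apply: (cc_tau cc uN).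
Qed.

Lemma scale_sdual_step P Q p N Y u : cyclic_chain P Q p N Y -> (u < N)%N ->
  colength O (scale pi (sdual (Y u.+1))) (scale pi (sdual (Y u))) 1.
Proof.
move=> cc uN; apply: colength1; last by apply/scaleS/sdualS; apply: (cc_mono cc).
  exact: (isvol_scale_sdual (cc_vol cc uN)).
by have := isvol_scale_sdual (cc_vol cc (ltnW uN)); congr isvol; lia.
Qed.

(** The volumes are [n - (p - u) - vH] for [A] and [p - u - 1] for [B]; their difference is [h]. The
    isotropy assumption is the inclusion of [pi B] in [A]; everything else comes from the two steps
    of colength 1 in the chain and from [P] and [Q]. *)
Lemma upper_pair P Q p N Y u (h : nat) : cyclic_chain P Q p N Y ->
  stable P -> isvol P p -> Q `<=` sdual P -> scale pi (sdual P) `<=` P ->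
  (u < N)%N -> (forall v w, Y u.+1 v -> Y u w -> O (beta v w)) ->
  h%:Z = n%:Z - vH - p - p + u%:Z + u%:Z + 1 ->
  chain_pair (scale pi (sdual (Y u))) (Y u.+1) h.
Proof.
move=> cc tP vP QP PP uN iso hE; have [PY YQ] := cyclic_chain_sub cc uN.
have [PY' _] := cyclic_chain_sub cc (ltnW uN).
have vA := isvol_scale_sdual (cc_vol cc (ltnW uN)).
have AP : scale pi (sdual (Y u)) `<=` P.
  by apply: subset_trans PP; apply/scaleS/sdualS.
split.
- by eexists; apply: vA.
- by eexists; apply: (cc_vol cc uN).
- by rewrite scale_sdual_scale; apply: (sdual_sdual_step cc uN).
- by move=> v Yv w Aw; have := QP _ (YQ _ Yv); apply; apply: AP.
- exact: (scale_sdual_step cc uN).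
- move=> w Aw v Yv; apply/betaC_int; have /(stable_sdual tP) := QP _ (YQ _ Yv).
  by apply; apply: AP.
- by apply: scaleS => v Yv w Yw; apply: iso.
apply: (colength_of_vol vA (cc_vol cc uN)); first exact: subset_trans PY.
by rewrite hE; lia.
Qed.

(** The roles of [A] and [B] are exchanged, and isotropy modulo [pi] now expresses the inclusion of
    [A] in [B]; the inclusion of [pi B] in [A] holds because [P] is [pi] times the dual of [Q]. *)
Lemma lower_pair P Q p N Y u (h : nat) : cyclic_chain P Q p N Y ->
  P = scale pi (sdual Q) -> stable Q -> Q `<=` sdual Q ->
  (u < N)%N -> (forall v w, Y u.+1 v -> Y u w -> O (beta v w / pi)) ->
  h%:Z = p + p - u%:Z - u%:Z - 1 - n%:Z + vH ->
  chain_pair (Y u.+1) (scale pi (sdual (Y u))) h.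
Proof.
move=> cc PE tQ QQ uN iso hE; have [PY YQ] := cyclic_chain_sub cc uN.
have [PY' _] := cyclic_chain_sub cc (ltnW uN).
have [q' vQ] : exists q', isvol Q q' by exists (p - N%:Z); rewrite -(cc_N cc); apply: (cc_vol cc).
have vB := isvol_scale_sdual (cc_vol cc (ltnW uN)).
have BQ : scale pi (sdual (Y u)) `<=` Q.
  rewrite -[Q in _ `<=` Q](sdual_sdual_stable vQ tQ) -(scale_sdual_scale (sdual Q)) -PE.
  by apply/scaleS/sdualS.
have AB : Y u.+1 `<=` scale pi (sdual (Y u)).
  move=> v Yv; apply/scaleP => // w Yw; rewrite betaZl mulrC; exact: iso.
split.
- by eexists; apply: (cc_vol cc uN).
- by eexists; apply: vB.
- exact: (scale_sdual_step cc uN).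
- by move=> v Bv w Yw; have := QQ _ (BQ _ Bv); apply; apply: YQ.
- by rewrite scale_sdual_scale; apply: (sdual_sdual_step cc uN).
- by move=> v Yv w Bw; have := QQ _ (YQ _ Yv); apply; apply: BQ.
- apply: subset_trans PY; rewrite PE; apply: scaleS.
  by apply: subset_trans BQ _.
by apply: (colength_of_vol (cc_vol cc uN) vB AB); rewrite hE; lia.
Qed.

(* The part of the lattice chain with indices in [lo + 1, ..., hi]; [PO] and [QO] are
   the vertex lattices bounding it, if any. *)
Record segment (h : nat -> nat) (lo hi : nat) (PO QO : option (set 'rV[K]_n))
    (A B : nat -> set 'rV[K]_n) : Prop := {
  sg_pair : forall i, (lo < i <= hi)%N -> chain_pair (A i) (B i) (h i);
  sg_mono : forall i, (lo < i)%N -> (i < hi)%N -> A i.+1 `<=` A i /\ B i `<=` B i.+1;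
  sg_upper : forall Q, QO = Some Q -> forall i, (lo < i <= hi)%N ->
    B i `<=` Q /\ scale pi (sdual Q) `<=` A i;
  sg_lower : forall P, PO = Some P -> forall i, (lo < i <= hi)%N ->
    A i `<=` scale pi (sdual P) /\ P `<=` B i;
  sg_genB : forall Q, QO = Some Q -> forall Z, submodule O Z -> stable Z ->
    B hi `<=` Z -> Q `<=` Z;
  sg_genA : forall P, PO = Some P -> forall Z z, isvol Z z -> stable Z ->
    A lo.+1 `<=` Z -> scale pi (sdual P) `<=` Z;
  sg_mid : forall i Z, (lo < i)%N -> (i < hi)%N -> submodule O Z -> stable Z ->
    B i `<=` Z -> Z `<=` scale pi (sdual (A i.+1)) -> False;
  sg_first : PO = None -> forall Z, submodule O Z -> stable Z ->
    A lo.+1 `<=` Z -> Z `<=` scale pi (sdual (A lo.+1)) -> False;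
  sg_last : QO = None -> forall Z, submodule O Z -> stable Z ->
    B hi `<=` Z -> Z `<=` sdual (B hi) -> False }.

(** The integer [z i] depends on [h i] and [H] only; the chain is used at [u = z i + p - 1], which
    turns the colength formula of [upper_pair] into the assumption on [h i]. If [Q] is contained in
    its dual, isotropy is free. If [Q] is the dual of [P], it needs the bound
    [2 (z i + p) <= N + 1]. *)
Lemma upper_segment (h : nat -> nat) (lo hi : nat) (z : nat -> int) P p Q N QO :
  isvol P p -> isvol Q (p - N%:Z) -> stable P -> stable Q -> P `<=` Q ->
  Q `<=` sdual P -> scale pi (sdual P) `<=` P ->
  (forall i, (lo < i <= hi)%N -> (h i)%:Z = n%:Z - vH - 1 + z i + z i) ->
  (forall i, (lo < i <= hi)%N -> (1 <= z i + p <= N%:Z)%R) ->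
  (forall i j, (lo < i)%N -> (i <= j <= hi)%N -> (z i <= z j)%R) ->
  (lo < hi)%N ->
  match QO with
  | Some Q' => Q' = Q /\ Q `<=` sdual Q
  | None => Q = sdual P /\ forall i, (lo < i <= hi)%N -> ((z i + p) *+ 2 <= N%:Z + 1)%R
  end ->
  exists A B : nat -> set 'rV[K]_n, segment h lo hi (Some P) QO A B.
Proof.
move=> vP vQ tP tQ PQ QP PP hz zN zm lohi QOP.
have piQ v : Q v -> P (pi *: v) by move=> /QP Qv; apply: PP; exists v.
have [Y cc iso] : exists2 Y, cyclic_chain P Q p N Y &
    forall i v w, (lo < i <= hi)%N -> Y (absz (z i + p)) v -> Y (absz (z i + p)).-1 w -> O (beta v w).
  case: QO QOP => [Q' [_ QQ]|[QE hN]].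
    have [Y cc] := cyclic_chain_ex vP vQ PQ tP tQ piQ; exists Y => // i v w ii Yv Yw.
    have Nu := zN _ ii.
    have [_ YQ] : P `<=` Y (absz (z i + p)) /\ Y (absz (z i + p)) `<=` Q.
      by apply: (cyclic_chain_sub cc); lia.
    have [_ YQ'] : P `<=` Y (absz (z i + p)).-1 /\ Y (absz (z i + p)).-1 `<=` Q.
      by apply: (cyclic_chain_sub cc); lia.
    by have := QQ _ (YQ _ Yv); apply; apply: YQ'.
  have [v w|v Qv|Y cc iso] := @cyclic_chain_isotropic P Q p N pi vP vQ PQ tP tQ piQ pi0 sigma_pi.
  - rewrite QE => Pv Pw; have : O (beta v (pi *: w)) by apply: Pv; apply: PP; exists w.
    by rewrite betaZr sigma_pi.
  - rewrite -[P in P v](sdual_sdual_stable vP tP) QE; split=> Pv w Qw.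
      by rewrite mulrAC divff // mul1r; apply: Pv.
    by have := Pv w Qw; rewrite mulrAC divff // mul1r.
  exists Y => // i v w ii Yv Yw.
  have := iso (absz (z i + p)) v w; rewrite mulrAC divff // mul1r; apply => //.
  by have := hN _ ii; have := zN _ ii; lia.
pose u i := (absz (z i + p)).-1.
have uE i : (lo < i <= hi)%N -> (u i < N)%N /\ absz (z i + p) = (u i).+1.
  by move=> /zN; rewrite /u; lia.
have um i : (lo < i)%N -> (i < hi)%N -> (u i <= u i.+1)%N.
  move=> li ih; have := zm i i.+1 li; rewrite leqnSn ih => /(_ isT).
  have := zN i; have := zN i.+1; rewrite /u li ih (ltnW ih) (leqW li) => /(_ isT) ? /(_ isT); lia.
have pair i : (lo < i <= hi)%N ->
    chain_pair (scale pi (sdual (Y (u i)))) (Y (u i).+1) (h i).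
  move=> ii; have [uN E] := uE _ ii; apply: (upper_pair cc) => //.
    by move=> v w Yv Yw; apply: (iso i) => //; rewrite E.
  by rewrite (hz _ ii); have := zN _ ii; move: E; lia.
have subs i : (lo < i <= hi)%N -> [/\ P `<=` Y (u i), P `<=` Y (u i).+1 & Y (u i).+1 `<=` Q].
  move=> /uE[uN _]; have [h1 h2] := cyclic_chain_sub cc uN.
  by have [h3 _] := cyclic_chain_sub cc (ltnW uN).
have lohi1 : (lo < lo.+1 <= hi)%N by rewrite ltnSn.
have hihi : (lo < hi <= hi)%N by rewrite lohi leqnn.
have gen Z i : (lo < i <= hi)%N -> submodule O Z -> stable Z -> Y (u i).+1 `<=` Z -> Q `<=` Z.
  by move=> /uE[uN _] sZ tZ; apply: (cc_gen cc sZ tZ).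
exists (fun i => scale pi (sdual (Y (u i)))), (fun i => Y (u i).+1); split=> //.
- move=> i li ih; split; last by apply: (cc_mono cc); rewrite ltnS um.
  by apply/scaleS/sdualS; apply: (cc_mono cc); rewrite um.
- move=> Q' QE i ii; rewrite QE in QOP; have [-> QQ] := QOP; have [h1 h2 h3] := subs _ ii.
  split=> //; apply/scaleS/sdualS.
  by apply: subset_trans h3; apply: (cc_mono cc).
- move=> _ [<-] i ii; have [h1 h2 h3] := subs _ ii; split=> //.
  by apply/scaleS/sdualS.
- by move=> Q' QE Z sZ tZ; rewrite QE in QOP; have [-> _] := QOP; apply: gen.
- move=> _ [<-] Z zz vZ tZ AZ; have [uN _] := uE _ lohi1.
  have tT : stable (scale pi (sdual Z)) by apply: stable_scale => //; apply: stable_sdual.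
  (* Generation by [A] is dual to smallness: since [Z] contains [A lo.+1], the stable lattice
     [pi Z^v] lies in the double dual of [Y u], hence by stability in [Y u], hence in [P]. *)
  have TP : scale pi (sdual Z) `<=` P.
    apply: (cc_small cc tT uN) => v /tT[w Zw wE].
    apply/(sdual_sdual v (cc_vol cc (ltnW uN))); rewrite -scale_sdual_scale -wE.
    by exists w => //; apply: sdualS AZ _ Zw.
  rewrite -[Z in _ `<=` Z](sdual_sdual_stable vZ tZ) -(scale_sdual_scale (sdual Z)).
  by apply/scaleS/sdualS.
- move=> i Z li ih sZ tZ YZ; rewrite scale_sdual_scale => ZY.
  have ii1 : (lo < i.+1 <= hi)%N by rewrite ih andbT leqW.
  have [uN _] := uE _ ii1; have [_ _ YQ] := subs _ ii1.
  have QZ := gen Z i _ sZ tZ YZ; have {}QZ : Q `<=` Z by apply: QZ; rewrite li ltnW.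
  (* The double dual of [Y u] would contain [Y u.+1], although it has the volume of [Y u]. *)
  have := isvol_le dvr (cc_vol cc uN) (isvol_sdual (isvol_sdual (cc_vol cc (ltnW uN)))).
  move=> /(_ (subset_trans YQ (subset_trans QZ ZY))); lia.
- move=> QE Z sZ tZ YZ ZY; rewrite QE in QOP; have [QE' _] := QOP.
  have [uN _] := uE _ hihi; have QZ := gen Z hi hihi sZ tZ YZ.
  have := isvol_le dvr (isvol_sdual vP) (isvol_sdual (cc_vol cc uN)).
  rewrite -QE' => /(_ (subset_trans QZ ZY)); lia.
Qed.

(** Here [P = pi Q^v] and the chain is used at [u = - e - z i], which decreases with [i]; duality
    turns this into increasing [B i]. *)
Lemma lower_segment (h : nat -> nat) (hi : nat) (z : nat -> int) Q e N :
  isvol Q e -> stable Q -> Q `<=` sdual Q -> scale pi (sdual Q) `<=` Q ->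
  N%:Z = n%:Z - e - e - vH ->
  (forall i, (0 < i <= hi)%N -> (h i)%:Z = n%:Z - vH - 1 + z i + z i) ->
  (forall i, (0 < i <= hi)%N -> (z i <= - e)%R) ->
  (forall i j, (0 < i)%N -> (i <= j <= hi)%N -> (z i <= z j)%R) ->
  (0 < hi)%N ->
  exists A B : nat -> set 'rV[K]_n, segment h 0 hi None (Some Q) A B.
Proof.
move=> vQ tQ QQ PQ NE hz zN zm hi0; pose P := scale pi (sdual Q).
have vP : isvol P (n%:Z - e - vH) := isvol_scale_sdual vQ.
set p := _ - _ in vP; have vQ' : isvol Q (p - N%:Z) by move: vQ; congr isvol; rewrite NE /p; lia.
have tP : stable P by apply: stable_scale => //; apply: stable_sdual.
have piQ v : Q v -> P (pi *: v) by move=> Qv; exists v => //; apply: QQ.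
have [||Y cc iso] := @cyclic_chain_isotropic P Q p N 1 vP vQ' PQ tP tQ piQ (oner_neq0 _) (rmorph1 _).
- by move=> v w Qv Qw; rewrite mul1r; have := QQ _ Qv; apply.
- move=> v Qv; rewrite /P scaleP //; split=> Pv w Qw; last first.
    by rewrite betaZl mulrC -[beta v w]mul1r; apply: Pv.
  by rewrite mul1r mulrC -betaZl; apply: Pv.
pose u i := absz (- e - z i).
have uE i : (0 < i <= hi)%N -> [/\ (u i < N)%N, ((u i).+1.*2 <= N.+1)%N & (u i)%:Z = - e - z i].
  move=> ii; have := zN _ ii; have := hz _ ii; rewrite /u => h1 h2.
  (* In terms of [u] one has [h i = N - 2 u - 1]; its being nonnegative is the isotropy bound
     [2 (u + 1) <= N + 1]. *)
  have h0 : (0 <= (h i)%:Z)%R by [].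
  by rewrite h1 in h0; split; lia.
have um i : (0 < i)%N -> (i < hi)%N -> (u i.+1 <= u i)%N.
  move=> li ih; have := zm i i.+1 li; rewrite leqnSn ih => /(_ isT) zz.
  have [|_ _ E1] := uE i; first by rewrite li ltnW.
  have [|_ _ E2] := uE i.+1; first by rewrite ih.
  by lia.
have subs i : (0 < i <= hi)%N -> [/\ P `<=` Y (u i), P `<=` Y (u i).+1 & Y (u i).+1 `<=` Q].
  move=> /uE[uN _ _]; have [h1 h2] := cyclic_chain_sub cc uN.
  by have [h3 _] := cyclic_chain_sub cc (ltnW uN).
have pair i : (0 < i <= hi)%N ->
    chain_pair (Y (u i).+1) (scale pi (sdual (Y (u i)))) (h i).
  move=> ii; have [uN u2 E] := uE _ ii; apply: (lower_pair cc) => //.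
    by move=> v w Yv Yw; have := iso (u i).+1 v w u2 Yv Yw; rewrite mul1r.
  by rewrite (hz _ ii) E /p; lia.
have BQ i : (0 < i <= hi)%N -> scale pi (sdual (Y (u i))) `<=` Q.
  move=> /subs[h1 _ _]; rewrite -[Q in _ `<=` Q](sdual_sdual_stable vQ tQ).
  rewrite -(scale_sdual_scale (sdual Q)).
  by apply/scaleS/sdualS.
have AB i (ii : (0 < i <= hi)%N) : Y (u i).+1 `<=` scale pi (sdual (Y (u i))).
  exact: colength_sub (cp_h (pair _ ii)).
have gen Z i : (0 < i <= hi)%N -> submodule O Z -> stable Z -> Y (u i).+1 `<=` Z -> Q `<=` Z.
  by move=> /uE[uN _ _] sZ tZ; apply: (cc_gen cc sZ tZ).
(* [pi Y_u^v] lies in [Q], and its volume is one less than that of [pi Y_(u+1)^v], so the latter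
   cannot contain [Q]. *)
have nQ i : (0 < i <= hi)%N -> ~ Q `<=` scale pi (sdual (Y (u i).+1)).
  move=> ii QB; have [uN _ _] := uE _ ii.
  have := isvol_le dvr (isvol_scale_sdual (cc_vol cc (ltnW uN))) (isvol_scale_sdual (cc_vol cc uN)).
  move=> /(_ (subset_trans (BQ _ ii) QB)); lia.
have hihi : (0 < hi <= hi)%N by rewrite hi0 leqnn.
exists (fun i => Y (u i).+1), (fun i => scale pi (sdual (Y (u i)))); split=> //.
- move=> i li ih; split; first by apply: (cc_mono cc); rewrite ltnS um.
  by apply/scaleS/sdualS; apply: (cc_mono cc); rewrite um.
- by move=> _ [<-] i ii; have [h1 h2 h3] := subs _ ii; split=> //; apply: BQ.
- move=> _ [<-] Z sZ tZ BZ; apply: (gen _ _ hihi sZ tZ).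
  by apply: subset_trans (AB _ hihi) BZ.
- move=> i Z li ih sZ tZ BZ ZB.
  have ii : (0 < i <= hi)%N by rewrite li ltnW.
  apply: (nQ i.+1); first by rewrite ih.
  apply: subset_trans ZB; apply: (gen _ _ ii sZ tZ).
  by apply: subset_trans (AB _ ii) BZ.
- move=> _ Z sZ tZ YZ ZY; apply: (nQ 1%N) => //.
  by apply: subset_trans ZY; apply: (gen _ 1%N _ sZ tZ YZ).
Qed.

(** * Gluing the segments along the index set *)

Section Gluing.
Variables (m : nat) (h : nat -> nat) (z : nat -> int) (I : nat -> bool).
Variables (L0 Pl : nat -> set 'rV[K]_n).
Hypothesis hz : forall i, (1 <= i <= m)%N -> (h i)%:Z = n%:Z - vH - 1 + z i + z i.
Hypothesis h_mono : forall i j, (1 <= i)%N -> (i <= j <= m)%N -> (h i <= h j)%N.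
Hypothesis h_le : forall i, (1 <= i <= m)%N -> (h i <= n)%N.
Hypothesis I_ne : exists2 i, (i <= m)%N & I i.
Hypothesis L0_vertex : forall i, I i -> (0 < i <= m)%N -> exists a,
  [/\ isvol (L0 i) a, stable (L0 i), L0 i `<=` sdual (L0 i),
      scale pi (sdual (L0 i)) `<=` L0 i & (h i)%:Z + 1 <= n%:Z - vH - a - a].
Hypothesis Pl_vertex : forall i, I i -> (i < m)%N -> exists p,
  [/\ isvol (Pl i) p, stable (Pl i), Pl i `<=` sdual (Pl i),
      scale pi (sdual (Pl i)) `<=` Pl i & n%:Z - vH - p - p <= (h i.+1)%:Z - 1].
Hypothesis L0_Pl : forall i, I i -> (0 < i < m)%N -> L0 i `<=` Pl i.
Hypothesis Pl_L0 : forall i j, I i -> I j -> (i < j <= m)%N -> Pl i `<=` L0 j.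

Fixpoint last_below i := if i is j.+1 then (if I j then Some j else last_below j) else None.

Fixpoint first_from d i :=
  if I i then Some i else if d is e.+1 then first_from e i.+1 else None.

Lemma last_belowP i : match last_below i with
  | Some a => [/\ (a < i)%N, I a & forall j, (a < j < i)%N -> ~~ I j]
  | None => forall j, (j < i)%N -> ~~ I j end.
Proof.
elim: i => [//|i] /=; case: ifP => [Ii _|/negbT nIi].
  by split=> // j /andP[]; rewrite ltnS => /leq_trans lt /lt; rewrite ltnn.
case: last_below => [a [ai Ia H']|H'].
  split=> // [|j /andP[aj]]; first exact: ltnW.
  by rewrite ltnS leq_eqVlt => /orP[/eqP->//|ji]; apply: H'; rewrite aj.
by move=> j; rewrite ltnS leq_eqVlt => /orP[/eqP->//|]; apply: H'.
Qed.

Lemma first_fromP d i : match first_from d i with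
  | Some b => [/\ (i <= b <= i + d)%N, I b & forall j, (i <= j < b)%N -> ~~ I j]
  | None => forall j, (i <= j <= i + d)%N -> ~~ I j end.
Proof.
elim: d i => [|d IH] i /=.
  case: ifP => [Ii|/negbT nIi]; last first.
    by move=> j; rewrite addn0 -eqn_leq => /eqP <-.
  by rewrite addn0 leqnn; split=> // j; rewrite leqNgt andNb.
case: ifP => [Ii|/negbT nIi].
  by rewrite leqnn leq_addr; split=> // j; rewrite leqNgt andNb.
have := IH i.+1; case: first_from => [b [bi Ib H']|H'].
  split=> // [|j /andP[]]; first by lia.
  by rewrite leq_eqVlt => /orP[/eqP<-//|ij jb]; apply: H'; rewrite ij.
move=> j /andP[]; rewrite leq_eqVlt => /orP[/eqP<-//|ij jd]; apply: H'; lia.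
Qed.

(* The neighbours of [i] in [I]; the indices sharing them form a segment. *)
Definition key i := (last_below i, first_from (m - i) i).
Definition key_seg (c : option nat * option nat) (AB : (nat -> set 'rV[K]_n) * (nat -> set 'rV[K]_n)) :=
  segment h (odflt 0%N c.1) (odflt m c.2) (omap Pl c.1) (omap L0 c.2) AB.1 AB.2.

Lemma key_range i : (1 <= i <= m)%N -> (odflt 0 (key i).1 < i <= odflt m (key i).2)%N.
Proof.
move=> im; rewrite /key /=; have := last_belowP i; have := first_fromP (m - i) i.
by case: last_below => [a|]; case: first_from => [b|] /=; first [move=> [? _ _] [? _ _]
  | move=> [? _ _] _| move=> _ [? _ _]| move=> _ _]; lia.
Qed.

(** The cases are: two neighbours in [I], only a lower one, only an upper one; none is impossible as
    [I] is nonempty. Through [hz] the type bounds read [1 <= z j + p] for [Pl] and [z j <= - e] for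
    [L0], which places [z j + p] between 1 and the length of the chain. *)
Lemma key_segment i : (1 <= i <= m)%N -> exists AB, key_seg (key i) AB.
Proof.
move=> im; have := key_range im; rewrite /key_seg /key /=.
have := last_belowP i; have := first_fromP (m - i) i.
case: last_below => [a|]; case: first_from => [b|] /=.
- move=> [bi Ib _] [ai Ia _] _; have bm : (0 < b <= m)%N by lia.
  have am : (a < m)%N by lia.
  have [e [vQ tQ QQ PQ hQ]] := L0_vertex Ib bm.
  have [p [vP tP PP PP' hP]] := Pl_vertex Ia am.
  have sub : Pl a `<=` L0 b by apply: Pl_L0 => //; lia.
  have ep := isvol_le dvr vP vQ sub.
  have [N NE] : exists N : nat, p - N%:Z = e by exists (absz (p - e)%R); lia.
  have [||||||A [B AB]] := @upper_segment h a b z (Pl a) p (L0 b) N (Some (L0 b)) vP _ tP tQ sub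
    (subset_trans QQ (sdualS sub)) PP'.
  + by rewrite NE.
  + by move=> j jj; apply: hz; lia.
  + move=> j jj; have h1 := h_mono (i := a.+1) (j := j).
    have h2 := h_mono (i := j) (j := b); have := hz (i := j); lia.
  + move=> j l jj ll; have := h_mono (i := j) (j := l); have := hz (i := j).
    have := hz (i := l); lia.
  + by lia.
  + by [].
  by exists (A, B).
- move=> H' [ai Ia _] _; have am : (a < m)%N by lia.
  have [p [vP tP PP PP' hP]] := Pl_vertex Ia am.
  have zE j : (a < j <= m)%N -> (1 <= z j + p)%R.
    move=> jj; have h1 := h_mono (i := a.+1) (j := j).
    have := hz (i := j); lia.
  (* Equivalent to [h j <= n]; [p + p + vH] is the length of [P^v / P], so this is the isotropy
     bound. *)
  have zE' j : (a < j <= m)%N -> ((z j + p) *+ 2 <= p + p + vH + 1)%R.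
    move=> jj; have := h_le (i := j); have := hz (i := j); lia.
  have [N NE] : exists N : nat, N%:Z = p + p + vH.
    by exists (absz (p + p + vH)%R); have := zE m; have := zE' m; lia.
  have [||||||A [B AB]] := @upper_segment h a m z (Pl a) p (sdual (Pl a)) N None vP _ tP
    (stable_sdual tP) PP (@subset_refl _ _) PP'.
  + by have := isvol_sdual vP; congr isvol; lia.
  + by move=> j jj; apply: hz; lia.
  + move=> j jj; have := zE j jj; have := zE' j jj; lia.
  + move=> j l jj ll; have := h_mono (i := j) (j := l); have := hz (i := j).
    have := hz (i := l); lia.
  + by [].
  + by split=> // j jj; rewrite NE; apply: zE'.
  by exists (A, B).
- move=> [bi Ib _] _ _; have bm : (0 < b <= m)%N by lia.
  have [e [vQ tQ QQ PQ hQ]] := L0_vertex Ib bm.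
  have [N NE] : exists N : nat, N%:Z = n%:Z - e - e - vH.
    by exists (absz (n%:Z - e - e - vH)%R); lia.
  have [||||A [B AB]] := @lower_segment h b z (L0 b) e N vQ tQ QQ PQ NE.
  + by move=> j jj; apply: hz; lia.
  + move=> j jj; have h2 := h_mono (i := j) (j := b); have := hz (i := j); lia.
  + move=> j l jj ll; have := h_mono (i := j) (j := l); have := hz (i := j).
    have := hz (i := l); lia.
  + by lia.
  by exists (A, B).
move=> H1 H2; have [j jm Ij] := I_ne.
have [ij|ji] := leqP i j; last by have := H2 _ ji; rewrite Ij.
by have := H1 j; rewrite ij subnKC ?jm; [move=> /(_ isT); rewrite Ij|case/andP: im].
Qed.

(** Segments are chosen as a function of the key, so that consecutive indices with the same key use
    the same segment and inherit its inclusions; keys that do not occur get a default value. *)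
Lemma core_chain : exists A B : nat -> set 'rV[K]_n,
  [/\ forall i, (1 <= i <= m)%N -> chain_pair (A i) (B i) (h i),
      forall i, (1 <= i < m)%N -> A i.+1 `<=` A i /\ B i `<=` B i.+1,
      forall i, I i -> (0 < i <= m)%N -> B i `<=` L0 i /\
        forall Z, submodule O Z -> stable Z -> B i `<=` Z -> L0 i `<=` Z,
      forall i, I i -> (i < m)%N -> A i.+1 `<=` scale pi (sdual (Pl i)) /\
        forall Z s, isvol Z s -> stable Z -> A i.+1 `<=` Z -> scale pi (sdual (Pl i)) `<=` Z
    & [/\ forall i Z, ~~ I i -> (0 < i < m)%N -> submodule O Z -> stable Z ->
            B i `<=` Z -> ~ Z `<=` scale pi (sdual (A i.+1)),
          forall Z, ~~ I 0%N -> (0 < m)%N -> submodule O Z -> stable Z ->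
            A 1%N `<=` Z -> ~ Z `<=` scale pi (sdual (A 1%N))
        & forall Z, ~~ I m -> (0 < m)%N -> submodule O Z -> stable Z ->
            B m `<=` Z -> ~ Z `<=` sdual (B m)]].
Proof.
have ex c : exists AB, (exists2 i, (1 <= i <= m)%N & key i = c) -> key_seg c AB.
  have [[i im <-]|no] := pselect (exists2 i, (1 <= i <= m)%N & key i = c).
    by have [AB seg] := key_segment im; exists AB.
  by exists (fun=> set0, fun=> set0).
have [F FP] := choice ex.
have seg i : (1 <= i <= m)%N -> key_seg (key i) (F (key i)) by move=> im; apply: FP; exists i.
have keyS i : (i < m)%N -> ~~ I i -> key i.+1 = key i.
  move=> im nI; rewrite /key /= (negPf nI); congr (_, _).
  by rewrite -[(m - i)%N](_ : (m - i.+1).+1 = m - i)%N /= ?(negPf nI) //; lia.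
have keyhi i : I i -> (key i).2 = Some i by rewrite /key /=; case: (m - i)%N => [|d] /= ->.
have keylo i : I i -> (key i.+1).1 = Some i by rewrite /key /= => ->.
pose A i := (F (key i)).1 i; pose B i := (F (key i)).2 i; exists A, B.
have up i : I i -> (0 < i <= m)%N -> B i `<=` L0 i /\ scale pi (sdual (L0 i)) `<=` A i.
  move=> Ii im; have sg := seg _ im; have rg := key_range im.
  by move: (sg_upper sg (Q := L0 i)) rg; rewrite (keyhi _ Ii) => H' rg; apply: (H' erefl).
have low i : I i -> (i < m)%N -> A i.+1 `<=` scale pi (sdual (Pl i)) /\ Pl i `<=` B i.+1.
  move=> Ii im; have im1 : (1 <= i.+1 <= m)%N by [].
  have sg := seg _ im1; have rg := key_range im1.
  by move: (sg_lower sg (P := Pl i)) rg; rewrite (keylo _ Ii) => H' rg; apply: (H' erefl).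
split.
- by move=> i im; apply: (sg_pair (seg _ im)); apply: key_range.
- move=> i /andP[i0 im]; have im' : (1 <= i <= m)%N by rewrite i0 ltnW.
  have [Ii|nI] := boolP (I i).
    have i0m : (0 < i < m)%N by rewrite i0.
    (* At a junction the two segments are compared through the vertex lattices: [B i], [L0 i],
       [Pl i], [B i.+1] increase, and dually for [A]. *)
    have [b1 a1] := up _ Ii im'; have [a2 b2] := low _ Ii im.
    split; last exact: subset_trans b1 (subset_trans (L0_Pl Ii i0m) b2).
    by apply: subset_trans a2 (subset_trans _ a1); apply/scaleS/sdualS/L0_Pl.
  rewrite /A /B keyS //; have sg := seg _ im'; have := key_range im' => /andP[r1 r2].
  apply: (sg_mono sg r1); rewrite ltn_neqAle r2 andbT.
  have := first_fromP (m - i) i; rewrite /key /=; case: first_from => [b [_ Ib _]|_] /=; last by lia.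
  by apply: contraNneq nI => ->.
- move=> i Ii im; split; first by have [] := up _ Ii im.
  move=> Z sZ tZ BZ; have sg := seg _ im.
  have := sg_genB sg (Q := L0 i); rewrite (keyhi _ Ii) /=; apply => //.
- move=> i Ii im; split; first by have [] := low _ Ii im.
  move=> Z s vZ tZ AZ; have sg := seg i.+1 im.
  have := sg_genA sg (P := Pl i); rewrite (keylo _ Ii) /= => /(_ erefl _ _ vZ tZ); apply.
  by [].
split=> [i Z nI /andP[i0 im] sZ tZ BZ|Z nI im sZ tZ AZ|Z nI im sZ tZ BZ] ZA.
- have im' : (1 <= i <= m)%N by rewrite i0 ltnW.
  have sg := seg _ im'; have := key_range im' => /andP[r1 r2].
  apply: (sg_mid sg r1 _ sZ tZ BZ); last by rewrite -(keyS _ im nI).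
  rewrite ltn_neqAle r2 andbT.
  have := first_fromP (m - i) i; rewrite /key /=; case: first_from => [b [_ Ib _]|_] /=; last by lia.
  by apply: contraNneq nI => ->.
- have k1 : (key 1).1 = None by rewrite /key /= (negPf nI).
  have sg := seg 1%N im; have := sg_first sg; rewrite k1 /= => /(_ erefl Z sZ tZ AZ ZA).
  by [].
have k1 : (key m).2 = None by rewrite /key /= subnn /= (negPf nI).
have mm : (1 <= m <= m)%N by rewrite im leqnn.
have sg := seg m mm; have := sg_last sg; rewrite k1 /= => /(_ erefl Z sZ tZ BZ ZA).
by [].
Qed.

End Gluing.

End Sesqui.

(** * Integral closures as subrings *)

Section SubringType.
Variables (K : fieldType) (O : set K).
Hypothesis subO : is_subring O.

(** [integralOver] speaks of a ring morphism, so the subset [O] is made into a ring type in order to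
    use the closure properties of integral elements. *)
Definition subring_pred (x : K) : bool := `[< O x >].

Fact subring_pred_closed : subring_closed subring_pred.
Proof.
split=> [|x y|x y]; rewrite ?unfold_in; first exact/asboolP/(ring1 subO).
- by move=> /asboolP Ox /asboolP Oy; apply/asboolP/(ringB subO).
- by move=> /asboolP Ox /asboolP Oy; apply/asboolP/(ringM subO).
Qed.
HB.instance Definition _ := GRing.isSubringClosed.Build K subring_pred subring_pred_closed.

Definition subring_type := {x : K | subring_pred x}.
HB.instance Definition _ := SubChoice.on subring_type.
HB.instance Definition _ := [SubChoice_isSubComNzRing of subring_type by <:].

Variable L : fieldExtType K.

Lemma integral_closureE (x : L) :
  integral_closure O L x <-> integralOver (in_alg L \o (val : subring_type -> K)) x.
Proof.
split=> [[f [fm fO rx]]|[f fm rx]].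
  pose g : {poly subring_type} := \poly_(i < size f) insubd 0 f`_i.
  have gE : map_poly val g = f.
    apply/polyP => i; rewrite coef_map coef_poly.
    case: ltnP => [_|fi]; last by rewrite [RHS]nth_default.
    by apply: (@insubdK _ subring_pred subring_type 0); rewrite unfold_in; apply/asboolP.
  exists g; last by rewrite map_poly_comp gE.
  by apply/eqP/val_inj; rewrite -(lead_coef_map_inj val_inj) // gE (eqP fm).
exists (map_poly val f); split; last by rewrite -map_poly_comp.
  by rewrite monicE (lead_coef_map_inj val_inj) // (eqP fm).
by move=> i; rewrite coef_map; apply/asboolP/(valP f`_i).
Qed.

Lemma integral_closure_subring : is_subring (integral_closure O L).
Proof.
split=> [|x y|x y]; rewrite !integral_closureE; first exact: integral1.
- exact: integral_sub.
- exact: integral_mul.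
Qed.

End SubringType.

(** * Arithmetic of relative Witt vectors *)

(** With [f] of degree [d + 1], multiplying [f(a^-1) = 0] by [a ^+ d] expresses [a^-1] as a
    polynomial in [a] over [O]. *)
Lemma integral_inv_in (K : fieldType) (O : set K) (f : {poly K}) a :
  is_subring O -> O a -> a != 0 -> f \is monic -> (forall i, O f`_i) -> root f a^-1 -> O a^-1.
Proof.
move=> subO Oa a0 fm fO /rootP fa.
have [d dE] : exists d, size f = d.+2.
  move: fa fm; case: (size f) (size_poly_leq0P f) (size1_polyC (p := f)) => [|[|d]] h0 h1.
  - by move=> _; rewrite (_ : f = 0) ?monicE ?lead_coef0 1?eq_sym ?oner_eq0 //; apply/h0.
  - rewrite h1 // hornerC monicE lead_coefC => ->.
    by rewrite eq_sym oner_eq0.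
  - by exists d.
have lf : f`_d.+1 = 1 by move/monicP: fm; rewrite lead_coefE dE.
move: fa; rewrite horner_coef dE big_ord_recr /= lf mul1r => /(congr1 (fun x => a ^+ d * x)).
rewrite mulr0 mulrDr exprS mulrCA -exprMn divff // expr1n mulr1 => /eqP.
rewrite addrC addr_eq0 => /eqP ->; apply: (ringN subO); rewrite mulr_sumr.
apply: (ring_sum subO) => i _; rewrite mulrCA; apply: (ringM subO) => //.
have id : (i <= d)%N by rewrite -ltnS.
have -> : a ^+ d = a ^+ (d - i) * a ^+ i by rewrite -exprD subnK.
rewrite -mulrA -exprMn divff // expr1n mulr1.
exact: (ringX subO).
Qed.

Lemma algebraic_root (K : fieldType) (L : fieldExtType K) (x : L) :
  exists2 f : {poly K}, f \is monic & root (map_poly (in_alg L) f) x.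
Proof.
have /polyOver1P[f fE] := minPolyOver 1%AS x.
exists f; last by rewrite -fE root_minPoly.
by rewrite -(map_monic (in_alg L)) -fE monic_minPoly.
Qed.

Section WittDvr.
Variables (F : fieldType) (OF : set F) (pi : F) (Fq : finFieldType) (resF : F -> Fq).
Variables (R : fieldType) (j : Fq -> R) (W : rel_witt OF pi resF j).
Hypotheses (OFpi : OF pi) (pi0 : pi != 0).

Lemma witt_dvr : is_dvr (wint W) (wstr W pi) (wred W).
Proof.
split; [exact: wint_subring|exact: wint_frac|exact: wint_complete|exact: wred_residue| |].
  by rewrite fmorph_eq0.
exact: wstr_int.
Qed.

Lemma wred_nat n : wred W n%:R = n%:R.
Proof.
have subO := wint_subring W; have res := wred_residue W.
elim: n => [|n IH]; first exact: (dvr_red0 witt_dvr).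
by rewrite mulrS (resD res) ?(res1 res) ?IH -?mulrS //; [apply: (ring1 subO)|apply: (ring_nat subO)].
Qed.

Lemma wred_nat0 l : OF (l%:R / pi) -> l%:R = 0 :> R.
Proof.
move=> /(wstr_int W); rewrite fmorph_div rmorph_nat => Ol.
have Onat := ring_nat (wint_subring W) l.
by rewrite -wred_nat; apply/(res_ker (wred_residue W)).
Qed.

End WittDvr.

Section Arithmetic.
Variables (p : nat) (p_odd : odd p).
Variables (Qp : fieldType) (Zp : set Qp) (HQp : padic_numbers p Zp).
Variables (F : fieldExtType Qp) (pi : F).
Local Notation OF := (integral_closure Zp F).
Hypothesis Hpi : uniformizer OF pi.
Let subZ := padic_subring HQp.
Let subF : is_subring OF := integral_closure_subring subZ F.

Lemma OF_pi : OF pi. Proof. by case: Hpi. Qed.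

Lemma uniformizer_neq0 : pi != 0.
Proof.
case: Hpi => _ + _; apply: contra_not_neq => ->.
by rewrite invr0; apply: (ring0 subF).
Qed.

(** If [p] were a unit of the integers of [F], its inverse would be integral over [Zp], hence in
    [Zp], and 1 would be divisible by all powers of [p]. *)
Lemma OF_p : OF (p%:R / pi).
Proof.
have [_ _ div] := Hpi; apply: div; first exact: (ring_nat subF).
case=> f [fm fO rf]; have p0 := padic_neq0 HQp.
have rf' : root f p%:R^-1.
  by rewrite -(fmorph_root (in_alg F)) /= -in_algE fmorphV rmorph_nat.
have pV := integral_inv_in subZ (ring_nat subZ p) p0 fm fO rf'.
have [sep _] := padic_complete HQp; have := oner_neq0 Qp.
rewrite (sep 1) ?eqxx // => n; rewrite div1r -exprVn; exact: (ringX subZ).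
Qed.

(** As [pi] divides [p], the residue field has characteristic [p], which is odd. *)
Lemma witt_two_neq0 (Fq : finFieldType) (resF : F -> Fq) (R : fieldType) (j : Fq -> R)
  (W : rel_witt OF pi resF j) : 2%:R != 0 :> R.
Proof.
have p0 := wred_nat0 W OF_pi uniformizer_neq0 OF_p.
have := oner_neq0 R; apply: contraNneq => two0; rewrite -p0 -(odd_double_half p) p_odd.
by rewrite natrD -muln2 natrM two0 mulr0 addr0.
Qed.

(** If [s] is a root of the monic [f] of degree [d] and [P] clears the denominators, then [P s] is a
    root of the integral polynomial with coefficients [f_i P^(d - i)]. *)
Lemma OF_frac s : exists N, OF (p%:R ^+ N * s).
Proof.
have [f fm rf] := algebraic_root s.
have [nu Hnu] := choice (fun i => padic_frac HQp f`_i).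
pose d := (size f).-1; pose N := (\sum_(i < d) nu i)%N; pose P := p%:R ^+ N : Qp.
have szf : size f = d.+1 by rewrite prednK // lt0n size_poly_eq0 monic_neq0.
have fd : f`_d = 1 by move/monicP: fm.
pose g := \poly_(i < d.+1) (f`_i * P ^+ (d - i)).
exists N; exists g; split.
- rewrite monicE lead_coefE.
  have gd : g`_d = 1 by rewrite coef_poly ltnSn subnn expr0 mulr1.
  suff -> : (size g).-1 = d by rewrite gd.
  by rewrite size_poly_eq //= subnn expr0 mulr1 fd oner_eq0.
- move=> i; rewrite coef_poly; case: ltnP => [|_]; last exact: (ring0 subZ).
  rewrite ltnS leq_eqVlt => /orP[/eqP->|id].
    by rewrite subnn expr0 mulr1 fd; apply: (ring1 subZ).
  rewrite -(subnK (_ : 1 <= d - i)%N) ?subn_gt0 // exprD expr1 mulrCA.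
  apply: (ringM subZ); first by do 2!apply: (ringX subZ); apply: (ring_nat subZ).
  rewrite mulrC /P /N (bigD1 (Ordinal id)) //= addnC exprD -mulrA.
  by apply: (ringM subZ) => //; apply: (ringX subZ); apply: (ring_nat subZ).
have PE : p%:R ^+ N = P%:A :> F by rewrite -in_algE rmorphXn rmorph_nat.
move/rootP: rf; rewrite horner_coef size_map_poly szf => sum0.
have gE : map_poly (in_alg F) g = \poly_(i < d.+1) ((f`_i)%:A * P%:A ^+ (d - i)).
  apply/polyP => i; rewrite coef_map !coef_poly; case: ifP => _; last by rewrite /= scale0r.
  by rewrite -[LHS]/(GRing.in_alg F (f`_i * P ^+ (d - i))) rmorphM rmorphXn.
apply/rootP; rewrite gE horner_poly.
transitivity ((P%:A : F) ^+ d * \sum_(i < d.+1) (map_poly (in_alg F) f)`_i * s ^+ i).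
  rewrite mulr_sumr.
  apply: eq_bigr => i _; have -> : (map_poly (in_alg F) f)`_i = (f`_i)%:A by rewrite coef_map.
  have -> : (P%:A : F) ^+ d = P%:A ^+ (d - i) * P%:A ^+ i by rewrite -exprD subnK // -ltnS.
  by rewrite PE exprMn; ring.
by rewrite sum0 mulr0.
Qed.

(** Division by [pi] stops because the integers of [F] map into Witt vectors, which are
    [pi]-adically separated. *)
Lemma OF_pi_power (Fq : finFieldType) (resF : F -> Fq) (R : fieldType) (j : Fq -> R)
  (W : rel_witt OF pi resF j) y : OF y -> y != 0 ->
  exists a, OF (y / pi ^+ a) /\ OF (y / pi ^+ a)^-1.
Proof.
move=> Oy y0; apply: contrapT => no; have [_ _ div] := Hpi.
have H n : OF (y / pi ^+ n).
  elim: n => [|n IH]; first by rewrite expr0 divr1.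
  rewrite exprSr invfM mulrA; apply: div => // OV; apply: no; exists n.
  by [].
have [sep _] := wint_complete W.
have /eqP : wstr W y = 0.
  by apply: sep => n; have := wstr_int W (H n); rewrite fmorph_div rmorphXn.
by rewrite fmorph_eq0 (negPf y0).
Qed.

(** Numerator and denominator of [s] are units times powers of [pi]; a negative exponent would make
    [pi^-1] integral in the Witt vectors. *)
Lemma OF_of_wint (Fq : finFieldType) (resF : F -> Fq) (R : fieldType) (j : Fq -> R)
  (W : rel_witt OF pi resF j) s : wint W (wstr W s) -> OF s.
Proof.
have pi0 := uniformizer_neq0; have [->|s0] := eqVneq s 0; first by move=> _; apply: (ring0 subF).
move=> Ws; have [N ON] := OF_frac s.
have pN0 : p%:R ^+ N != 0 :> F.
  by rewrite expf_neq0 // -(rmorph_nat (in_alg F)) fmorph_eq0 (padic_neq0 HQp).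
have OpN : OF (p%:R ^+ N) by apply: (ringX subF); apply: (ring_nat subF).
have [|a [Oa OaV]] := OF_pi_power W ON; first exact: mulf_neq0.
have [b [Ob ObV]] := OF_pi_power W OpN pN0.
set y := _ * s in Oa OaV; set t := _ ^+ N in Ob ObV pN0.
have sE : s = y / t by rewrite /y mulrC mulKf.
have [ba|ab] := leqP b a.
  have -> : s = (y / pi ^+ a) * (t / pi ^+ b)^-1 * pi ^+ (a - b).
    have -> : pi ^+ a = pi ^+ (a - b) * pi ^+ b by rewrite -exprD subnK.
    rewrite sE; field; by rewrite pN0 !expf_neq0.
  by apply: (ringM subF); [apply: (ringM subF)|apply: (ringX subF); apply: OF_pi].
have subW := wint_subring W.
case: (dvr_npiV (witt_dvr W OF_pi pi0)).
have -> : (wstr W pi)^-1 = wstr W ((y / pi ^+ a)^-1 * (t / pi ^+ b) * pi ^+ (b - a).-1) * wstr W s.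
  rewrite -rmorphM -fmorphV; congr (wstr W _).
  have bE : pi ^+ b = pi ^+ (b - a).-1 * pi * pi ^+ a.
    by rewrite -exprSr prednK ?subn_gt0 // -exprD subnK // ltnW.
  have y0 : y != 0 by rewrite mulf_neq0.
  by rewrite sE bE; field; rewrite pN0 y0 pi0 !expf_neq0.
apply: (ringM subW) => //; apply: wstr_int.
by apply: (ringM subF); [apply: (ringM subF)|apply: (ringX subF); apply: OF_pi].
Qed.

Section Unramified.
Variables (E : fieldExtType F) (degE : \dim {:E} = 2%N).
Variables (conjE : {rmorphism E -> E}) (conjE_F : forall a : F, conjE a%:A = a%:A).
Hypothesis conjE_neq : exists x, conjE x != x.

Lemma conj_quadratic e : conjE e != e -> exists c d : F,
  [/\ forall x, exists a b : F, x = a%:A + b *: e, conjE e = d%:A - e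
    & e * e = c%:A + d *: e].
Proof.
move=> ee; have conjZ (a : F) x : conjE (a *: x) = a *: conjE x.
  by rewrite -[a *: x]mulr_algl -[a *: conjE x]mulr_algl rmorphM conjE_F.
have nF (a : F) : a%:A != e by apply: contraNneq ee => <-; rewrite conjE_F.
have fr : free [:: 1; e].
  rewrite free_cons span_seq1 seq1_free; apply/andP; split; last first.
    by rewrite -(scale0r 1) eq_sym nF.
  apply/negP => /vlineP[a aE]; have a0 : a != 0.
    by apply: contraTneq (oner_neq0 E) => a0; rewrite aE a0 scale0r eqxx.
  by have := nF a^-1; rewrite aE scalerA mulVf // scale1r eqxx.
have full : <<[:: (1 : E); e]%R>>%VS = {:E}%VS.
  by apply/eqP; rewrite eqEdim subvf degE /=; have /eqP -> := fr.
have gen x : exists a b : F, x = a%:A + b *: e.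
  have : x \in <<[:: (1 : E); e]%R>>%VS by rewrite full memvf.
  rewrite span_cons span_seq1 => /memv_addP[u /vlineP[a ->] [v /vlineP[b ->] ->]].
  by exists a, b.
have [c [d cd]] := gen (e * e); exists c, d; split=> //.
have : (conjE e - e) * (conjE e - (d%:A - e)) = 0.
  have := congr1 conjE cd; rewrite rmorphM rmorphD conjE_F conjZ => cd'.
  have -> : (conjE e - e) * (conjE e - (d%:A - e)) =
    conjE e * conjE e - e * e - d%:A * conjE e + d%:A * e by ring.
  by rewrite cd' cd !mulr_algl; ring.
by move=> /eqP; rewrite mulf_eq0 !subr_eq0 (negPf ee) /= => /eqP.
Qed.

Variables (Fq : finFieldType) (resF : F -> Fq) (Fq2 : finFieldType) (j2 : Fq -> Fq2).
Hypothesis cardFq2 : #|Fq2| = (#|Fq| ^ 2)%N.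
Variables (L : rel_witt OF pi resF j2) (phi0 : {rmorphism E -> L}).
Hypotheses (phi0_bij : bijective phi0) (phi0_F : forall a : F, phi0 a%:A = wstr L a).
Let dvrL := witt_dvr L OF_pi uniformizer_neq0.

Lemma residue_moved : exists a : Fq2, a ^+ #|Fq| != a.
Proof.
apply: contrapT => no; have q1 : (1 < #|Fq|)%N := card_finNzRing_gt1 Fq.
have H (a : Fq2) : a ^+ #|Fq| = a by apply: contrapT => /eqP Ha; apply: no; exists a.
have lt : (size (- 'X : {poly Fq2})%R < size ('X^#|Fq| : {poly Fq2}))%N.
  by rewrite size_polyN size_polyX size_polyXn ltnS.
have sz : size ('X^#|Fq| - 'X : {poly Fq2})%R = #|Fq|.+1 by rewrite size_polyDl // size_polyXn.
have f0 : ('X^#|Fq| - 'X : {poly Fq2})%R != 0 by rewrite -size_poly_eq0 sz.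
have rts : all (root ('X^#|Fq| - 'X : {poly Fq2})%R) (enum Fq2).
  by apply/allP => a _; rewrite rootE !hornerE H subrr.
have := max_poly_roots f0 rts (enum_uniq _); rewrite sz -cardE cardFq2 ltnS leqNgt.
by case/negP; rewrite -mulnn -[X in (X < _)%N]muln1 ltn_pmul2l // ltnW.
Qed.

Lemma wfrob_moved : exists2 y, wint L y & wred L (y - wfrob L y) != 0.
Proof.
have [a aq] := residue_moved; have [y Oy ya] := res_surj (wred_residue L) a.
exists y => //; rewrite (dvr_redB dvrL) //; last exact: wfrob_int.
by rewrite wfrob_red // ya subr_eq0 eq_sym.
Qed.

(** The Frobenius sends a generator [e] of [E] to a root of the same quadratic equation. Were it to
    fix [e], it would be trivial on all of [L], against its action on the residue field. *)
Lemma wfrob_phi0 x : wfrob L (phi0 x) = phi0 (conjE x).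
Proof.
have [e ee] := conjE_neq; have [c [d [gen conje e2]]] := conj_quadratic ee.
have phiZ (a : F) z : phi0 (a *: z) = wstr L a * phi0 z by rewrite -mulr_algl rmorphM phi0_F.
suff He : wfrob L (phi0 e) = phi0 (conjE e).
  have [a [b ->]] := gen x; have conjZ z : conjE (b *: z) = b *: conjE z.
    by rewrite -[b *: z]mulr_algl -[b *: conjE z]mulr_algl rmorphM conjE_F.
  by rewrite !rmorphD conjE_F conjZ /= phi0_F !phiZ rmorphM !wfrob_str He.
have : (wfrob L (phi0 e) - phi0 e) * (wfrob L (phi0 e) - phi0 (conjE e)) = 0.
  have := congr1 phi0 e2; rewrite rmorphM rmorphD phi0_F phiZ => E1.
  have := congr1 (wfrob L) E1; rewrite rmorphM rmorphD rmorphM !wfrob_str => E2.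
  rewrite conje rmorphB phi0_F mulrBl !mulrBr E2 E1; ring: E1 E2.
move/eqP; rewrite mulf_eq0 !subr_eq0 => /orP[/eqP fe|/eqP //].
have [y Oy] := wfrob_moved; have [g gK Kg] := phi0_bij.
suff -> : wfrob L y = y by rewrite subrr (dvr_red0 dvrL) eqxx.
rewrite -(Kg y); have [a [b ->]] := gen (g y).
by rewrite rmorphD /= phi0_F phiZ rmorphD rmorphM !wfrob_str fe.
Qed.

Lemma conjE_involutive x : conjE (conjE x) = x.
Proof.
have [e ee] := conjE_neq; have [c [d [gen conje e2]]] := conj_quadratic ee.
have conjZ (a : F) z : conjE (a *: z) = a *: conjE z.
  by rewrite -[a *: z]mulr_algl -[a *: conjE z]mulr_algl rmorphM conjE_F.
have [a [b ->]] := gen x; rewrite !rmorphD !conjE_F !conjZ /= conje rmorphB conjE_F conje.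
by rewrite subKr.
Qed.

Lemma wfrob2 y : wfrob L (wfrob L y) = y.
Proof.
have [g gK Kg] := phi0_bij.
by rewrite -(Kg y) !wfrob_phi0 conjE_involutive.
Qed.

(** A lift of a residue moved by the Frobenius. Its trace and norm are integral Witt vectors coming
    from [F], hence integral in [F], so the element is integral. Distinct residues of the two
    conjugates make the eigenprojectors below integral. *)
Lemma unramified_generator : exists th : E,
  [/\ integral_closure OF E th, wint L (phi0 th)
    & wred L (phi0 th) != wred L (phi0 (conjE th))].
Proof.
have [y Oy yy] := wfrob_moved; have [g gK Kg] := phi0_bij; exists (g y).
have Osy : wint L (wfrob L y) by apply: wfrob_int.
have yE : wfrob L y = phi0 (conjE (g y)) by rewrite -wfrob_phi0 Kg.
rewrite Kg -yE; split=> //; last by rewrite -subr_eq0 -(dvr_redB dvrL).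
have cth : conjE (g y) != g y.
  apply: contraNneq yy => cy; rewrite yE cy Kg subrr; exact/eqP/(dvr_red0 dvrL).
have [c [d [gen conjg g2]]] := conj_quadratic cth.
have phiZ (a : F) z : phi0 (a *: z) = wstr L a * phi0 z by rewrite -mulr_algl rmorphM phi0_F.
have dE : wstr L d = y + wfrob L y by rewrite yE conjg rmorphB phi0_F Kg addrC subrK.
have cE : wstr L c = - (y * wfrob L y).
  have := congr1 phi0 g2; rewrite rmorphM rmorphD phi0_F phiZ Kg dE => H.
  by rewrite -[wstr L c](addrK ((y + wfrob L y) * y)) -H; ring.
have subW := wint_subring L.
have Od : OF d by apply: (OF_of_wint (W := L)); rewrite dE; apply: (ringD subW).
have Oc : OF c.
  by apply: (OF_of_wint (W := L)); rewrite cE; apply/(ringN subW)/(ringM subW).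
pose f : {poly F} := 'X^2 - (d *: 'X + c%:P).
have szr : (size (d *: 'X + c%:P : {poly F})%R <= 2)%N.
  rewrite (leq_trans (size_polyD _ _)) // geq_max (leq_trans (size_scale_leq _ _)) ?size_polyX //=.
  by rewrite (leq_trans (size_polyC_leq1 _)).
exists f; split.
- rewrite monicE lead_coefDl ?lead_coefXn // size_polyN size_polyXn ltnS //.
- move=> i; rewrite coefB coefXn coefD coefZ coefX coefC.
  apply: (ringB subF); first exact: (ring_nat subF).
  apply: (ringD subF); first by apply: (ringM subF) => //; apply: (ring_nat subF).
  by case: ifP => // _; apply: (ring0 subF).
apply/rootP; rewrite rmorphB rmorphD /= map_polyXn map_polyZ map_polyX map_polyC /=.
by rewrite !hornerE expr2 g2 mulr_algl [d *: _ + _]addrC subrr.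
Qed.

End Unramified.

End Arithmetic.

(** * Fixed points of the squared Frobenius on Witt vectors *)

Section FixedPoints.
Variables (F : fieldType) (OF : set F) (pi : F) (Fq : finFieldType) (resF : F -> Fq).
Variables (Fq2 : finFieldType) (k : fieldType) (j2 : Fq -> Fq2) (jk : Fq -> k).
Variables (L : rel_witt OF pi resF j2) (Wk : rel_witt OF pi resF jk).
Hypotheses (OFpi : OF pi) (pi0 : pi != 0).
Variables (f : {rmorphism Fq2 -> k}) (chi : {rmorphism L -> Wk}).
Hypothesis Hchi : witt_map f chi.
Hypothesis cardFq2 : #|Fq2| = (#|Fq| ^ 2)%N.
Hypothesis wfrobL2 : forall y, wfrob L (wfrob L y) = y.
Let dvrW := witt_dvr Wk OFpi pi0.
Let dvrL := witt_dvr L OFpi pi0.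

Lemma finite_residue (a : k) : a ^+ #|Fq2| = a -> exists b, f b = a.
Proof.
move=> aq; have := congr1 (map_poly f) (finField_genPoly Fq2).
rewrite rmorphB /= map_polyXn map_polyX rmorph_prod /= => /(congr1 (fun g => g.[a])).
rewrite !hornerE horner_prod aq subrr => /esym/eqP; rewrite prodf_seq_eq0 => /hasP[b _].
by rewrite /= map_polyXsubC hornerXsubC subr_eq0 => /eqP ->; exists b.
Qed.

Lemma pival_chi x : pival (wint Wk) (wstr Wk pi) (chi x) = pival (wint L) (wstr L pi) x.
Proof.
have [->|x0] := eqVneq x 0; first by rewrite rmorph0 !pival0.
apply: (pival_eq dvrW); first by rewrite fmorph_eq0.
have cz z : wstr Wk pi ^ z = chi (wstr L pi ^ z) by rewrite fmorphXz (wmap_str Hchi).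
by have [a b] := pivalP dvrL x0; split; rewrite cz -fmorph_div; apply: (wmap_int Hchi).
Qed.

Lemma wint_chi x : wint Wk (chi x) <-> wint L x.
Proof.
have [->|x0] := eqVneq x 0.
  by rewrite rmorph0; split=> _; apply: (ring0 (wint_subring _)).
by rewrite (pival_ge0 dvrW) ?fmorph_eq0 // (pival_ge0 dvrL) // pival_chi.
Qed.

(** Successive approximation: the residue of a fixed element lies in [Fq2]; subtracting a lift from
    [L] and dividing by [pi] gives a fixed element again. The digits so obtained sum to an element
    of [L] by completeness. *)
Lemma fixed_wint x : wint Wk x -> wfrob Wk (wfrob Wk x) = x ->
  exists2 y, wint L y & chi y = x.
Proof.
move=> Ox fx; pose fixed z := wint Wk z /\ wfrob Wk (wfrob Wk z) = z.
have piW0 := dvr_pi_neq0 dvrW.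
have step z : exists yz : L * Wk, fixed z ->
    [/\ wint L yz.1, fixed yz.2 & z = chi yz.1 + wstr Wk pi * yz.2].
  have [[Oz fz]|nf] := pselect (fixed z); last by exists (0, 0).
  have [b bE] : exists b, f b = wred Wk z.
    apply: finite_residue; rewrite cardFq2 -mulnn exprM.
    by rewrite -!wfrob_red // ?fz //; apply: wfrob_int.
  have [y Oy yb] := res_surj (wred_residue L) b.
  have Ocy : wint Wk (chi y) by apply: (wmap_int Hchi).
  exists (y, (z - chi y) / wstr Wk pi) => _; split=> //=; last by rewrite mulrC divfK // addrC subrK.
  split.
    apply/(res_ker (wred_residue Wk)); first exact: (ringB (wint_subring _)).
    by rewrite (dvr_redB dvrW) // (wmap_red Hchi) // yb bE subrr.
  by rewrite !fmorph_div !rmorphB fz -!(wmap_frob Hchi) wfrobL2 !wfrob_str.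
have [g gP] := choice step.
pose xs := fix xs i := if i is i'.+1 then (g (xs i')).2 else x.
have xsP i : fixed (xs i) by elim: i => [//|i IH] /=; have [] := gP _ IH.
pose u i := \sum_(l < i) wstr L pi ^+ l * (g (xs l)).1.
have xE i : x = chi (u i) + wstr Wk pi ^+ i * xs i.
  elim: i => [|i IH]; first by rewrite /u big_ord0 rmorph0 add0r expr0 mul1r.
  rewrite IH /u big_ord_recr /= -/(u i) rmorphD rmorphM rmorphXn (wmap_str Hchi).
  have [_ _ E] := gP _ (xsP i); rewrite {1}E exprSr; ring.
have Og l : wint L (g (xs l)).1 by have [] := gP _ (xsP l).
have [sep comp] := wint_complete L; have subL := wint_subring L.
have piL0 := dvr_pi_neq0 dvrL.
have [||l Ol lu] := comp u.
- move=> i; apply: (ring_sum subL) => l _; apply: (ringM subL) => //.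
  by apply: (ringX subL); apply: (dvr_pi dvrL).
- move=> i; rewrite /u big_ord_recr /= addrAC subrr add0r mulrAC divff ?expf_neq0 // mul1r.
  exact: Og.
exists l => //; apply/eqP; rewrite -subr_eq0; apply/eqP.
have [sepW _] := wint_complete Wk; apply: sepW => i.
have -> : (chi l - x) / wstr Wk pi ^+ i = chi ((l - u i) / wstr L pi ^+ i) - xs i.
  rewrite {1}(xE i) fmorph_div rmorphB rmorphXn (wmap_str Hchi).
  by field; rewrite expf_neq0.
apply: (ringB (wint_subring _)); first exact: (wmap_int Hchi).
by have [] := xsP i.
Qed.

Lemma fixed_chi x : wfrob Wk (wfrob Wk x) = x -> exists y, chi y = x.
Proof.
move=> fx; have [N ON] := wint_frac x.
have [|y _ yE] := fixed_wint ON; first by rewrite !rmorphM !rmorphXn !wfrob_str fx.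
exists (y / wstr L pi ^+ N); rewrite fmorph_div rmorphXn (wmap_str Hchi) yE mulrC mulKf //.
by rewrite expf_neq0 // (dvr_pi_neq0 dvrW).
Qed.

End FixedPoints.

(** * Determinants, idempotents and block Gram matrices *)

Section MatrixLemmas.
Variable K : fieldType.

(** Sylvester's determinant identity, from two factorisations of one block matrix. *)
Lemma det_1_sub_mulC n m (A : 'M[K]_(n, m)) (B : 'M_(m, n)) :
  \det (1%:M - A *m B) = \det (1%:M - B *m A).
Proof.
have E : block_mx (1%:M - A *m B) A 0 1%:M *m block_mx 1%:M 0 B 1%:M =
    block_mx 1%:M 0 B 1%:M *m block_mx 1%:M A 0 (1%:M - B *m A).
  rewrite !mulmx_block !mulmx1 !mul1mx !mul0mx !mulmx0 !addr0 !add0r subrK.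
  by rewrite [_ + (_ - _)]addrC subrK.
have := congr1 determinant E.
by rewrite !det_mulmx det_ublock !det_lblock det_ublock !det1 !mulr1 !mul1r.
Qed.

Lemma idempotent_factor n r (P : 'M[K]_n) (C : 'M_(n, r)) (R : 'M_(r, n)) :
  P *m P = P -> C *m R = P -> row_full C -> row_free R -> R *m C = 1%:M.
Proof.
move=> PP PE /row_fullP[B BC] /row_freeP[D RD].
have : B *m (P *m P) *m D = B *m P *m D by rewrite PP.
rewrite -PE.
have -> : B *m (C *m R *m (C *m R)) *m D = (B *m C) *m (R *m C) *m (R *m D) by rewrite !mulmxA.
have -> : B *m (C *m R) *m D = (B *m C) *m (R *m D) by rewrite !mulmxA.
by rewrite BC RD !mul1mx mulmx1.
Qed.

Lemma idempotent_base n (P : 'M[K]_n) : P *m P = P -> row_base P *m col_base P = 1%:M.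
Proof.
by move=> PP; apply: idempotent_factor (mulmx_base P) (col_base_full P) (row_base_free P).
Qed.

(** With a rank factorisation [P = C R], [R C = 1], Sylvester's identity replaces [P] by the
    identity of size [\rank P]. *)
Lemma det_1_sub_2idempotent n (P : 'M[K]_n) : P *m P = P ->
  \det (1%:M - 2%:R *: P) = (-1) ^+ \rank P.
Proof.
move=> PP; have -> : 2%:R *: P = (2%:R *: col_base P) *m row_base P.
  by rewrite -scalemxAl mulmx_base.
rewrite det_1_sub_mulC -scalemxAr idempotent_base // -det_scalar; congr (\det _).
by apply/matrixP => i j; rewrite !mxE; case: eqP => _ /=; ring.
Qed.

Lemma char_poly_horner n (A : 'M[K]_n) x : (char_poly A).[x] = \det (x%:M - A).
Proof.
rewrite /char_poly -horner_evalE -det_map_mx; congr (\det _).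
apply/matrixP => i j; rewrite !mxE; case: (i == j); rewrite ?mulr1n ?mulr0n /=.
  by rewrite /horner_eval hornerXsubC.
by rewrite !sub0r /horner_eval hornerN hornerC.
Qed.

Lemma mulmx_ext m n (A B : 'M[K]_(m, n)) : (forall v : 'rV_m, v *m A = v *m B) -> A = B.
Proof. by move=> AB; apply/row_matrixP => i; rewrite !rowE. Qed.

Lemma rank_basis m n d (A : 'M[K]_(m, d)) : \rank A = n ->
  exists f : 'M_(n, d), row_free f /\ (f :=: A)%MS.
Proof.
by move=> <-; exists (row_base A); split; [apply: row_base_free|apply: eq_row_base].
Qed.

(** For two isotropic halves the Gram matrix is block antidiagonal. The sign [s] is the determinant
    of the swap of the halves; only [s * s = 1] matters for valuations. *)
Lemma split_gram n N (O : set K) (subO : is_subring O) (f0 f1 : 'M[K]_(n, N)) (G : 'M_N) :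
  (n + n = N)%N -> f0 *m G *m f0^T = 0 -> f1 *m G *m f1^T = 0 ->
  exists f : 'M_N, [/\ forall v, int_comb O f v <->
      exists c d : 'rV_n, [/\ intmx O c, intmx O d & v = c *m f0 + d *m f1]
    & exists2 s, s * s = 1 &
      \det f * \det G * \det f = s * (\det (f0 *m G *m f1^T) * \det (f1 *m G *m f0^T))].
Proof.
move=> nN; case: _ / nN in f0 f1 G * => G0 G1.
exists (col_mx f0 f1); split=> [v|].
  split=> [[w Iw ->]|[c [d [Ic Id ->]]]].
    exists (lsubmx w), (rsubmx w); split; last by rewrite -mul_row_col hsubmxK.
      by move=> i j; rewrite !mxE ord1.
    by move=> i j; rewrite !mxE ord1.
  exists (row_mx c d); last by rewrite mul_row_col.
  by move=> i; rewrite mxE; case: splitP => l _; rewrite ?Ic ?Id.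
pose J : 'M[K]_(n + n) := block_mx 0 1%:M 1%:M 0.
have JJ : J *m J = 1%:M.
  by rewrite /J mulmx_block !mulmx0 !mul0mx !mulmx1 !addr0 !add0r -scalar_mx_block.
exists (\det J); first by rewrite -det_mulmx JJ det1.
set B := f0 *m G *m f1^T; set C := f1 *m G *m f0^T.
have E : col_mx f0 f1 *m G *m (col_mx f0 f1)^T = block_mx B 0 0 C *m J.
  rewrite tr_col_mx mul_col_mx mul_col_row G0 G1 /J mulmx_block.
  by rewrite !mulmx0 !mul0mx !mulmx1 !addr0 !add0r.
have := congr1 determinant E; rewrite !det_mulmx det_tr det_ublock => ->.
by rewrite mulrC.
Qed.

End MatrixLemmas.

(** * Intersections of lattices with subspaces *)

Section Sublattice.
Variables (K : fieldType) (O : set K) (pi : K) (k : fieldType) (r : K -> k).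
Hypothesis dvr : is_dvr O pi r.
Let subO := dvr_subring dvr.
Let pi0 := dvr_pi_neq0 dvr.
Let Opi := dvr_pi dvr.

Lemma mx_frac m n (A : 'M[K]_(m, n)) : exists N, intmx O (pi ^+ N *: A).
Proof.
have H (ij : 'I_m * 'I_n) : exists N, O (pi ^+ N * A ij.1 ij.2) by apply: (dvr_frac dvr).
have [N HN] := choice H; exists (\sum_ij N ij)%N => i j; rewrite mxE.
rewrite (bigD1 (i, j)) //= addnC exprD -mulrA; apply: (ringM subO).
  exact: (ringX subO).
exact: (HN (i, j)).
Qed.

(** In the basis [f] of the subspace, the intersection with [M] lies between two multiples of the
    standard lattice by powers of [pi], hence is a lattice itself. *)
Lemma sublattice_basis d n (M : set 'rV[K]_d) a (f : 'M[K]_(n, d)) :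
  isvol O pi M a -> row_free f ->
  exists2 g : 'M_n, g \in unitmx & forall c : 'rV_n, M (c *m (g *m f)) <-> intmx O c.
Proof.
move=> [e [eu ME _]] /row_freeP[B fB].
pose S : set 'rV[K]_n := [set c | M (c *m f)].
have memM v : M v <-> intmx O (v *m invmx e) by rewrite ME; apply: mem_lat.
have sM : submodule O M by rewrite ME; apply: submodule_int_comb.
have [M0 MD MZ] := sM.
have sS : submodule O S.
  split=> [|u v Su Sv|b v Ob Sv]; rewrite /S /=.
  - by rewrite mul0mx.
  - by rewrite mulmxDl; apply: MD.
  - by rewrite -scalemxAl; apply: MZ.
have [N1 I1] := mx_frac (f *m invmx e); have [N2 I2] := mx_frac (e *m B).
have u1 N : (pi ^+ N)%:M \in @unitmx K n.
  by rewrite unitmxE det_scalar unitfE !expf_neq0.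
pose p1 : 'M[K]_n := (pi ^+ N1)%:M; pose p2 : 'M[K]_n := invmx (pi ^+ N2)%:M.
have v1 : isvol O pi (int_comb O p1) (pival O pi (\det p1)) by exists p1; rewrite u1.
have v2 : isvol O pi (int_comb O p2) (pival O pi (\det p2)).
  by exists p2; rewrite unitmx_inv u1.
have [||s [g [gu SE _]] _] := submodule_between_vol dvr v1 v2 sS.
- move=> _ [c Ic ->]; rewrite /S /=; apply/memM.
  rewrite mul_mx_scalar -!scalemxAl -mulmxA scalemxAr; apply: (intmx_mul subO) => // i j.
  by rewrite ord1.
- move=> c Sc; apply/mem_lat; rewrite ?unitmx_inv // invmxK mul_mx_scalar.
  move/memM: Sc => Ic; have -> : pi ^+ N2 *: c = c *m f *m invmx e *m (pi ^+ N2 *: (e *m B)).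
    by rewrite -scalemxAr mulmxA mulmxKV // -mulmxA fB mulmx1.
  exact: (intmx_mul subO).
exists g => // c; rewrite mulmxA -[M _]/(S (c *m g)) SE mem_lat // mulmxK //.
Qed.

End Sublattice.

(** * The parity of the hermitian space *)

Section IsocrystalBasis.
Variables (F : fieldType) (OF : set F) (pi : F) (Fq : finFieldType) (resF : F -> Fq).
Hypotheses (OFpi : OF pi) (pi0 : pi != 0).
Variables (E : fieldExtType F) (conjE : {rmorphism E -> E}) (n : nat).
Variables (R : fieldType) (j : Fq -> R) (L : rel_witt OF pi resF j).
Variable phi0 : {rmorphism E -> L}.
Hypothesis phi0_F : forall a : F, phi0 a%:A = wstr L a.
Hypothesis wfrob_phi0 : forall x, wfrob L (phi0 x) = phi0 (conjE x).
Hypothesis wfrob2 : forall x, wfrob L (wfrob L x) = x.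
Hypothesis two_neq0 : 2%:R != 0 :> R.
Variables (OE : set E) (th : E) (c d : F).
Hypotheses (OEth : OE th) (Oth : wint L (phi0 th))
  (redth : wred L (phi0 th) != wred L (phi0 (conjE th))).
Hypotheses (gen_th : forall x, exists a b : F, x = a%:A + b *: th)
  (conj_th : conjE th = d%:A - th) (th2 : th * th = c%:A + d *: th).
Variables (D : isocrystal E n L).
Hypothesis HD : is_isocrystal conjE D.
Let dvrL := witt_dvr L OFpi pi0.
Let subL := wint_subring L.
Local Notation piL := (wstr L pi).
Let piL0 : piL != 0 := dvr_pi_neq0 dvrL.
Local Notation s := (map_mx (wfrob L)).
Local Notation Fm := (frob_mx D).
Local Notation Vm := (ver_mx D).
Local Notation G := (gram D).
Local Notation T := (act D th).
Let y := phi0 th.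
Let y' := phi0 (conjE th).

(** Over [L] the Frobenius has order two, so it is its own inverse and the Verschiebung is
    semilinear for the same map. *)
Let sV m1 m2 (A : 'M[L]_(m1, m2)) : map_mx (wfrobV L) A = s A.
Proof. by apply/matrixP => a b; rewrite !mxE -{1}[A a b]wfrob2 wfrobK. Qed.

Let ss m1 m2 (A : 'M[L]_(m1, m2)) : s (s A) = A.
Proof. by apply/matrixP => a b; rewrite !mxE wfrob2. Qed.

Lemma iso_FV : s Vm *m Fm = piL%:M.
Proof.
apply: mulmx_ext => v; have := frob_ver HD v.
by rewrite /frob /ver /semilin sV map_mxM ss mulmxA mul_mx_scalar.
Qed.

Lemma iso_actF x : s (act D x) *m Fm = Fm *m act D x.
Proof.
apply: mulmx_ext => v; have := act_frob HD x (s v).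
by rewrite /frob /semilin map_mxM ss -!mulmxA.
Qed.

Lemma iso_actV x : s (act D x) *m Vm = Vm *m act D x.
Proof.
apply: mulmx_ext => v; have := act_ver HD x (s v).
by rewrite /ver /semilin !sV map_mxM ss -!mulmxA.
Qed.

Lemma frob_unit : Fm \in unitmx.
Proof.
have : s Vm *m Fm \in unitmx.
  by rewrite iso_FV unitmxE det_scalar unitfE expf_neq0.
by rewrite unitmx_mul => /andP[].
Qed.

Lemma dth : wstr L d = y + y'.
Proof. by rewrite /y' conj_th rmorphB phi0_F addrC subrK. Qed.

Lemma cth : wstr L c = - (y * y').
Proof.
have := congr1 phi0 th2; rewrite -[d *: th]mulr_algl rmorphM rmorphD rmorphM !phi0_F -/y dth => H.
by rewrite -[wstr L c](addrK ((y + y') * y)) -H; ring.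
Qed.

Let yy : y - y' != 0.
Proof. by apply: contraNneq redth => /eqP; rewrite subr_eq0 => /eqP; rewrite /y /y' => ->. Qed.

Let yy' : y' - y != 0. Proof. by rewrite -oppr_eq0 opprB. Qed.

Let Oy : wint L y := Oth.
Let Oy' : wint L y'. Proof. by rewrite /y' -wfrob_phi0; apply: wfrob_int. Qed.

Let yyV : wint L (y - y')^-1.
Proof.
apply: (dvr_unit dvrL); first exact: (ringB subL).
by rewrite (dvr_redB dvrL) // subr_eq0.
Qed.

Let sy : wfrob L y = y'. Proof. exact: wfrob_phi0. Qed.
Let sy' : wfrob L y' = y. Proof. by rewrite -sy wfrob2. Qed.

(** The projectors onto the two eigenspaces of [E]; they preserve the lattice [M] because [y - y']
    is a unit. *)
Definition eig0 := (y - y')^-1 *: (T - y'%:M).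
Definition eig1 := (y' - y)^-1 *: (T - y%:M).

Lemma act_quadratic : T *m T = (wstr L c)%:M + wstr L d *: T.
Proof.
have -> : T *m T = act D (th * th) by rewrite rmorphM.
by rewrite th2 -[d *: th]mulr_algl rmorphD rmorphM !(act_F HD) -[_ * T]/(_ *m T) mul_scalar_mx.
Qed.

Lemma act_factor : (T - y%:M) *m (T - y'%:M) = 0.
Proof.
rewrite mulmxBl !mulmxBr act_quadratic cth dth -scalar_mxM mul_mx_scalar mul_scalar_mx.
by rewrite scalerDl raddfN /=; apply/matrixP => a b; rewrite !mxE; ring.
Qed.

Lemma act_factorC : (T - y'%:M) *m (T - y%:M) = 0.
Proof.
rewrite -act_factor !mulmxBl !mulmxBr -!scalar_mxM !mul_mx_scalar !mul_scalar_mx.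
by rewrite [y * y']mulrC; apply/matrixP => a b; rewrite !mxE; ring.
Qed.

Lemma eig_sum : eig0 + eig1 = 1%:M.
Proof.
rewrite /eig0 /eig1 -[(y' - y)^-1]opprK -invrN opprB scaleNr -scalerBr.
have -> : T - y'%:M - (T - y%:M) = (y - y')%:M.
  by rewrite raddfB /=; apply/matrixP => a b; rewrite !mxE; ring.
by rewrite scale_scalar_mx mulVf.
Qed.

Lemma eig01 : eig0 *m eig1 = 0.
Proof. by rewrite /eig0 /eig1 -scalemxAl -scalemxAr act_factorC !scaler0. Qed.

Lemma eig10 : eig1 *m eig0 = 0.
Proof. by rewrite /eig0 /eig1 -scalemxAl -scalemxAr act_factor !scaler0. Qed.

Lemma eig00 : eig0 *m eig0 = eig0.
Proof. by rewrite -[RHS]mulmx1 -eig_sum mulmxDr eig01 addr0. Qed.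

Lemma eig11 : eig1 *m eig1 = eig1.
Proof. by rewrite -[RHS]mulmx1 -eig_sum mulmxDr eig10 add0r. Qed.

Lemma eig0P m (v : 'M[L]_(m, n.*2)) : v *m eig0 = v <-> v *m T = y *: v.
Proof.
split=> [<-|vT].
  rewrite -mulmxA; have : eig0 *m (T - y%:M) = 0.
    by rewrite /eig0 -scalemxAl act_factorC scaler0.
  rewrite mulmxBr mul_mx_scalar => /eqP; rewrite subr_eq0 => /eqP ->.
  by rewrite scalemxAr.
by rewrite /eig0 -scalemxAr mulmxBr vT mul_mx_scalar -scalerBl scalerA mulVf // scale1r.
Qed.

Lemma eig1P m (v : 'M[L]_(m, n.*2)) : v *m eig1 = v <-> v *m T = y' *: v.
Proof.
split=> [<-|vT].
  rewrite -mulmxA; have : eig1 *m (T - y'%:M) = 0.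
    by rewrite /eig1 -scalemxAl act_factor scaler0.
  rewrite mulmxBr mul_mx_scalar => /eqP; rewrite subr_eq0 => /eqP ->.
  by rewrite scalemxAr.
by rewrite /eig1 -scalemxAr mulmxBr vT mul_mx_scalar -scalerBl scalerA mulVf // scale1r.
Qed.

Lemma eig_actE m (v : 'M[L]_(m, n.*2)) x : v *m T = y *: v -> v *m act D x = phi0 x *: v.
Proof.
move=> vT; have [a [b ->]] := gen_th x; rewrite -[b *: th]mulr_algl.
rewrite !rmorphD !rmorphM !(act_F HD) !phi0_F mulmxDr -[_ * T]/(_ *m T) mul_scalar_mx.
by rewrite -scalemxAr vT mul_mx_scalar scalerA -scalerDl.
Qed.

Lemma s_eig0 : s eig0 *m Fm = Fm *m eig1.
Proof.
rewrite /eig0 /eig1 map_mxZ map_mxB map_scalar_mx fmorphV rmorphB sy sy' -scalemxAl -scalemxAr.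
by rewrite mulmxBl mulmxBr iso_actF mul_mx_scalar mul_scalar_mx.
Qed.

Lemma s_eig1V : s eig1 *m Vm = Vm *m eig0.
Proof.
rewrite /eig0 /eig1 map_mxZ map_mxB map_scalar_mx fmorphV rmorphB sy sy' -scalemxAl -scalemxAr.
by rewrite mulmxBl mulmxBr iso_actV mul_mx_scalar mul_scalar_mx.
Qed.

(** The Frobenius is bijective and exchanges the eigenspaces, so they have the same dimension. *)
Lemma eig_rank : \rank eig0 = n /\ \rank eig1 = n.
Proof.
have r01 : \rank eig0 = \rank eig1.
  rewrite -(mxrank_map (wfrob L) eig0) -(mxrankMfree (s eig0) (_ : row_free Fm)).
    rewrite s_eig0 -mxrank_tr trmx_mul mxrankMfree ?mxrank_tr //.
    by rewrite row_free_unit unitmx_tr frob_unit.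
  by rewrite row_free_unit frob_unit.
have le := mulmx0_rank_max eig01.
have ge : (n.*2 <= \rank eig0 + \rank eig1)%N.
  by rewrite -{1}(mxrank1 L n.*2) -eig_sum mxrank_add.
by split; lia.
Qed.

Lemma bilin_delta (A : 'M[L]_(n.*2)) i l : bilin A (delta_mx 0 i) (delta_mx 0 l) = A i l.
Proof. by rewrite /bilin -rowE trmx_delta -colE !mxE. Qed.

Lemma gram_tr : G^T = - G.
Proof.
apply/matrixP => i l; rewrite !mxE -!bilin_delta.
set v := delta_mx 0 i; set w := delta_mx 0 l.
have := pairing_alt HD (v + w); rewrite /pairing /bilin linearD /= mulmxDr !mulmxDl.
do !rewrite [(_ + _ : 'M_1) 0 0]mxE.
have v0 : bilin G v v = 0 := pairing_alt HD v; have w0 : bilin G w w = 0 := pairing_alt HD w.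
rewrite -!/(bilin G _ _) v0 w0 add0r addr0 => /eqP.
by rewrite addr_eq0 => /eqP ->; rewrite ?opprK.
Qed.

Lemma gram_act x : act D x *m G = G *m (act D (conjE x))^T.
Proof.
apply/matrixP => i l; rewrite -!bilin_delta.
have := pairing_act HD x (delta_mx 0 i) (delta_mx 0 l).
by rewrite /pairing /bilin trmx_mul !mulmxA.
Qed.

Lemma frob_gram : Fm *m G = s (G *m Vm^T).
Proof.
apply/matrixP => i l; rewrite -!bilin_delta.
have := pairing_frob HD (s (delta_mx 0 i)) (delta_mx 0 l).
rewrite /pairing /frob /ver /semilin sV ss /bilin trmx_mul -!mulmxA => fgE; apply: etrans fgE _.
set X := _ *m (_ *m _); have -> : wfrob L (X 0 0) = s X 0 0 by rewrite [RHS]mxE.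
by rewrite /X !map_mxM !map_trmx !ss !mulmxA.
Qed.

Lemma act_conj : act D (conjE th) = (wstr L d)%:M - T.
Proof. by rewrite conj_th rmorphB (act_F HD). Qed.

(** The adjoint of [T] is its conjugate, so moving [T] across the pairing replaces [y] by [y']; the
    eigenspaces are isotropic. *)
Lemma gram_eig0 m1 m2 (v : 'M[L]_(m1, n.*2)) (w : 'M_(m2, n.*2)) :
  v *m T = y *: v -> w *m T = y *: w -> v *m G *m w^T = 0.
Proof.
move=> vT wT; have wT' : w *m act D (conjE th) = y' *: w.
  rewrite act_conj mulmxBr wT mul_mx_scalar -scalerBl dth; congr (_ *: _); ring.
have : y *: (v *m G *m w^T) = y' *: (v *m G *m w^T).
  rewrite !scalemxAl -vT -[v *m T *m G]mulmxA gram_act -!scalemxAl.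
  by rewrite -!mulmxA -trmx_mul wT' linearZ /= -!scalemxAr.
move/eqP; rewrite -subr_eq0 -scalerBl scaler_eq0 (negPf yy) => /eqP //.
Qed.

Lemma gram_eig1 m1 m2 (v : 'M[L]_(m1, n.*2)) (w : 'M_(m2, n.*2)) :
  v *m T = y' *: v -> w *m T = y' *: w -> v *m G *m w^T = 0.
Proof.
move=> vT wT; have wT' : w *m act D (conjE th) = y *: w.
  rewrite act_conj mulmxBr wT mul_mx_scalar -scalerBl dth; congr (_ *: _); ring.
have : y *: (v *m G *m w^T) = y' *: (v *m G *m w^T).
  rewrite !scalemxAl -vT -[v *m T *m G]mulmxA gram_act -!scalemxAl.
  by rewrite -!mulmxA -trmx_mul wT' linearZ /= -!scalemxAr.
move/eqP; rewrite -subr_eq0 -scalerBl scaler_eq0 (negPf yy) => /eqP //.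
Qed.

Variables (h : nat) (M : set 'rV[L]_(n.*2)).
Hypothesis frM : framing_object conjE D OE phi0 h M.

Lemma framing_vol : exists a, isvol (wint L) piL M a.
Proof. exact: lattice_isvol (fr_lattice frM). Qed.

Let sM : submodule (wint L) M.
Proof. by have [a /(isvol_submodule dvrL)] := framing_vol. Qed.

Lemma framing_split : exists f0 f1 : 'M[L]_(n, n.*2),
  [/\ [/\ row_free f0, row_free f1, (f0 :=: eig0)%MS & (f1 :=: eig1)%MS],
      f0 *m T = y *: f0 /\ f1 *m T = y' *: f1,
      forall v : 'rV_n, M (v *m f0) <-> intmx (wint L) v,
      forall v : 'rV_n, M (v *m f1) <-> intmx (wint L) v
    & forall v, M v -> exists a b : 'rV_n,
        [/\ intmx (wint L) a, intmx (wint L) b & v = a *m f0 + b *m f1]].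
Proof.
have [r0 r1] := eig_rank; have [a vM] := framing_vol.
have basis (P : 'M[L]_(n.*2)) : \rank P = n -> exists f : 'M[L]_(n, n.*2),
    [/\ row_free f, (f :=: P)%MS & forall v : 'rV_n, M (v *m f) <-> intmx (wint L) v].
  move=> /rank_basis[f [ff fP]]; have [g gu gM] := sublattice_basis dvrL vM ff.
  exists (g *m f); split=> //; first by rewrite /row_free mxrankMfree // mxrank_unit.
  by apply: eqmx_trans fP; apply: eqmxMfull; rewrite row_full_unit.
have [f0 [ff0 e0 M0]] := basis _ r0; have [f1 [ff1 e1 M1]] := basis _ r1.
have [M00 MD MZ] := sM.
have Mth v : M v -> M (v *m T) by apply: (fr_act frM).
exists f0, f1; split=> // [|v Mv].
  split; [apply/eig0P|apply/eig1P].
    have : (f0 <= eig0)%MS by rewrite e0.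
    by case/submxP => X ->; rewrite -mulmxA eig00.
  have : (f1 <= eig1)%MS by rewrite e1.
  by case/submxP => X ->; rewrite -mulmxA eig11.
have MB := submoduleB subL sM.
have MP0 : M (v *m eig0).
  rewrite /eig0 -scalemxAr mulmxBr mul_mx_scalar; apply: (MZ) => //.
  by apply: (MB); [apply: (Mth)|apply: (MZ)].
have vE : v = v *m eig0 + v *m eig1 by rewrite -mulmxDr eig_sum mulmx1.
have MP1 : M (v *m eig1).
  have -> : v *m eig1 = v - v *m eig0 by rewrite {2}vE addrC addKr.
  exact: MB.
have /submxP[a0 a0E] : (v *m eig0 <= f0)%MS by rewrite e0 submxMl.
have /submxP[b0 b0E] : (v *m eig1 <= f1)%MS by rewrite e1 submxMl.
exists a0, b0; split; last by rewrite -a0E -b0E.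
  by apply/M0; rewrite -a0E.
by apply/M1; rewrite -b0E.
Qed.

Section Parity.
Hypothesis n_gt0 : (0 < n)%N.
Variables (f0 f1 : 'M[L]_(n, n.*2)).
Hypotheses (ff0 : row_free f0) (ff1 : row_free f1).
Hypotheses (e0 : (f0 :=: eig0)%MS) (e1 : (f1 :=: eig1)%MS).
Hypotheses (f0T : f0 *m T = y *: f0) (f1T : f1 *m T = y' *: f1).
Hypothesis M0 : forall v : 'rV_n, M (v *m f0) <-> intmx (wint L) v.
Hypothesis M1 : forall v : 'rV_n, M (v *m f1) <-> intmx (wint L) v.
Hypothesis M01 : forall v, M v -> exists a b : 'rV_n,
  [/\ intmx (wint L) a, intmx (wint L) b & v = a *m f0 + b *m f1].
Local Notation vL := (pival (wint L) piL).
Let Gp := f0 *m G *m f1^T.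

(** [M] has colength [2 h] in its dual, which is the valuation of the determinant of the pairing in
    a basis of [M]; the latter is twice that of [Gp], since the other off-diagonal block is
    [- Gp^T]. *)
Lemma framing_gram : Gp \in unitmx /\ vL (\det Gp) = h%:Z.
Proof.
have [a vM] := framing_vol; have [M00 MD MZ] := sM.
have nn : (n + n = n.*2)%N by rewrite addnn.
have [f [fE [sg sg1 dE]]] := split_gram subL nn (gram_eig0 f0T f0T) (gram_eig1 f1T f1T).
have MfE : M = int_comb (wint L) f.
  apply/seteqP; split=> v.
    by move=> /M01[a0 [b0 [Ia Ib ->]]]; apply/fE; exists a0, b0.
  by move=> /fE[a0 [b0 [Ia Ib ->]]]; apply: MD; [apply/M0|apply/M1].
have fu : f \in unitmx.
  have [e [eu ME _]] := vM; have : (e <= f)%MS.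
    apply/row_subP => i; have : M (row i e) by rewrite ME; apply: int_comb_row.
    by rewrite MfE => -[w _ ->]; apply: submxMl.
  by move=> /submxP[w wE]; move: eu; rewrite wE unitmx_mul => /andP[].
have vMf : isvol (wint L) piL M (vL (\det f)) by exists f.
have Gu := pairing_nondeg HD.
have dualE : dual (wint L) (pairing D) setT M = sdual (wint L) (idfun : {rmorphism L -> L}) G M.
  apply/seteqP; split=> [v [_ Hv] w Mw|v Hv]; last split=> // w Mw.
    by have := Hv w Mw; rewrite /pairing /bilin /beta /conj_tr map_mx_id.
  by have := Hv w Mw; rewrite /pairing /bilin /beta /conj_tr map_mx_id.
have vD := isvol_sdual dvrL (sigma := idfun) (fun x Ox => Ox) erefl Gu vMf.
have := colength_vol dvrL vMf (fr_order frM); rewrite dualE => /(isvol_uniq dvrL vD) eqv.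
have nz A : A \in unitmx -> \det A != 0 := @det_neq0 L (n.*2) A.
have f10 : f1 *m G *m f0^T = - Gp^T by rewrite /Gp !trmx_mul trmxK gram_tr mulNmx mulmxN mulmxA opprK.
have sg0 : sg != 0 by apply: contra_eq_neq sg1 => ->; rewrite mul0r eq_sym oner_eq0.
have lhs0 : \det f * \det G * \det f != 0 by rewrite !mulf_neq0 ?nz.
have detGp0 : \det Gp != 0 by apply: contraNneq lhs0; rewrite dE -/Gp => ->; rewrite mul0r mulr0.
have vsg : vL sg = 0.
  have := pivalM dvrL sg0 sg0; rewrite sg1 (pival1 dvrL).
  by move: (vL sg); clear => v; lia.
split; first by rewrite unitmxE unitfE.
have := congr1 vL dE; rewrite -/Gp f10 -scaleN1r detZ det_tr.
rewrite !(pivalM dvrL) ?mulf_neq0 ?expf_neq0 ?oppr_eq0 ?oner_neq0 ?nz //.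
rewrite (pivalX dvrL) ?oppr_eq0 ?oner_neq0 // (pivalN dvrL) (pival1 dvrL) vsg.
move: eqv; rewrite mul0rn; move: (vL _) (vL _) (vL _); clear => v1 v2 v3.
by lia.
Qed.

Let verE v : ver D v = s v *m Vm. Proof. by rewrite /ver /semilin sV. Qed.

Let M0r i : M (row i f0).
Proof. by rewrite rowE; apply/M0; apply: (intmx_delta subL). Qed.

Let M1r i : M (row i f1).
Proof. by rewrite rowE; apply/M1; apply: (intmx_delta subL). Qed.

Lemma frob_f0 : exists2 X : 'M[L]_n, intmx (wint L) X & s f0 *m Fm = X *m f1.
Proof.
have : (s f0 *m Fm <= f1)%MS.
  rewrite e1; have <- : s f0 *m Fm *m eig1 = s f0 *m Fm; last exact: submxMl.
  by rewrite -mulmxA -s_eig0 mulmxA -map_mxM (proj2 (eig0P f0) f0T).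
case/submxP => X XE; exists X => //; apply: (intmx_row (O := wint L)) => i.
by apply/M1; rewrite -row_mul -XE row_mul -map_row; apply: (fr_frob frM).
Qed.

Lemma ver_f1 : exists2 Y : 'M[L]_n, intmx (wint L) Y & s f1 *m Vm = Y *m f0.
Proof.
have : (s f1 *m Vm <= f0)%MS.
  rewrite e0; have <- : s f1 *m Vm *m eig0 = s f1 *m Vm; last exact: submxMl.
  by rewrite -mulmxA -s_eig1V mulmxA -map_mxM (proj2 (eig1P f1) f1T).
case/submxP => Y YE; exists Y => //; apply: (intmx_row (O := wint L)) => i.
by apply/M0; rewrite -row_mul -YE row_mul -map_row -verE; apply: (fr_ver frM).
Qed.

Variables (X Y : 'M[L]_n).
Hypotheses (IX : intmx (wint L) X) (IY : intmx (wint L) Y).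
Hypotheses (XE : s f0 *m Fm = X *m f1) (YE : s f1 *m Vm = Y *m f0).

Lemma frob_ver_mx : s Y *m X = piL%:M.
Proof.
apply: (row_free_inj ff1); rewrite /= -mulmxA -XE mulmxA -map_mxM -YE map_mxM ss.
by rewrite -mulmxA iso_FV mul_mx_scalar mul_scalar_mx.
Qed.

Lemma ver_mx_unit : Y \in unitmx /\ X \in unitmx.
Proof.
have : s Y *m X \in unitmx by rewrite frob_ver_mx unitmxE det_scalar unitfE expf_neq0.
by rewrite unitmx_mul map_unitmx => /andP[].
Qed.

Lemma frob_ver_vol : vL (\det Y) + vL (\det X) = n%:Z.
Proof.
have [Yu Xu] := ver_mx_unit; have := congr1 (fun A => vL (\det A)) frob_ver_mx.
rewrite det_mulmx det_map_mx det_scalar (pivalM dvrL) ?fmorph_eq0 ?det_neq0 //.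
rewrite (pival_sigma dvrL (@wfrob_int _ _ _ _ _ _ _ L) (wfrob_str L pi)).
rewrite (pivalX dvrL) // (pival_pi dvrL) => ->.
by rewrite natz.
Qed.

Let VM := [set ver D v | v in M].

Lemma submodule_ver : submodule (wint L) VM.
Proof.
have [M00 MD MZ] := sM; split=> [|_ _ [u Mu <-] [v Mv <-]|a _ Oa [v Mv <-]].
- by exists 0; rewrite // verE map_mx0 mul0mx.
- by exists (u + v); [apply: MD|rewrite !verE map_mxD mulmxDl].
- exists (wfrob L a *: v); first by apply: MZ => //; apply: wfrob_int.
  by rewrite !verE map_mxZ /= wfrob2 -scalemxAl.
Qed.

Lemma ver_pi v : M v -> VM (piL *: v).
Proof. by move=> Mv; exists (frob D v); [apply: (fr_frob frM)|apply: (ver_frob HD)]. Qed.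

Lemma ver_th v : VM v -> VM (v *m T).
Proof.
by move=> [u Mu <-]; exists (u *m T); [apply: (fr_act frM)|apply: (act_ver HD)].
Qed.

(* The coordinates on [Lie = M / ver M] given by [fr_lie]. *)
Lemma lie_coord : exists (kap : 'rV[L]_(n.*2) -> 'rV[R]_n) (Gb : 'M[R]_n),
  [/\ quot_coord (wint L) (wred L) VM M kap,
      forall v, M v -> kap (v *m T) = kap v *m Gb
    & char_poly Gb = ('X - (wred L y)%:P) * ('X - (wred L y')%:P) ^+ n.-1].
Proof.
have [e [Me gen_e free_e chare]] := fr_lie frM.
have [Gm [IG eG charG]] := chare th OEth.
have sVM := submodule_ver; have [V0 VD VZ] := sVM; have [M00 MD MZ] := sM.
have ex v : exists cc : 'rV[L]_n, M v -> intmx (wint L) cc /\ VM (v - cc *m e).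
  have [Mv|nMv] := pselect (M v); last by exists 0.
  by have [cc Ic Vc] := gen_e v Mv; exists cc => _; split=> // a b; rewrite ord1.
have [cc ccP] := choice ex; pose kap v := map_mx (wred L) (cc v).
(* All integral coordinates of [v] modulo [VM] have the same reduction, so [kap] does not depend on
   the choice of [cc]; its properties follow by exhibiting suitable coordinates. *)
have kapE v (b : 'rV_n) : M v -> intmx (wint L) b -> VM (v - b *m e) -> kap v = map_mx (wred L) b.
  move=> Mv Ib Vb; have [Ic Vc] := ccP v Mv.
  apply/eqP; rewrite -subr_eq0 -(map_red_sub dvrL) //; apply/eqP/rowP => i.
  rewrite mxE [RHS]mxE; apply: free_e => [l|].
    by have := intmx_sub subL Ic Ib; apply.
  have -> : (cc v - b) *m e = (v - b *m e) - (v - cc v *m e).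
    by rewrite mulmxBl opprB [RHS]addrC addrA subrK.
  exact: (submoduleB subL sVM).
exists kap, (map_mx (wred L) Gm); split=> //; first split.
- move=> u v Mu Mv; have [Iu Vu] := ccP u Mu; have [Iv Vv] := ccP v Mv.
  rewrite -(map_red_add dvrL) //; apply: (kapE); [exact: (MD)|exact: (intmx_add subL)|].
  by rewrite mulmxDl opprD addrACA; apply: (VD).
- move=> a v Oa Mv; have [Iv Vv] := ccP v Mv.
  rewrite -(map_red_scale dvrL) //; apply: (kapE); [exact: (MZ)|exact: (intmx_scale subL)|].
  by rewrite -scalemxAl -scalerBr; apply: VZ.
- move=> z; have [b Ib bE] := red_lift dvrL z.
  have Mb : M (b *m e) by apply: (int_comb_sub sM Me); exists b.
  exists (b *m e) => //; rewrite (kapE _ b) //.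
  by rewrite subrr.
- move=> v Mv; have [Iv Vv] := ccP v Mv; split=> [k0|Vv0].
    have [b Ib bE] := red_eq0 dvrL Iv k0; rewrite -[v](subrK (cc v *m e)); apply: (VD) => //.
    rewrite bE -scalemxAl; apply: ver_pi; apply: (int_comb_sub sM Me).
    by exists b.
  rewrite (kapE _ 0) //; first by apply/rowP => i; rewrite !mxE (dvr_red0 dvrL).
    by move=> a b; rewrite mxE; apply: (ring0 subL).
  by rewrite mul0mx subr0.
move=> v Mv; have [Iv Vv] := ccP v Mv.
rewrite -(map_red_mul dvrL) //; apply: (kapE); first exact: (fr_act frM).
  exact: (intmx_mul subL).
have -> : v *m T - cc v *m Gm *m e = (v - cc v *m e) *m T + cc v *m (e *m T - Gm *m e).
  by rewrite mulmxBl mulmxBr !mulmxA addrA subrK.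
apply: VD; first exact: ver_th.
by apply: (int_comb_sub sVM eG); exists (cc v).
Qed.

(* [th] acts on [Lie] through a projector [P] and its complement, and evaluating its
   characteristic polynomial at the mean of the two eigenvalues gives
   [\det (1 - 2 P) = -1]; hence the rank of [P], which is the volume of [Y], is odd. *)
Lemma ver_vol_odd : exists2 l : nat, odd l & vL (\det Y) = l%:Z.
Proof.
have [kap [Gb [kapP kapT charG]]] := lie_coord.
have sVM := submodule_ver; have [M00 MD MZ] := sM.
pose t := wred L y - wred L y'; have t0 : t != 0 by rewrite subr_eq0.
pose P := t^-1 *: (Gb - (wred L y')%:M).
have MT v : M v -> M (v *m T) by apply: (fr_act frM).
have eigE v : v *m eig0 = (y - y')^-1 *: (v *m T - y' *: v).
  by rewrite /eig0 -scalemxAr mulmxBr mul_mx_scalar.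
have Me v : M v -> M (v *m eig0).
  move=> Mv; rewrite eigE; apply: (MZ) => //.
  by apply: (submoduleB subL sM); [apply: MT|apply: (MZ)].
have kapP0 v : M v -> kap (v *m eig0) = kap v *m P.
  move=> Mv; have MT' := MT _ Mv; have My : M (y' *: v) by apply: (MZ).
  rewrite eigE (qcZ kapP) //; last exact: (submoduleB subL sM).
  rewrite (qcB dvrL sM kapP) // kapT // (qcZ kapP) // -scalemxAr mulmxBr mul_mx_scalar.
  congr (_ *: _); apply: (mulfI t0); rewrite divff //.
  have <- : wred L (y - y') = t by rewrite (dvr_redB dvrL).
  by rewrite -(resM (wred_residue L)) ?divff ?(res1 (wred_residue L)) //; apply: (ringB subL).
have PP : P *m P = P.
  apply: mulmx_ext => x; have [v Mv <-] := qc_surj kapP x.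
  by rewrite mulmxA -!kapP0 //; [rewrite -mulmxA eig00|apply: Me].
have dP : \det (1%:M - 2%:R *: P) = -1.
  pose x := (wred L y + wred L y') / 2%:R.
  have xG : x%:M - Gb = (t / 2%:R) *: (1%:M - 2%:R *: P).
    have tE : t / 2%:R * (2%:R * t^-1) = 1 by field; rewrite t0 two_neq0.
    rewrite scalerBr /P !scalerA tE scale1r scale_scalar_mx mulr1 opprB addrA -raddfD /=.
    by congr (_%:M - _); rewrite /x /t; field.
  have := char_poly_horner Gb x; rewrite charG xG detZ hornerM horner_exp !hornerXsubC.
  have -> : x - wred L y = - (t / 2%:R) by rewrite /x /t; field.
  have -> : x - wred L y' = t / 2%:R by rewrite /x /t; field.
  rewrite mulNr -exprS prednK // -mulrN1 => /mulfI -> //.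
  by rewrite expf_neq0 // mulf_neq0 ?invr_eq0.
exists (\rank P).
  have := det_1_sub_2idempotent PP; rewrite dP -signr_odd; case: odd => //=.
  rewrite expr0 => /eqP; rewrite eq_sym -addr_eq0 -mulr2n => /eqP two0.
  by case/eqP: two_neq0.
have [Yu Xu] := ver_mx_unit.
(* The image of [P] is the [phi0]-part of [Lie]. Since the Verschiebung maps the second half of [M]
   to the first by [Y], this part is the quotient of the standard lattice by the rows of [Y], whose
   length is the valuation of [\det Y]. *)
pose kq (v : 'rV[L]_n) := kap (v *m f0) *m col_base P.
have O1 : int_comb (wint L) (1%:M : 'M[L]_n) = [set v | intmx (wint L) v].
  by apply/seteqP; split=> v; rewrite mem_lat ?unitmx1 // invmx1 mulmx1.
have f0e : f0 *m eig0 = f0 by apply/eig0P.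
have kqE v : intmx (wint L) v -> kap (v *m f0) = kap (v *m f0) *m P.
  by move=> /M0 Mv; rewrite -kapP0 // -mulmxA f0e.
have kqP : quot_coord (wint L) (wred L) (int_comb (wint L) Y) (int_comb (wint L) 1%:M) kq.
  rewrite O1; split.
  - by move=> u v /M0 Mu /M0 Mv; rewrite /kq mulmxDl (qcD kapP) // mulmxDl.
  - by move=> a v Oa /M0 Mv; rewrite /kq -scalemxAl (qcZ kapP) // scalemxAl.
  - move=> z; have [v Mv vE] := qc_surj kapP (z *m row_base P).
    have /submxP[a aE] : (v *m eig0 <= f0)%MS by rewrite e0 submxMl.
    have Ia : intmx (wint L) a by apply/M0; rewrite -aE; apply: Me.
    have PE : row_base P *m P = row_base P.
      by rewrite -[X in _ *m X = _]mulmx_base mulmxA idempotent_base // mul1mx.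
    by exists a => //; rewrite /kq -aE kapP0 // vE -[z *m _ *m P]mulmxA PE -mulmxA idempotent_base // mulmx1.
  move=> v Iv; have /M0 Mv := Iv; split=> [k0|[w Iw vE]].
    have : kap (v *m f0) = 0.
      by rewrite kqE // -(mulmx_base P) mulmxA -/(kq v) k0 mul0mx.
    move/(qc_ker kapP Mv) => [u /M01[a [b [Ia Ib uE]]]].
    rewrite verE uE map_mxD !map_mxM mulmxDl -!mulmxA YE => wE.
    exists (s b); first by move=> i; rewrite mxE; apply: wfrob_int.
    apply: (row_free_inj ff0) => /=.
    have := congr1 (mulmx^~ eig0) wE; rewrite mulmxDl -!mulmxA f0e -s_eig1V => <-.
    rewrite [s f0 *m _]mulmxA -map_mxM -{1}f0e -[f0 *m _ *m _]mulmxA eig01 mulmx0.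
    by rewrite map_mx0 mul0mx mulmx0 add0r.
  rewrite /kq (_ : kap _ = 0) ?mul0mx //; apply/(qc_ker kapP Mv).
  exists (s w *m f1); last by rewrite verE map_mxM ss -mulmxA YE mulmxA vE.
  by apply/M1 => i l; rewrite mxE ord1; apply: wfrob_int.
have vY : isvol (wint L) piL (int_comb (wint L) Y) (vL (\det Y)) by exists Y.
have v1 : isvol (wint L) piL (int_comb (wint L) (1%:M : 'M[L]_n)) 0.
  by exists 1%:M; rewrite unitmx1 det1 (pival1 dvrL).
have sY := isvol_submodule dvrL vY; have s1 := isvol_submodule dvrL v1.
have YO : int_comb (wint L) Y `<=` int_comb (wint L) 1%:M.
  by move=> _ [w Iw ->]; rewrite O1; apply: (intmx_mul subL) => // i l; rewrite ord1.
have piY (v : 'rV_n) : int_comb (wint L) 1%:M v -> int_comb (wint L) Y (piL *: v).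
  rewrite O1 => Iv; exists (v *m s X).
    move=> i; apply: (intmx_mul subL) => // a b; rewrite mxE; exact: wfrob_int.
  have sXu : s X \in unitmx by rewrite map_unitmx.
  have sXY : s X *m Y = piL%:M.
    have YX : Y *m s X = piL%:M.
      by rewrite -(ss Y) -map_mxM frob_ver_mx map_scalar_mx /= wfrob_str.
    by apply: (can_inj (mulmxK sXu)); rewrite -mulmxA YX mul_mx_scalar mul_scalar_mx.
  by rewrite -mulmxA sXY mul_mx_scalar.
have := flag_vol dvrL sY s1 YO kqP vY piY (leqnn _); rewrite flagN => /(isvol_uniq dvrL v1).
by move/esym/eqP; rewrite subr_eq0 => /eqP.
Qed.

End Parity.

(** Up to a unit, [Hf] is [Gp *m X^T] with [X] the matrix of the Frobenius from the first half of
    [M] to the second. As Frobenius times Verschiebung is [pi], the valuation of [\det X] is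
    [n - l], where [l] is the odd valuation of [\det Y]. *)
Lemma framing_hermitian delta : (0 < n)%N -> wint L delta -> wint L delta^-1 -> delta != 0 ->
  exists f0 : 'M[L]_(n, n.*2), exists Hf : 'M[L]_n, exists l : nat,
  [/\ [/\ row_free f0, (f0 :=: eig0)%MS & f0 *m T = y *: f0], Hf = delta *: (f0 *m G *m (s f0 *m Fm)^T),
      Hf \in unitmx, odd l & pival (wint L) piL (\det Hf) = h%:Z + n%:Z - l%:Z].
Proof.
move=> n0 Od OdV d0.
have [f0 [f1 [[ff0 ff1 e0 e1] [f0T f1T] M0 M1 M01]]] := framing_split.
have [Gu vG] := framing_gram f0T f1T M0 M1 M01.
have [X IX XE] := frob_f0 e1 f0T M0 M1; have [Y IY YE] := ver_f1 e0 f1T M0 M1.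
have [Yu Xu] := ver_mx_unit ff1 XE YE; have vXY := frob_ver_vol ff1 XE YE.
have [l lo vY] := ver_vol_odd n0 ff0 ff1 e0 f0T M0 M1 M01 IX IY XE YE.
exists f0, (delta *: (f0 *m G *m (s f0 *m Fm)^T)), l.
have FE : f0 *m G *m (s f0 *m Fm)^T = f0 *m G *m f1^T *m X^T by rewrite XE trmx_mul mulmxA.
have XTu : X^T \in unitmx by rewrite unitmx_tr.
have u : f0 *m G *m (s f0 *m Fm)^T \in unitmx by rewrite FE unitmx_mul Gu.
split=> //; first by rewrite unitmxZ ?unitfE.
rewrite detZ (pivalM dvrL) ?expf_neq0 ?det_neq0 // (pivalX dvrL) // (pival_unit dvrL) // mul0rn.
rewrite FE det_mulmx (pivalM dvrL) ?det_neq0 // vG det_tr add0r.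
by move: vXY; rewrite vY; move: (pival _ _ _); clear => v; lia.
Qed.

End IsocrystalBasis.

(** * Coordinates on the hermitian space *)

Section ColengthTransport.
Variables (L K : fieldType) (chi : {rmorphism L -> K}) (O : set L) (n N : nat).
Variable f : 'rV[L]_n -> 'rV[K]_N.
Hypotheses (f_inj : injective f) (fD : forall u v, f (u + v) = f u + f v).
Hypothesis fZ : forall a v, f (a *: v) = chi a *: f v.

Let f0 : f 0 = 0. Proof. by rewrite -(scale0r 0) fZ rmorph0 scale0r. Qed.

Lemma submodule_image A : submodule O A -> submodule (chi @` O) (f @` A).
Proof.
move=> [A0 AD AZ]; split=> [|_ _ [u Au <-] [v Av <-]|_ _ [a Oa <-] [v Av <-]].
- by exists 0.
- by exists (u + v); [apply: AD|].
- by exists (a *: v); [apply: AZ|].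
Qed.

Lemma submodule_preimage A : submodule (chi @` O) A -> submodule O (f @^-1` A).
Proof.
move=> [A0 AD AZ]; split=> [|u v Au Av|a v Oa Av]; rewrite /preimage /= ?f0 ?fD ?fZ //.
- exact: AD.
- by apply: AZ => //; exists a.
Qed.

Lemma preimageK A : f @^-1` (f @` A) = A.
Proof.
by apply/seteqP; split=> v; [case=> u Au /f_inj <-|exists v].
Qed.

Lemma imageK A B : A `<=` f @` B -> f @` (f @^-1` A) = A.
Proof.
move=> AB; apply/seteqP; split=> [_ [v Av <-] //|v Av].
by have [u _ uv] := AB v Av; exists u => //; rewrite /preimage /= uv.
Qed.

Lemma colength_image A B x : colength O A B x -> colength (chi @` O) (f @` A) (f @` B) x.
Proof.
move=> [s [<- <- sS sI]]; exists (fun i => f @` s i); split=> // [i ix|i ix].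
  exact/submodule_image/sS.
have [[s1 s2] sM] := sI i ix; split.
  split=> [_ [v sv <-]|H]; first by exists v => //; apply: s1.
  by apply: s2 => v sv; have [|u su /f_inj <-] := H (f v); [exists v|].
move=> M /submodule_preimage SM iM Mi; have ME := imageK Mi.
have [||E|E] := sM _ SM; last 2 first.
- by left; rewrite -ME E.
- by right; rewrite -ME E.
- by move=> v sv; apply: iM; exists v.
by move=> v /Mi[u su /f_inj <-].
Qed.

(** Moves lengths over the image of the integers of [L] back to [L] itself, where they are
    differences of volumes. *)
Lemma colength_preimage A B x :
  colength (chi @` O) (f @` A) (f @` B) x -> colength O A B x.
Proof.
move=> [s [s0 sx sS sI]].
have sB i : (i <= x)%N -> s i `<=` f @` B.
  move=> ix; rewrite -sx -(subnKC ix); have := subnKC ix.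
  elim: (x - i)%N => [|d IH] dx; first by rewrite addn0.
  move=> v sv; rewrite addnS in dx *.
  have [] := sI (i + d)%N; first by rewrite -dx leqnn.
  move=> [H _] _; apply: (H).
  suff : forall e, (e <= d)%N -> s (i + e)%N v by apply.
  elim=> [|e IHe] ed; first by rewrite addn0.
  rewrite addnS; have [] := sI (i + e)%N; first by rewrite -dx; lia.
  by move=> [H' _] _; apply: H'; apply: IHe; apply: ltnW.
exists (fun i => f @^-1` s i); split; rewrite ?s0 ?sx ?preimageK //.
  by move=> i ix; apply/submodule_preimage/sS.
move=> i ix; have [[s1 s2] sM] := sI i ix; split.
  split=> [v sv|H]; first exact: s1.
  by apply: s2 => v sv; have [u _ uv] := sB _ ix v sv; rewrite -uv; apply: H; rewrite /preimage /= uv.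
move=> M SM iM Mi; have [||E|E] := sM (f @` M) (submodule_image SM); last 2 first.
- by left; rewrite -E preimageK.
- by right; rewrite -E preimageK.
- by rewrite -(imageK (sB _ (ltnW ix))) => _ [v sv <-]; exists v => //; apply: iM.
by move=> _ [v Mv <-]; apply: Mi.
Qed.

End ColengthTransport.

Section Coordinates.
Variables (K L : fieldType) (O : set K) (OL0 : set L) (pi : K) (piL : L).
Variables (k : closedFieldType) (kL : fieldType) (r : K -> k) (rL : L -> kL).
Hypotheses (dvr : is_dvr O pi r) (dvrL : is_dvr OL0 piL rL).
Variable chi : {rmorphism L -> K}.
Hypotheses (chi_pi : chi piL = pi) (chi_int : forall x, O (chi x) <-> OL0 x).
Hypothesis pival_chi : forall x, pival O pi (chi x) = pival OL0 piL x.
Variables (sigma : {rmorphism K -> K}) (sigL : {rmorphism L -> L}).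
Hypotheses (sigma_int : forall x, O x -> O (sigma x)) (sigma_pi : sigma pi = pi).
Hypothesis sigma_chi : forall x, sigma (chi x) = chi (sigL x).
Hypothesis sigL2 : forall x, sigL (sigL x) = x.
Hypothesis fixed_chi : forall x, sigma (sigma x) = x -> exists y, chi y = x.
Variables (n N : nat) (H : 'M[K]_n).
Hypotheses (Hu : H \in unitmx) (hermH : conj_tr sigma H = H).
Variables (e0 : 'M[K]_(n, N)) (U U' : set 'rV[K]_N) (b : 'rV[K]_N -> 'rV[K]_N -> K).
Hypothesis e0free : row_free e0.
Hypothesis UE : forall v, U v <-> (v <= e0)%MS.
Hypothesis U'U : U' `<=` U.
Hypothesis U'E : forall c, U' (c *m e0) <-> fr2 sigma c = c.
Hypothesis bE : forall u v, b (u *m e0) (v *m e0) = beta sigma H u v.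
Let subO := dvr_subring dvr.
Let subL := dvr_subring dvrL.
Let piL0 := dvr_pi_neq0 dvrL.
Let pi0 := dvr_pi_neq0 dvr.
Local Notation OLs := (chi @` OL0).
Local Notation sdual := (sdual O sigma H).
Local Notation mchi := (map_mx chi).
Implicit Types (A : set 'rV[K]_N) (Z : set 'rV[K]_n).

Let emb (c : 'rV[K]_n) : 'rV[K]_N := c *m e0.
Let emb_inj : injective emb := row_free_inj e0free.

(* [A] is a lattice of [C], and [Z] the coordinates of its extension to [C_k], of
   volume [a]. *)
Definition rep A Z a := exists g : 'M[L]_n,
  [/\ g \in unitmx, A = int_comb OLs (mchi g *m e0), Z = int_comb O (mchi g)
    & pival OL0 piL (\det g) = a].

Lemma fixed_mx m p (B : 'M[K]_(m, p)) : fr2 sigma B = B -> exists C, B = mchi C.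
Proof.
move=> fB; have ex (ij : 'I_m * 'I_p) : exists y, chi y = B ij.1 ij.2.
  by apply: fixed_chi; have /matrixP/(_ ij.1 ij.2) := fB; rewrite !mxE.
have [c cE] := choice ex; exists (\matrix_(i, j) c (i, j)).
by apply/matrixP => i j; rewrite !mxE cE.
Qed.

Lemma fr2_chi m p (C : 'M[L]_(m, p)) : fr2 sigma (mchi C) = mchi C.
Proof. by apply/matrixP => i j; rewrite !mxE !sigma_chi sigL2. Qed.

Lemma mem_chi (g : 'M[L]_n) (c : 'rV[L]_n) : g \in unitmx ->
  int_comb O (mchi g) (mchi c) <-> int_comb OL0 g c.
Proof.
move=> gu; rewrite mem_lat ?map_unitmx // (mem_lat OL0 c gu) -map_invmx -map_mxM.
by split=> I i j; [have := I i j; rewrite mxE => /chi_int|rewrite mxE; apply/chi_int].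
Qed.

Lemma int_comb_chi (g : 'M[L]_n) :
  int_comb OLs (mchi g *m e0) = (fun c => mchi c *m e0) @` int_comb OL0 g.
Proof.
apply/seteqP; split=> [_ [d Od ->]|_ [_ [d Od ->] <-]].
  have ex i : exists y, OL0 y /\ chi y = d 0 i by have [y Oy yE] := Od i; exists y.
  have [y yP] := choice ex; pose d' := \row_i y i.
  have dE : d = mchi d' by apply/rowP => i; rewrite !mxE; have [] := yP i.
  exists (d' *m g); last by rewrite map_mxM mulmxA dE.
  by exists d' => // i; rewrite mxE; have [] := yP i.
exists (mchi d); first by move=> i; rewrite mxE; exists (d 0 i).
by rewrite map_mxM mulmxA.
Qed.

Lemma rep_mem A Z a v : rep A Z a -> A v <-> exists2 c, v = mchi c *m e0 & Z (mchi c).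
Proof.
move=> [g [gu -> -> _]]; rewrite int_comb_chi.
by split=> [[c /(mem_chi _ gu) gc <-]|[c -> /(mem_chi _ gu) gc]]; exists c.
Qed.

Lemma rep_ext_eq A A' Z a : rep A Z a ->
  (forall v, A' v <-> exists2 c, v = mchi c *m e0 & Z (mchi c)) -> A' = A.
Proof.
by move=> AZ A'E; apply/seteqP; split=> v; rewrite A'E (rep_mem _ AZ).
Qed.

Lemma rep_isvol A Z a : rep A Z a -> isvol O pi Z a.
Proof.
move=> [g [gu _ -> <-]]; exists (mchi g); rewrite map_unitmx; split=> //.
by rewrite det_map_mx pival_chi.
Qed.

Lemma rep_stable A Z a : rep A Z a -> stable sigma Z.
Proof.
move=> [g [gu _ -> _]] v; rewrite !mem_lat ?map_unitmx //.
have -> : fr2 sigma v *m invmx (mchi g) = fr2 sigma (v *m invmx (mchi g)).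
  by rewrite fr2M fr2_inv fr2_chi.
exact: (intmx_tau dvr sigma_int sigma_pi).
Qed.

(** The basis vectors of [A] are fixed by [tau], so their coordinates in [e0] are fixed by the
    squared Frobenius and come from [L]. *)
Lemma rep_ex A : lattice_on OLs U U' A -> exists Z a, rep A Z a.
Proof.
move=> [s [e [ef eU eU' ->]]].
have ee : (e :=: e0)%MS.
  apply/eqmxP/andP; split; apply/row_subP => i.
    by apply/UE/eU; apply: row_sub.
  by apply/eU/UE; apply: row_sub.
have sn : s = n by rewrite -(eqP ef) ee (eqP e0free).
move: e ef eU eU' ee; rewrite {}sn => e ef _ eU' ee.
have /submxP[P PE] : (e <= e0)%MS by rewrite ee.
have [|g gE] := @fixed_mx _ _ P.
  apply/row_matrixP => i; rewrite /fr2 -!map_row; apply/U'E.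
  by rewrite -row_mul -PE; apply: eU'.
have gu : g \in unitmx.
  rewrite -(map_unitmx chi) -gE -row_free_unit /row_free -(mxrankMfree P e0free) -PE ee.
  exact: e0free.
exists (int_comb O (mchi g)), (pival OL0 piL (\det g)), g; split=> //.
by rewrite PE gE.
Qed.

Lemma rep_sub A Z a A' Z' a' : rep A Z a -> rep A' Z' a' -> A `<=` A' <-> Z `<=` Z'.
Proof.
move=> AZ AZ'; split=> [AA|ZZ v /(rep_mem _ AZ)[c vE /ZZ Zc]]; last first.
  by apply/(rep_mem _ AZ'); exists c.
have sZ' := isvol_submodule dvr (rep_isvol AZ').
have [g [gu AE ZE _]] := AZ; rewrite ZE; apply: (int_comb_sub sZ') => i.
have Zi : Z (mchi (row i g)) by rewrite ZE map_row; apply: (int_comb_row subO).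
have /AA/(rep_mem _ AZ')[c /(row_free_inj e0free)] : A (mchi (row i g) *m e0).
  by apply/(rep_mem _ AZ); exists (row i g).
by rewrite /= map_row => <-.
Qed.

Lemma rep_extend A Z a : rep A Z a -> extend O A = emb @` Z.
Proof.
move=> AZ; have sZ := isvol_submodule dvr (rep_isvol AZ).
have sE : submodule O (emb @` Z).
  have [Z0 ZD ZZ] := sZ; split=> [|_ _ [u Zu <-] [v Zv <-]|c _ Oc [v Zv <-]].
  - by exists 0; rewrite // /emb mul0mx.
  - by exists (u + v); [apply: ZD|rewrite /emb mulmxDl].
  - by exists (c *: v); [apply: ZZ|rewrite /emb -scalemxAl].
apply/seteqP; split=> [v [s [e [Ae]]]|_ [c Zc <-]].
  apply: (int_comb_sub sE) => i; have /(rep_mem _ AZ)[c -> Zc] := Ae i.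
  by exists (mchi c).
have [g [gu AE ZE _]] := AZ; exists n, (mchi g *m e0); split=> [i|].
  apply/(rep_mem _ AZ); exists (row i g); rewrite ?map_row ?row_mul //.
  by rewrite ZE; apply: (int_comb_row subO).
by rewrite ZE in Zc; case: Zc => d Od ->; exists d; rewrite // /emb mulmxA.
Qed.

Lemma gram_descent : exists2 HL : 'M[L]_n, HL \in unitmx & H = mchi HL.
Proof.
have [|HL HE] := @fixed_mx _ _ H; first by rewrite -conj_trK !hermH.
by exists HL; rewrite // -(map_unitmx chi) -HE.
Qed.

(** [A] spans [Z] over [O], so by sesquilinearity integrality against [A] is integrality against
    [Z]. The volume is identified with that of [sdual Z] by uniqueness. *)
Lemma rep_dual A Z a : rep A Z a ->
  rep (dual O b U' A) (sdual Z) (- a - pival O pi (\det H)).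
Proof.
move=> AZ; have [g [gu AE ZE vg]] := AZ; have [HL HLu HE] := gram_descent.
pose g' := invmx (HL *m conj_tr sigL g).
have u : HL *m conj_tr sigL g \in unitmx by rewrite unitmx_mul HLu conj_tr_unit.
have ZE' : sdual Z = int_comb O (mchi g').
  rewrite ZE (sdual_lat dvr) ?map_unitmx // map_invmx map_mxM -HE.
  suff -> : mchi (conj_tr sigL g) = conj_tr sigma (mchi g) by [].
  by apply/matrixP => i j; rewrite !mxE sigma_chi.
have R' : rep (int_comb OLs (mchi g' *m e0)) (sdual Z) (pival OL0 piL (\det g')).
  by exists g'; rewrite unitmx_inv.
have vE := isvol_uniq dvr (rep_isvol R') (isvol_sdual dvr sigma_int sigma_pi Hu (rep_isvol AZ)).
have -> : dual O b U' A = int_comb OLs (mchi g' *m e0); last by rewrite -vE.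
apply: (rep_ext_eq R') => v; split=> [[U'v Hv]|[c -> Zc]].
  have /submxP[c cE] : (v <= e0)%MS by apply/UE/U'U.
  have [|d dE] := @fixed_mx _ _ c; first by apply/U'E; rewrite -cE.
  exists d; rewrite -?dE // ZE => w [x Ox ->]; rewrite mulmx_sum_row.
  have -> : beta sigma H c (\sum_i x 0 i *: row i (mchi g)) =
            \sum_i sigma (x 0 i) * beta sigma H c (row i (mchi g)).
    rewrite /beta /conj_tr map_mx_sum linear_sum mulmx_sumr summxE; apply: eq_bigr => i _.
    by rewrite map_mxZ linearZ -scalemxAr mxE.
  apply: (ring_sum subO) => i _; apply: (ringM subO); first exact: sigma_int.
  rewrite -bE -cE; apply: Hv; apply/(rep_mem _ AZ); exists (row i g); rewrite map_row //.
  by rewrite ZE; apply: (int_comb_row subO).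
split; first by apply/U'E; rewrite fr2_chi.
by move=> w /(rep_mem _ AZ)[d -> Zd]; rewrite bE; apply: Zc.
Qed.

Lemma rep_scale A Z a i : rep A Z a ->
  rep (scale (pi ^+ i) A) (scale (pi ^+ i) Z) (a + (n * i)%:Z).
Proof.
move=> [g [gu -> -> vg]]; exists (piL ^+ i *: g).
have chipi : chi (piL ^+ i) = pi ^+ i by rewrite rmorphXn chi_pi.
have sc (O' : set K) s (e : 'M[K]_(n, s)) x : scale x (int_comb O' e) = int_comb O' (x *: e).
  apply/seteqP; split=> [_ [_ [c Oc ->] <-]|_ [c Oc ->]].
    by exists c; rewrite // scalemxAr.
  by exists (c *m e); [exists c|rewrite scalemxAr].
rewrite !sc map_mxZ /= chipi -scalemxAl unitmxZ ?unitfE ?expf_neq0 //; split=> //.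
rewrite detZ (pivalM dvrL) ?expf_neq0 ?det_neq0 // !(pivalX dvrL) ?expf_neq0 //.
by rewrite (pival_pi dvrL) vg addrC; congr (_ + _); rewrite -mulrnA natz mulnC.
Qed.

Lemma rep_colength A Z a A' Z' a' t : rep A Z a -> rep A' Z' a' -> colength OLs A A' t ->
  a' = a - t%:Z.
Proof.
move=> [g [gu -> _ va]] [g' [gu' -> _ va']].
rewrite !int_comb_chi => /(colength_preimage (chi := chi)) H'.
have vg : isvol OL0 piL (int_comb OL0 g) a by exists g.
have vg' : isvol OL0 piL (int_comb OL0 g') a' by exists g'.
apply: (isvol_uniq dvrL vg'); apply: (colength_vol dvrL vg); apply: H'.
- by move=> u v /(row_free_inj e0free)/map_mx_inj.
- by move=> u v; rewrite map_mxD mulmxDl.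
- by move=> x v; rewrite map_mxZ -scalemxAl.
Qed.

Lemma emb_lattice Z a : isvol O pi Z a -> lattice O U (emb @` Z).
Proof.
move=> [g [gu -> _]]; exists n, (g *m e0); split=> //.
- by rewrite /row_free mxrankMfree // mxrank_unit.
- move=> v; rewrite UE; have /eqmxP/andP[le ge] : (g *m e0 :=: e0)%MS.
    by apply: eqmxMfull; rewrite row_full_unit.
  by split=> vv; apply: (submx_trans vv).
apply/seteqP; split=> [_ [_ [c Oc ->] <-]|_ [c Oc ->]].
  by exists c; rewrite // /emb mulmxA.
by exists (c *m g); [exists c|rewrite /emb mulmxA].
Qed.

Lemma emb_dual Z : dual O b U (emb @` Z) = emb @` sdual Z.
Proof.
apply/seteqP; split=> [v [/UE/submxP[c ->] Hv]|_ [c Zc <-]].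
  by exists c => // w Zw; rewrite -bE; apply: Hv; exists w.
split; first by apply/UE; apply: submxMl.
by move=> _ [w Zw <-]; rewrite bE; apply: Zc.
Qed.

Lemma emb_scale x Z : scale x (emb @` Z) = emb @` scale x Z.
Proof.
apply/seteqP; split=> [_ [_ [c Zc <-] <-]|_ [_ [c Zc <-] <-]].
  by exists (x *: c); [exists c|rewrite /emb -scalemxAl].
by exists (emb c); [exists c|rewrite /emb -scalemxAl].
Qed.

Lemma emb_sub Z Z' : emb @` Z `<=` emb @` Z' <-> Z `<=` Z'.
Proof.
split=> [ZZ c Zc|ZZ _ [c Zc <-]]; last by exists c => //; apply: ZZ.
by have [|d Zd /emb_inj <-] := ZZ (emb c); first by exists c.
Qed.

Lemma emb_colength Z Z' t : colength O Z Z' t -> colength O (emb @` Z) (emb @` Z') t.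
Proof.
have OE : O = (idfun : {rmorphism K -> K}) @` O.
  by apply/seteqP; split=> [c Oc|_ [c Oc <-] //]; exists c.
move=> /(colength_image (chi := idfun) emb_inj); rewrite -OE; apply.
  by move=> u v; rewrite /emb mulmxDl.
by move=> x v; rewrite /emb -scalemxAl.
Qed.

End Coordinates.

(** * Base change of the isocrystal to [k] *)

Section BaseChange.
Variables (F : fieldType) (OF : set F) (pi : F) (Fq : finFieldType) (resF : F -> Fq).
Hypotheses (OFpi : OF pi) (pi0 : pi != 0).
Variables (E : fieldExtType F) (n : nat) (Fq2 : finFieldType) (k : fieldType).
Variables (j : Fq -> Fq2) (jk : Fq -> k).
Variables (L : rel_witt OF pi resF j) (Wk : rel_witt OF pi resF jk).
Variables (f : {rmorphism Fq2 -> k}) (chi : {rmorphism L -> Wk}).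
Hypothesis Hchi : witt_map f chi.
Variables (phi0 : {rmorphism E -> L}) (delta : L) (D : isocrystal E n L).
Hypothesis delta_frob : wfrob L delta = - delta.
Local Notation piW := (wstr Wk pi).
Local Notation s := (map_mx (wfrob L)).
Local Notation sk := (map_mx (wfrob Wk)).
Local Notation mchi := (map_mx chi).
Local Notation Fm := (frob_mx D).
Local Notation Vm := (ver_mx D).
Local Notation G := (gram D).
Local Notation Dk := (base_change chi D).
Local Notation Ck := (Ck chi phi0 D).
Local Notation Cfix := (Cfix chi phi0 D).
Local Notation herm := (herm chi delta D).
Hypotheses (FV : s Vm *m Fm = (wstr L pi)%:M) (Fu : Fm \in unitmx).
Hypotheses (FG : Fm *m G = s (G *m Vm^T)) (GT : G^T = - G).
Variables (f0 : 'M[L]_(n, n.*2)) (th : E) (a b : L).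
Hypotheses (f0free : row_free f0) (f0act : forall x, f0 *m act D x = phi0 x *: f0).
Hypotheses (f0eig : (f0 :=: a *: (act D th - b%:M))%MS) (ab : a * (phi0 th - b) = 1).
Let piW0 : piW != 0 := dvr_pi_neq0 (witt_dvr Wk OFpi pi0).

Let mchi_s m p (A : 'M_(m, p)) : mchi (s A) = sk (mchi A).
Proof. by apply/matrixP => i l; rewrite !mxE (wmap_frob Hchi). Qed.

Let frobE v : frob Dk v = sk v *m mchi Fm. Proof. by []. Qed.

Let frob_inj : injective (frob Dk).
Proof.
move=> u v; rewrite !frobE => /(can_inj (mulmxK _)) H.
by apply: (map_mx_inj (f := wfrob Wk)); apply: H; rewrite map_unitmx.
Qed.

Let frobZ x v : frob Dk (x *: v) = wfrob Wk x *: frob Dk v.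
Proof. by rewrite !frobE map_mxZ -scalemxAl. Qed.

Let frobZpi v : frob Dk (piW *: v) = piW *: frob Dk v.
Proof. by rewrite frobZ wfrob_str. Qed.

Let frob_verk v : frob Dk (ver Dk v) = piW *: v.
Proof.
rewrite frobE /ver /semilin map_mxM -mulmxA /= -mchi_s -map_mxM FV map_scalar_mx /=.
rewrite (wmap_str Hchi) mul_mx_scalar; congr (_ *: _).
by apply/matrixP => i l; rewrite !mxE wfrobVK.
Qed.

Lemma ver_frobP v u : ver Dk v = u <-> frob Dk u = piW *: v.
Proof. by split=> [<-|H] //; apply: frob_inj; rewrite frob_verk. Qed.

(** [a *: (act D th - b%:M)] is the eigenprojector [eig0]; by [ab] it acts as the identity on
    [Ck]. *)
Lemma CkE v : Ck v <-> (v <= mchi f0)%MS.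
Proof.
split=> [Cv|/submxP[c ->] x]; last first.
  by rewrite /= -mulmxA -map_mxM f0act map_mxZ /= -scalemxAr.
have /submxP[P PE] : (a *: (act D th - b%:M) <= f0)%MS by rewrite f0eig.
have vE : v *m mchi (a *: (act D th - b%:M)) = v.
  rewrite map_mxZ map_mxB map_scalar_mx -scalemxAr mulmxBr mul_mx_scalar (Cv th).
  by rewrite -scalerBl scalerA -rmorphB -rmorphM /= ab rmorph1 scale1r.
by rewrite -vE PE map_mxM mulmxA submxMl.
Qed.

Lemma CfixE w : Cfix w <-> Ck w /\ frob Dk (frob Dk w) = piW *: w.
Proof.
split=> [[Cw vw]|[Cw fw]]; split=> //.
  by move/ver_frobP: vw; rewrite frobZpi => /(scalerI piW0) ->; rewrite frob_verk.
by apply/ver_frobP; rewrite frobZpi; congr (_ *: _); apply/esym/ver_frobP.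
Qed.

Lemma ver_Cfix w : Cfix w -> ver Dk w = frob Dk w.
Proof. by move=> /CfixE[_ fw]; apply/ver_frobP. Qed.

Lemma pairing_frobk v w : pairing Dk (frob Dk v) w = wfrob Wk (pairing Dk v (ver Dk w)).
Proof.
have -> : pairing Dk (frob Dk v) w = (sk v *m mchi (Fm *m G) *m w^T) 0 0.
  by rewrite map_mxM !mulmxA.
set wV := map_mx (wfrobV Wk) w; have wE : w^T = sk wV^T.
  by apply/matrixP => i l; rewrite !mxE wfrobVK.
have -> : pairing Dk v (ver Dk w) = (v *m mchi (G *m Vm^T) *m wV^T) 0 0.
  by rewrite /pairing /bilin /ver /semilin -/wV trmx_mul map_mxM map_trmx !mulmxA.
have mxs (A : 'M_1) : wfrob Wk (A 0 0) = sk A 0 0 by rewrite mxE.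
by rewrite mxs [in RHS]map_mxM [in RHS]map_mxM wE -mchi_s -FG.
Qed.

Lemma pairing_swap v w : pairing Dk v w = - pairing Dk w v.
Proof.
have mxt (A : 'M[Wk]_1) : A 0 0 = A^T 0 0 by rewrite mxE.
have Gk : (gram Dk)^T = - gram Dk by rewrite -[gram Dk]/(mchi G) map_trmx GT map_mxN.
by rewrite /pairing /bilin mxt !trmx_mul trmxK mulmxA Gk mulmxN mulNmx mxE.
Qed.

(** The basis [e0] is one of a lattice of [C], so [tau] acts on coordinates by the squared Frobenius
    alone. [H] is hermitian since Verschiebung and Frobenius agree on [C]. The passage from [f0] to
    [e0] by [g] changes the valuation of the determinant by twice that of [\det g], which preserves
    its parity. *)
Lemma coordinates Hf A : Hf = delta *: (f0 *m G *m (s f0 *m Fm)^T) -> Hf \in unitmx ->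
    latticeC chi phi0 D A ->
  exists (e0 : 'M[Wk]_(n, n.*2)) (H : 'M[Wk]_n),
  [/\ row_free e0 /\ forall v, Ck v <-> (v <= e0)%MS,
      forall c, Cfix (c *m e0) <-> fr2 (wfrob Wk) c = c,
      forall u v, herm (u *m e0) (v *m e0) = beta (wfrob Wk) H u v,
      H \in unitmx /\ conj_tr (wfrob Wk) H = H
    & exists w : int, pival (wint Wk) piW (\det H) =
        pival (wint L) (wstr L pi) (\det Hf) + w + w].
Proof.
move=> HfE Hfu [r [e [ef eC eFix _]]].
have f0k : row_free (mchi f0) by rewrite /row_free mxrank_map.
have ee : (e :=: mchi f0)%MS.
  apply/eqmxP/andP; split; apply/row_subP => i.
    by apply/CkE/eC; apply: row_sub.
  by apply/eC/CkE; apply: row_sub.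
have rn : r = n by rewrite -(eqP ef) ee (eqP f0k).
move: e ef eC eFix ee; rewrite {}rn => e0 ef eC eFix ee.
have /submxP[g gE] : (e0 <= mchi f0)%MS by rewrite ee.
have gu : g \in unitmx.
  by rewrite -row_free_unit /row_free -(mxrankMfree g f0k) -gE ee; exact: f0k.
pose H := chi delta *: (e0 *m mchi G *m (sk e0 *m mchi Fm)^T).
have frobr i : frob Dk (row i e0) = row i (sk e0 *m mchi Fm).
  by rewrite frobE row_mul map_row.
have hermE u v : herm (u *m e0) (v *m e0) = beta (wfrob Wk) H u v.
  rewrite /Defs.herm /pairing /bilin frobE map_mxM /beta /H /conj_tr -scalemxAr -scalemxAl [RHS]mxE.
  by congr (_ * _); rewrite !trmx_mul !mulmxA.
have herm_conj v w : Cfix v -> Cfix w -> wfrob Wk (herm v w) = herm w v.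
  move=> Cv Cw; rewrite /Defs.herm rmorphM -(wmap_frob Hchi) delta_frob -(ver_Cfix Cw).
  by rewrite -pairing_frobk pairing_swap rmorphN mulrNN.
have frob2 c : frob Dk (frob Dk (c *m e0)) = piW *: (fr2 (wfrob Wk) c *m e0).
  have [_ fe] : True /\ forall i, frob Dk (frob Dk (row i e0)) = piW *: row i e0.
    by split=> // i; have /CfixE[] := eFix i.
  rewrite !frobE !map_mxM /= -!mulmxA -/(fr2 _ c) scalemxAr; congr (_ *m _).
  apply/row_matrixP => i; have := fe i; rewrite !frobE !map_mxM /= !map_row -!mulmxA -!row_mul.
  by move=> ->; rewrite linearZ.
have Hh : H = g *m mchi Hf *m conj_tr (wfrob Wk) g.
  rewrite /H gE HfE map_mxZ -scalemxAr -scalemxAl; congr (_ *: _).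
  by rewrite /conj_tr !map_mxM !trmx_mul !map_mxM -!map_trmx mchi_s !mulmxA.
have Hu : H \in unitmx by rewrite Hh !unitmx_mul conj_tr_unit gu map_unitmx Hfu.
clearbody H; exists e0, H; split=> //.
- move=> c; split=> [/CfixE[_]|cE].
    by rewrite frob2 => /(scalerI piW0) /(row_free_inj ef).
  by apply/CfixE; split; [apply/eC/submxMl|rewrite frob2 cE].
- split=> //; apply/matrixP => i l; rewrite !mxE.
  have HE i' l' : H i' l' = herm (row i' e0) (row l' e0).
    rewrite !rowE hermE /beta -rowE /conj_tr map_delta_mx trmx_delta -colE !mxE //.
  by rewrite !HE; apply: herm_conj.
exists (pival (wint Wk) piW (\det g)).
have dvrk := witt_dvr Wk OFpi pi0.
rewrite Hh !det_mulmx !(pivalM dvrk) ?mulf_neq0 ?det_neq0 ?conj_tr_unit ?map_unitmx //.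
rewrite det_tr !det_map_mx (pival_sigma dvrk (@wfrob_int _ _ _ _ _ _ _ Wk) (wfrob_str Wk pi)).
by rewrite (pival_chi OFpi pi0 Hchi) [X in X + _]addrC.
Qed.

End BaseChange.

Section ResidueFrobenius.
Variables (F : fieldType) (OF : set F) (pi : F) (Fq : finFieldType) (resF : F -> Fq).
Variables (R : fieldType) (j : Fq -> R) (W : rel_witt OF pi resF j).

(** The argument [W] is carried along because additivity of the power map is inherited from the
    Frobenius of [W]. *)
Definition residue_frob of rel_witt OF pi resF j := fun a : R => a ^+ #|Fq|.

Fact residue_frob_zmod : zmod_morphism (residue_frob W).
Proof.
have res := wred_residue W; have subW := wint_subring W.
have wB x y : wint W x -> wint W y -> wred W (x - y) = wred W x - wred W y.
  move=> Ox Oy; have -> : wred W x = wred W (x - y) + wred W y.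
    by rewrite -(resD res) ?subrK //; apply: (ringB subW).
  by rewrite addrK.
move=> a b; have [[x Ox <-] [y Oy <-]] := (res_surj res a, res_surj res b).
rewrite /residue_frob -wB // -!wfrob_red //; last exact: (ringB subW).
by rewrite rmorphB wB //; apply: wfrob_int.
Qed.

Fact residue_frob_monoid : monoid_morphism (residue_frob W).
Proof. by split=> [|a b]; rewrite /residue_frob ?expr1n ?exprMn. Qed.

HB.instance Definition _ := GRing.isZmodMorphism.Build R R (residue_frob W) residue_frob_zmod.
HB.instance Definition _ := GRing.isMonoidMorphism.Build R R (residue_frob W) residue_frob_monoid.

End ResidueFrobenius.

(** * The point of the open stratum *)

Section OpenStratum.
Variables (F : fieldType) (OF : set F) (pi : F) (Fq : finFieldType) (resF : F -> Fq).
Hypotheses (OFpi : OF pi) (pi0 : pi != 0).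
Variables (E : fieldExtType F) (n : nat) (Fq2 : finFieldType) (k : closedFieldType).
Variables (j : Fq -> Fq2) (jk : Fq -> k).
Variables (L : rel_witt OF pi resF j) (Wk : rel_witt OF pi resF jk).
Variables (f : {rmorphism Fq2 -> k}) (chi : {rmorphism L -> Wk}).
Hypotheses (Hchi : witt_map f chi) (cardFq2 : #|Fq2| = (#|Fq| ^ 2)%N).
Hypothesis wfrob2 : forall x, wfrob L (wfrob L x) = x.
Hypothesis two_neq0 : 2%:R != 0 :> k.
Variables (phi0 : {rmorphism E -> L}) (delta : L) (D : isocrystal E n L).
Local Notation O := (wint Wk).
Local Notation piW := (wstr Wk pi).
Local Notation sigma := (wfrob Wk).
Local Notation mchi := (map_mx chi).
Local Notation Ck := (Ck chi phi0 D).
Local Notation Cfix := (Cfix chi phi0 D).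
Local Notation herm := (herm chi delta D).
Local Notation OLs := (chi @` wint L).
Local Notation dualC := (dualC chi phi0 delta D).
Local Notation dualk := (dualk chi phi0 delta D).
Variables (e0 : 'M[Wk]_(n, n.*2)) (H : 'M[Wk]_n).
Hypotheses (Hu : H \in unitmx) (hermH : conj_tr sigma H = H).
Hypothesis e0free : row_free e0.
Hypothesis UE : forall v, Ck v <-> (v <= e0)%MS.
Hypothesis U'E : forall c, Cfix (c *m e0) <-> fr2 sigma c = c.
Hypothesis bE : forall u v, herm (u *m e0) (v *m e0) = beta sigma H u v.
Local Notation vH := (pival O piW (\det H)).
Variables (m : nat) (h : nat -> nat) (z : nat -> int).
Hypothesis m_gt0 : (0 < m)%N.
Hypothesis hz : forall i, (1 <= i <= m)%N -> (h i)%:Z = n%:Z - vH - 1 + z i + z i.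
Hypothesis h_mono : forall i i', (1 <= i)%N -> (i <= i' <= m)%N -> (h i <= h i')%N.
Hypothesis h_le : forall i, (1 <= i <= m)%N -> (h i <= n)%N.
Let dvrk : is_dvr O piW (wred Wk) := witt_dvr Wk OFpi pi0.
Let dvrL := witt_dvr L OFpi pi0.
Let piW0 : piW != 0 := dvr_pi_neq0 dvrk.
Let sigma_int : forall x, O x -> O (sigma x) := @wfrob_int _ _ _ _ _ _ _ Wk.
Let sigma_pi : sigma piW = piW := wfrob_str Wk pi.
Let frobVK : cancel (wfrobV Wk) sigma := @wfrobVK _ _ _ _ _ _ _ Wk.
Let chi_pi : chi (wstr L pi) = piW := wmap_str Hchi pi.
Let chi_int : forall x, O (chi x) <-> wint L x := wint_chi OFpi pi0 Hchi.
Let pv_chi : forall x, pival O piW (chi x) = pival (wint L) (wstr L pi) x :=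
  pival_chi OFpi pi0 Hchi.
Let sigma_chi x : sigma (chi x) = chi (wfrob L x).
Proof. by rewrite (wmap_frob Hchi). Qed.
Let fixed : forall x, sigma (sigma x) = x -> exists y, chi y = x :=
  fixed_chi OFpi pi0 Hchi cardFq2 wfrob2.
Let U'U : Cfix `<=` Ck. Proof. by move=> v []. Qed.
Local Notation sd := (sdual O sigma H).
Local Notation rep := (rep O (wint L) (wstr L pi) chi e0).
Local Notation emb := (fun c : 'rV[Wk]_n => c *m e0).
Implicit Types (A : set 'rV[Wk]_(n.*2)) (Z : set 'rV[Wk]_n).

Let rep_v A Z a : rep A Z a -> isvol O piW Z a.
Proof. exact: (rep_isvol pv_chi). Qed.
Let rep_st A Z a : rep A Z a -> stable sigma Z.
Proof. exact: (rep_stable dvrk sigma_int sigma_pi sigma_chi wfrob2). Qed.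
Let rep_le A Z a A' Z' a' : rep A Z a -> rep A' Z' a' -> A `<=` A' <-> Z `<=` Z'.
Proof. exact: (rep_sub dvrk chi_int pv_chi e0free). Qed.
Let rep_du A Z a : rep A Z a -> rep (dualC A) (sd Z) (- a - vH).
Proof.
exact: (rep_dual dvrk chi_int pv_chi sigma_int sigma_pi sigma_chi wfrob2 fixed Hu hermH
  UE U'U U'E bE).
Qed.
Let rep_sc A Z a i : rep A Z a ->
  rep (scale (piW ^+ i) A) (scale (piW ^+ i) Z) (a + (n * i)%:Z).
Proof. exact: (rep_scale dvrL chi_pi). Qed.

Lemma vertex_rep i t0 A : vertex_ge chi phi0 delta D i t0 A -> exists Z a,
  [/\ rep A Z a, scale (piW ^+ i.+1) (sd Z) `<=` Z, Z `<=` scale (piW ^+ i) (sd Z)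
    & t0%:Z <= (n * i.+1)%:Z - vH - a - a].
Proof.
move=> [[lA A1 A2] [t tA tle]].
have [Z [a AZ]] : exists Z a, rep A Z a by apply: (rep_ex O (wstr L pi) fixed e0free UE U'E lA).
exists Z, a; have R1 := rep_sc i.+1 (rep_du AZ); have R2 := rep_sc i (rep_du AZ).
split=> //; [exact/(rep_le R1 AZ)|exact/(rep_le AZ R2)|].
have aE := rep_colength dvrL e0free R1 AZ tA.
move: aE tle; move: (pival _ _ _) (n * _)%N => v N; clear; lia.
Qed.

Lemma scale_scale (K : fieldType) d (u v : K) (B : set 'rV[K]_d) :
  scale u (scale v B) = scale (u * v) B.
Proof.
apply/seteqP; split=> [_ [_ [c Bc <-] <-]|_ [c Bc <-]].
  by exists c; rewrite // scalerA.
by exists (v *: c); [exists c|rewrite scalerA].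
Qed.

Lemma vertex0_rep t0 A : vertex_ge chi phi0 delta D 0 t0 A -> exists Z a,
  [/\ rep A Z a, Z `<=` sd Z, scale piW (sd Z) `<=` Z & t0%:Z <= n%:Z - vH - a - a].
Proof.
move=> /vertex_rep[Z [a [AZ Z1 Z2 t]]]; exists Z, a; rewrite muln1 in t; split=> //.
apply: subset_trans Z2 _ => _ [c Zc <-].
by rewrite expr0 scale1r.
Qed.

Lemma vertex1_rep t0 A : vertex_ge chi phi0 delta D 1 t0 A -> exists Z a,
  [/\ rep A Z a, scale piW (scale piW (sd Z)) `<=` Z, Z `<=` scale piW (sd Z)
    & t0%:Z <= n%:Z + n%:Z - vH - a - a].
Proof.
move=> /vertex_rep[Z [a [AZ Z1 Z2 t]]]; exists Z, a; split=> //; last by move: t; clear; lia.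
by rewrite scale_scale -expr2.
Qed.

Variable x : bt_data n Wk m.
Hypothesis Hx : bt_index chi phi0 delta D h x.

Let ord_neq0 (i : 'I_m.+1) : (i != ord0) = (0 < i)%N.
Proof. by rewrite -val_eqE /= lt0n. Qed.

Let ord_neq_max (i : 'I_m.+1) : (i != ord_max) = (i < m)%N.
Proof. by rewrite -val_eqE /= ltn_neqAle -ltnS ltn_ord andbT. Qed.

Lemma index_rep y : bt_index chi phi0 delta D h y -> exists Z0 Z1 : 'I_m.+1 -> set 'rV[Wk]_n,
  exists a0 a1 : 'I_m.+1 -> int,
  [/\ forall i, i \in bt_I y -> (0 < i)%N -> [/\ rep (Lam0 y i) (Z0 i) (a0 i),
        Z0 i `<=` sd (Z0 i), scale piW (sd (Z0 i)) `<=` Z0 i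
        & (h i)%:Z + 1 <= n%:Z - vH - a0 i - a0 i],
      forall i, i \in bt_I y -> (i < m)%N -> [/\ rep (Lam1 y i) (Z1 i) (a1 i),
        scale piW (scale piW (sd (Z1 i))) `<=` Z1 i, Z1 i `<=` scale piW (sd (Z1 i))
        & n%:Z - (h i.+1)%:Z + 1 <= n%:Z + n%:Z - vH - a1 i - a1 i],
      forall i, i \in bt_I y -> (0 < i < m)%N -> Z0 i `<=` scale piW (sd (Z1 i))
    & forall i i', i \in bt_I y -> i' \in bt_I y -> (i < i')%N ->
        scale piW (sd (Z1 i)) `<=` Z0 i'].
Proof.
move=> Hy.
have ex0 (i : 'I_m.+1) : exists Za, i \in bt_I y -> (0 < i)%N ->
    [/\ rep (Lam0 y i) Za.1 Za.2, Za.1 `<=` sd Za.1, scale piW (sd Za.1) `<=` Za.1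
      & (h i).+1%:Z <= n%:Z - vH - Za.2 - Za.2].
  have [/andP[Ii i0]|no] := boolP ((i \in bt_I y) && (0 < i)%N); last first.
    by exists (set0, 0) => Ii i0; rewrite Ii i0 in no.
  rewrite -ord_neq0 in i0; have [Z [a HZ]] := vertex0_rep (bt_Lam0 Hy Ii i0).
  by exists (Z, a).
have ex1 (i : 'I_m.+1) : exists Za, i \in bt_I y -> (i < m)%N ->
    [/\ rep (Lam1 y i) Za.1 Za.2, scale piW (scale piW (sd Za.1)) `<=` Za.1,
        Za.1 `<=` scale piW (sd Za.1) & (n - h i.+1).+1%:Z <= n%:Z + n%:Z - vH - Za.2 - Za.2].
  have [/andP[Ii im]|no] := boolP ((i \in bt_I y) && (i < m)%N); last first.
    by exists (set0, 0) => Ii im; rewrite Ii im in no.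
  rewrite -ord_neq_max in im; have [Z [a HZ]] := vertex1_rep (bt_Lam1 Hy Ii im).
  by exists (Z, a).
have [F0 P0] := choice ex0; have [F1 P1] := choice ex1.
exists (fun i => (F0 i).1), (fun i => (F1 i).1), (fun i => (F0 i).2), (fun i => (F1 i).2).
split.
- move=> i Ii i0; have [R1 R2 R3 R4] := P0 i Ii i0; split=> //.
  by move: R4; move: (pival _ _ _) => v; clear; lia.
- move=> i Ii im; have [R1 R2 R3 R4] := P1 i Ii im; split=> //.
  have hn : (h i.+1 <= n)%N by apply: h_le; rewrite im.
  by move: R4 hn; move: (pival _ _ _) => v; clear; lia.
- move=> i Ii /andP[i0 im]; have [R _ _ _] := P0 i Ii i0; have [R' _ _ _] := P1 i Ii im.
  have := bt_incl01 Hy Ii; rewrite ord_neq0 ord_neq_max => /(_ i0 im).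
  by move=> ii; apply/(rep_le R (rep_sc 1%N (rep_du R'))).
- move=> i i' Ii Ii' ii'; have i0 : (0 < i')%N by apply: leq_ltn_trans ii'.
  have im : (i < m)%N by apply: leq_trans ii' _; rewrite -ltnS.
  have [R _ _ _] := P0 i' Ii' i0; have [R' _ _ _] := P1 i Ii im.
  by apply/(rep_le (rep_sc 1%N (rep_du R')) R); apply: (bt_incl10 Hy Ii Ii' ii').
Qed.

Lemma open_stratum_ex : exists A B : nat -> set 'rV[Wk]_(n.*2),
  open_stratum chi phi0 delta D h x A B.
Proof.
have [Z0 [Z1 [a0 [a1 [X0 X1 X01 X10]]]]] := index_rep Hx.
pose I i := (i <= m)%N && (inord i \in bt_I x).
pose o i : 'I_m.+1 := inord i.
have oE i : (i <= m)%N -> o i = i :> nat by move=> im; rewrite inordK.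
have oI (i : 'I_m.+1) : o i = i by rewrite /o inord_val.
have II (i : 'I_m.+1) : I i = (i \in bt_I x) by rewrite /I inord_val -ltnS ltn_ord.
pose Pl i := scale piW (sd (Z1 (o i))).
have Z1st i : i \in bt_I x -> (i < m)%N -> sd (sd (Z1 i)) = Z1 i.
  move=> Ii im; have [R _ _ _] := X1 i Ii im.
  exact: (sdual_sdual_stable dvrk frobVK sigma_int sigma_pi Hu hermH (rep_v R) (rep_st R)).
have PlE i : I i -> (i < m)%N -> scale piW (sd (Pl i)) = Z1 (o i).
  move=> /andP[im Ii] lim; rewrite /Pl (scale_sdual_scale dvrk sigma_pi) Z1st //.
  by rewrite oE.
have frE : forall a, residue_frob Wk a = a ^+ #|Fq| by [].
have q1 : (1 < #|Fq|)%N := card_finNzRing_gt1 Fq.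
have [|||||A [B [AB mono BL AL [mid low high]]]] := core_chain dvrk frobVK sigma_int sigma_pi
  q1 frE (@wfrob_red _ _ _ _ _ _ _ Wk) two_neq0 Hu hermH
  hz h_mono h_le (I := I) (L0 := Z0 \o o) (Pl := Pl).
- have /set0Pn[i Ii] := bt_neq0 Hx; exists i; first by rewrite -ltnS ltn_ord.
  by rewrite II.
- move=> i /andP[im Ii] /andP[i0 _]; exists (a0 (o i)).
  have [|R R1 R2 R3] := X0 _ Ii; first by rewrite oE.
  by rewrite oE // in R3; split=> //; [exact: rep_v R|exact: rep_st R].
- move=> i /andP[im Ii] lim; exists (n%:Z - a1 (o i) - vH).
  have [|R R1 R2 R3] := X1 _ Ii; first by rewrite oE.
  have PE : scale piW (sd (Pl i)) = Z1 (o i) by apply: PlE; rewrite ?/I ?im.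
  have sP : stable sigma (Pl i).
    apply: stable_scale => //.
    exact: (stable_sdual dvrk frobVK sigma_int sigma_pi hermH (rep_st R)).
  have vP : isvol O piW (Pl i) (n%:Z - a1 (o i) - vH).
    exact: (isvol_scale_sdual dvrk sigma_int sigma_pi Hu (rep_v R)).
  split=> //; last 2 first.
  + by rewrite PE.
  + rewrite oE // in R3; move: R3; move: (pival _ _ _) (a1 _) => v a; clear; lia.
  (* The upper bound in the definition of [Pl] as [pi Z1^v] gives [pi Pl] inside [Z1 = pi Pl^v];
     cancelling [pi] yields the inclusion of [Pl] in its dual. *)
  move=> v Pv; have : scale piW (sd (Pl i)) (piW *: v) by rewrite PE; apply: R1; exists v.
  by move/(scaleP _ _ piW0); rewrite scalerA mulVf // scale1r.
- by move=> i /andP[im Ii] im'; apply: (X01 _ Ii); rewrite oE.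
- move=> i i' /andP[im Ii] /andP[im' Ii'] /andP[ii' _]; apply: X10 => //.
  by rewrite !oE.
have embdk Z : dualk (emb @` Z) = emb @` sd Z by exact: (emb_dual _ UE bE).
have embsc Z : scale piW (emb @` Z) = emb @` scale piW Z by exact: emb_scale.
have embS Z Z' : emb @` Z `<=` emb @` Z' <-> Z `<=` Z' by exact: (emb_sub e0free).
have embC Z Z' t : colength O Z Z' t -> colength O (emb @` Z) (emb @` Z') t.
  exact: (emb_colength e0free).
have ext A0 Z a : rep A0 Z a -> extend O A0 = emb @` Z.
  exact: (rep_extend dvrk chi_int pv_chi).
exists (fun i => emb @` A i), (fun i => emb @` B i); split.
  split; first split.
  - move=> i im; have [[a vA] [b vB] _ _ _ _ _ _] := AB i im.
    by split; [exact: (emb_lattice e0free UE vA)|exact: (emb_lattice e0free UE vB)].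
  - by move=> i im; have [mA mB] := mono i im; split; apply/embS.
  - move=> i im; have [_ _ c1 c2 c3 c4 c5 c6] := AB i im.
    rewrite !embdk !embsc; split; [exact: embC|exact/embS|exact: embC|exact/embS|].
    by split; [exact/embS|exact: embC].
  - move=> i Ii; rewrite ord_neq0 => i0; have [R _ _ _] := X0 _ Ii i0.
    rewrite (ext _ _ _ R); apply/embS; rewrite -[i in Z0 i]oI.
    by have [] := BL i; rewrite ?II // i0 -ltnS ltn_ord.
  move=> i Ii; rewrite ord_neq_max => im; have [R _ _ _] := X1 _ Ii im.
  rewrite (ext _ _ _ R); apply/embS; rewrite -[i in Z1 i]oI -PlE ?II //.
  by have [] := AL i; rewrite ?II.
(* Strictness of [y < x] contains the failure of [x <= y], so it suffices to derive [x <= y] from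
   membership in the closed stratum of [y]. *)
move=> [y [Hy [_ nle] [_ cB cA]]]; apply: nle.
have [W0 [W1 [c0 [c1 [Y0 Y1 Y01 _]]]]] := index_rep Hy.
have BW (i : 'I_m.+1) : i \in bt_I y -> (0 < i)%N -> B i `<=` W0 i.
  move=> Ii i0; have [R _ _ _] := Y0 _ Ii i0; apply/embS; rewrite -(ext _ _ _ R).
  by apply: cB; rewrite ?ord_neq0.
have AW (i : 'I_m.+1) : i \in bt_I y -> (i < m)%N -> A i.+1 `<=` W1 i.
  move=> Ii im; have [R _ _ _] := Y1 _ Ii im; apply/embS; rewrite -(ext _ _ _ R).
  by apply: cA; rewrite ?ord_neq_max.
have sub A0 Z a : rep A0 Z a -> submodule O Z by move=> /rep_v/(isvol_submodule dvrk).
have yx i : i \in bt_I y -> i \in bt_I x.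
  move=> Ii; apply: contrapT => /negP; rewrite -II => nI.
  have im : (i <= m)%N by rewrite -ltnS.
  (* At the ends a single lattice of [y] gives the contradiction: for [i = 0] the lattice [W1] lies
     between [A 1] and [pi] times the dual of [A 1], and for [i = m] the lattice [W0] between [B m]
     and its dual. *)
  have [i0|i0] := posnP i.
    have lim : (i < m)%N by rewrite i0.
    have [R _ R2 _] := Y1 _ Ii lim; rewrite i0 in nI.
    have AWi := AW _ Ii lim; rewrite i0 in AWi.
    apply: (low (W1 i) nI m_gt0 (sub _ _ _ R) (rep_st R) AWi).
    exact: subset_trans R2 (scaleS (sdualS AWi)).
  have [lim|] := ltnP i m.
    have [R0 _ _ _] := Y0 _ Ii i0; have [R1 _ _ _] := Y1 _ Ii lim.
    have ii : (0 < i < m)%N by rewrite i0.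
    apply: (mid i (W0 i) nI ii (sub _ _ _ R0) (rep_st R0) (BW _ Ii i0)).
    exact: subset_trans (Y01 _ Ii ii) (scaleS (sdualS (AW _ Ii lim))).
  move=> mi; have iE : i = m :> nat by apply/eqP; rewrite eqn_leq im.
  have [R0 R1 _ _] := Y0 _ Ii i0; have BWi := BW _ Ii i0; rewrite iE in nI BWi.
  apply: (high (W0 i) nI m_gt0 (sub _ _ _ R0) (rep_st R0) BWi).
  exact: subset_trans R1 (sdualS BWi).
split=> [|i Iy|i Iy].
- by apply/fintype.subsetP => i /yx.
- rewrite ord_neq0 => i0; have Ix := yx _ Iy; have [R _ _ _] := X0 _ Ix i0.
  have [R' _ _ _] := Y0 _ Iy i0; apply/(rep_le R R').
  have Ii : I i by rewrite II.
  have i0m : (0 < i <= m)%N by rewrite i0 -ltnS ltn_ord.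
  have [_ gen] := BL i Ii i0m.
  by have := gen _ (sub _ _ _ R') (rep_st R') (BW _ Iy i0); rewrite /= oI.
- rewrite ord_neq_max => im; have Ix := yx _ Iy; have [R _ _ _] := X1 _ Ix im.
  have [R' _ _ _] := Y1 _ Iy im; apply/(rep_le R R').
  have Ii : I i by rewrite II.
  have [_ gen] := AL i Ii im.
  by have := gen _ _ (rep_v R') (rep_st R') (AW _ Iy im); rewrite PlE // oI.
Qed.

End OpenStratum.

Theorem corollary4p4
  (* F / Q_p, its uniformizer and residue field *)
  (p : nat) (p_prime : prime p) (p_odd : odd p)
  (Qp : fieldType) (Zp : set Qp) (HQp : padic_numbers p Zp)
  (F : fieldExtType Qp) (pi : F)
  (Hpi : uniformizer (integral_closure Zp F) pi)
  (Fq : finFieldType) (resF : F -> Fq)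
  (HresF : residue_map (integral_closure Zp F) pi resF)
  (* the unramified quadratic extension E / F *)
  (E : fieldExtType F) (degE : \dim {:E} = 2%N)
  (unramE : uniformizer (integral_closure (integral_closure Zp F) E) (pi%:A))
  (conjE : {rmorphism E -> E}) (conjE_F : forall a : F, conjE a%:A = a%:A)
  (conjE_neq : exists x, conjE x != x)
  (* its residue field, and an algebraic closure kappa of the latter *)
  (Fq2 : finFieldType) (j2 : {rmorphism Fq -> Fq2})
  (cardFq2 : #|Fq2| = (#|Fq| ^ 2)%N)
  (kappa : closedFieldType) (jkappa : {rmorphism Fq2 -> kappa})
  (kappa_alg : forall a : kappa, algebraicOver jkappa a)
  (L : rel_witt (integral_closure Zp F) pi resF j2)
  (phi0 : {rmorphism E -> L}) (phi0_bij : bijective phi0)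
  (phi0_F : forall a : F, phi0 a%:A = wstr L a)
  (* discrete parameters and framing objects *)
  (n m : nat) (n_gt0 : (0 < n)%N) (m_gt0 : (0 < m)%N)
  (h : nat -> nat)
  (h_incr : forall i i', (1 <= i)%N -> (i < i')%N -> (i' <= m)%N -> (h i < h i')%N)
  (h_le : forall i, (1 <= i <= m)%N -> (h i <= n)%N)
  (h_parity : forall i i', (1 <= i <= m)%N -> (1 <= i' <= m)%N ->
     odd (h i) = odd (h i'))
  (D : isocrystal E n L) (HD : is_isocrystal conjE D) (Dss : supersingular D)
  (M : nat -> set 'rV[L]_(n.*2))
  (HM : framing_chain conjE D (integral_closure (integral_closure Zp F) E)
          phi0 m h M)
  (delta : L) (delta_int : wint L delta) (delta_unit : wint L delta^-1)
  (delta_neq0 : delta != 0) (delta_frob : wfrob L delta = - delta)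
  (* the algebraically closed field k *)
  (k : closedFieldType) (jk : {rmorphism kappa -> k})
  (Wk : rel_witt (integral_closure Zp F) pi resF (jk \o jkappa \o j2))
  (chi : {rmorphism L -> Wk}) (Hchi : witt_map (jk \o jkappa) chi)
  (x : bt_data n Wk m) (Hx : bt_index chi phi0 delta D h x) :
  exists A B : nat -> set 'rV[Wk]_(n.*2), open_stratum chi phi0 delta D h x A B.
Proof.
have OFpi := OF_pi Hpi; have pi0 := uniformizer_neq0 HQp Hpi.
have subF := integral_closure_subring (padic_subring HQp) F.
have wphi := wfrob_phi0 HQp Hpi degE conjE_F conjE_neq cardFq2 phi0_bij phi0_F.
have wfr2 := wfrob2 HQp Hpi degE conjE_F conjE_neq cardFq2 phi0_bij phi0_F.
have two2 : 2%:R != 0 :> Fq2 := witt_two_neq0 p_odd HQp Hpi L.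
have twok : 2%:R != 0 :> k := witt_two_neq0 p_odd HQp Hpi Wk.
have [th [OEth Oth redth]] :=
  unramified_generator HQp Hpi degE conjE_F conjE_neq cardFq2 phi0_bij phi0_F.
have cth : conjE th != th by apply: contraNneq redth => ->.
have [c [d [gen_th conj_th th2]]] := conj_quadratic degE conjE_F cth.
have h1m : (1 <= 1 <= m)%N by rewrite m_gt0.
have [f0 [Hf [l [[f0free f0e f0T] HfE Hfu lo vHf]]]] :=
  framing_hermitian OFpi pi0 phi0_F wphi wfr2 two2 OEth Oth redth conj_th th2 HD
    (frc_object HM h1m) n_gt0 delta_int delta_unit delta_neq0.
(* An [L]-basis of [C] is read off from any lattice of the index: [0] carries [Lam1] because [m] is
   positive, every other element carries [Lam0]. *)
have [A lA] : exists A, latticeC chi phi0 D A.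
  have /set0Pn[i Ii] := bt_neq0 Hx.
  have [i0|i0] := eqVneq i ord0.
    have im : i != ord_max by rewrite i0 -val_eqE /= eq_sym -lt0n.
    by have [[lA _ _] _] := bt_Lam1 Hx Ii im; exists (Lam1 x i).
  by have [[lA _ _] _] := bt_Lam0 Hx Ii i0; exists (Lam0 x i).
have yy : phi0 th - phi0 (conjE th) != 0.
  by apply: contraNneq redth => /eqP; rewrite subr_eq0 => /eqP ->.
have [e0 [H [[e0free UE] U'E bE [Hu hermH] [w vH]]]] :=
  coordinates OFpi pi0 Hchi delta_frob (iso_FV wfr2 HD) (frob_unit OFpi pi0 wfr2 HD)
    (frob_gram wfr2 HD) (gram_tr HD) f0free (fun e => eig_actE phi0_F gen_th HD e f0T) f0e
    (mulVf yy) HfE Hfu lA.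
rewrite vHf in vH.
have exz i : exists zi : int, (1 <= i <= m)%N ->
    (h i)%:Z = n%:Z - pival (wint Wk) (wstr Wk pi) (\det H) - 1 + zi + zi.
  have [im|no] := boolP (1 <= i <= m)%N; last by exists 0.
  (* Since [v(det H) = h_1 + n - l + 2 w], the equation becomes [2 z = h_i + h_1 - (l - 1) + 2 w],
     soluble because [l] is odd and [h_i], [h_1] have the same parity. *)
  exists (((h i + h 1%N)./2)%:Z - (l./2)%:Z + w) => _; rewrite vH.
  have hh : ~~ odd (h i + h 1%N) by rewrite oddD (h_parity i 1%N) // addbb.
  have := odd_double_half (h i + h 1%N); rewrite (negPf hh) add0n.
  have := odd_double_half l; rewrite lo; clear; lia.
have [z hz] := choice exz.
apply: (open_stratum_ex OFpi pi0 Hchi cardFq2 wfr2 twok Hu hermH e0free UE U'E bE m_gt0 hz _ h_le Hx).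
move=> i i' i0 /andP[]; rewrite leq_eqVlt => /orP[/eqP-> //|ii'] i'm.
by apply/ltnW/h_incr.
Qed.
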